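(* Suppose no sample splitting is performed, and let $\hat\psi^{\mathrm{NR}}_k$ be the Newey and Robins plug-in estimator without sample splitting of $\psi(\mathbb P)=\mathbb E_{\mathbb P}[\mathrm{Cov}_{\mathbb P}(A,Y\mid X)]$ defined in the context. Then $$\sup_{\mathbb P\in\mathcal P_{(\alpha,\beta)}}\left|\mathbb E_{\mathbb P}\left(\hat\psi^{\mathrm{NR}}_{k}-\psi(\mathbb P)\right)\right|\asymp k^{-(\alpha+\beta)/d}\vee\frac kn,\qquad \sup_{\mathbb P\in\mathcal P_{(\alpha,\beta)}}\mathrm{Var}_{\mathbb P}(\hat\psi^{\mathrm{NR}}_{k})\lesssim\frac1n+\frac{k}{n^2}+\frac{k^2}{n^3}.$$
   Context: Notation. $a\vee b=\max(a,b)$; integrals are over $[0,1]^d$. For nonnegative sequences, $a_n\lesssim b_n$ means there is a constant $C>0$ with $a_n\le Cb_n$ for all $n\ge n_0$; $a_n\gtrsim b_n$ means $b_n\lesssim a_n$; $a_n\asymp b_n$ means both. The resolution $k$ may depend on $n$; implicit constants do not depend on $n$ or $k$. Wavelets. Fix a compactly supported Cohen–Daubechies–Vial type orthonormal wavelet basis $\{\Phi_{J_0m},\Psi^{\iota}_{lm'}: m\in\mathcal Z_{J_0},\,m'\in\mathcal Z_l,\,\iota\in\{0,1\}^d\setminus\{0\},\,l\ge J_0\}$ of $L^2([0,1]^d)$ of regularity $S\ge1$, $S>\alpha\vee\beta$, with $2^{J_0}\ge S$, $|\mathcal Z_l|\asymp 2^{ld}$. For $j\ge J_0$ let $V_j=\mathrm{span}\{\Phi_{jm}:m\in\mathcal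 Z_j\}$ ($\{\Phi_{jm}\}_m$ the orthonormal scaling functions at level $j$; the $V_j$ are nested). A resolution is a number $k=2^{jd}$, $j\ge J_0$; write $V_k,\Phi_{km},\mathcal Z_k$ for $V_j,\Phi_{jm},\mathcal Z_j$. Standard properties: $|\Phi_{km}|\lesssim\sqrt k$ uniformly with support in a set of Lebesgue measure $O(1/k)$; $V_k$ contains all polynomials of degree at most $S-1$. The projection kernel is $K_{V_k}(x,y)=\sum_{m\in\mathcal Z_k}\Phi_{km}(x)\Phi_{km}(y)$. Hölder ball. $H(\alpha,M)$ is the set of uniformly continuous $h:[0,1]^d\to\mathbb R$ with $2^{J_0(\alpha+d/2)}\max_m|\langle h,\Phi_{J_0m}\rangle|+\sup_{l\ge J_0,m\in\mathcal Z_l,\iota}2^{l(\alpha+d/2)}|\langle h,\Psi^\iota_{lm}\rangle|\le M$. Model. $\mathcal P_{(\alpha,\beta)}$ is the set of distributions $\mathbb P$ of $(X,A,Y)\in[0,1]^d\times\mathbb R\times\mathbb R$ with $X\sim\mathrm{Uniform}([0,1]^d)$, $A,Y\in[C_1,C_2]$ a.s., $p(x):=\mathbb E_{\mathbb P}[A\mid X=x]\in H(\alpha,M)$ and $b(x):=\mathbb E_{\mathbb P}[Y\mid X=x]\in H(\beta,M)$, where $C_1,C_2\in\mathbb R$, $\alpha,\beta,M>0$ are fixed known constants. The functional is $\psi(\mathbb P)=\mathbb E_{\mathbb P}[\mathrm{Cov}_{\mathbb P}(A,Y\mid X)]$. Estimator. Let $\mathcal D_1$ be a sample of $n$ i.i.d.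 observations from $\mathbb P$. Put $\hat b_k(x)=\frac1n\sum_{i\in\mathcal D_1}Y_iK_{V_k}(X_i,x)$ and $\hat\psi^{\mathrm{NR}}_k=\frac1n\sum_{i\in\mathcal D_1}A_i(Y_i-\hat b_k(X_i))$.
   Formalization: The lower bound in the bias relation ≍ is proved assuming that, for α and for β, some function has Hölder norm strictly below M and values strictly inside [C1,C2]; without this it fails, e.g. for C1 = C2 = 0 (zero bias) or M so small that the model is empty. *)

(* Defs.v *)
From HB Require Import structures.
From mathcomp Require Import all_boot all_order all_algebra.
From mathcomp Require Import all_classical all_reals all_analysis.

Set Implicit Arguments.
Unset Strict Implicit.
Unset Printing Implicit Defensive.

Import Order.TTheory GRing.Theory Num.Theory.
Import numFieldNormedType.Exports.

Local Open Scope classical_set_scope.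
Local Open Scope ring_scope.

Section power.
Context {dT : measure_display} {T : measurableType dT} {R : realType}.

Definition tcons n (u : T * n.-tuple T) : n.+1.-tuple T :=
  [tuple of u.1 :: u.2].

Lemma measurable_tcons n : measurable_fun setT (@tcons n).
Proof. by apply: measurable_cons; [exact: measurable_fst|exact: measurable_snd]. Qed.

HB.instance Definition _ n := isMeasurableFun.Build _ _ _ _ (@tcons n)
  (@measurable_tcons n).

(* The n-fold product of P: the law of n i.i.d. draws from P. *)
Fixpoint power_prob (P : probability T R) n : probability (n.-tuple T) R :=
  match n with
  | 0 => \d_([tuple] : 0.-tuple T)
  | m.+1 => distribution (P \x power_prob P m)%E (@tcons m)
  end.

End power.

Section space.
Context (R : realType) (d : nat).

(* Functions on [0,1]^d are represented by functions on R^d; every notion below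
   depends on their values on the cube only, up to null sets. *)
Definition point := d.-tuple (measurableTypeR R).

Definition cube : set point := [set x | forall i, 0 <= tnth x i <= 1].

Definition unif : probability point R := power_prob (uniform_prob (@ltr01 R)) d.

Definition inner (f g : point -> R) : R := \int[unif]_(x in cube) (f x * g x).

Definition unif_cont (h : point -> R) : Prop :=
  forall eps : R, 0 < eps -> exists2 delta : R, 0 < delta &
    forall x y : point, cube x -> cube y ->
      (forall i, `|tnth x i - tnth y i| < delta) -> `|h x - h y| < eps.

Definition wtype : finType :=
  {iota : {ffun 'I_d -> bool} | iota != [ffun=> false]}.

(* Compactly supported orthonormal multiresolution basis of L^2([0,1]^d) of
   Cohen-Daubechies-Vial type and regularity S, starting at level J0.  Only the
   structural properties of such bases are required, so that every CDV basis is
   an instance, after extending its elements by 0 outside the cube (and so is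
   the Haar basis, S = 1); in particular iota is a mere label of the 2^d - 1
   kinds of wavelets, no tensor-product form being imposed. *)
Record cdv_basis (S J0 : nat) := CdvBasis {
  Z : nat -> finType ;
  Phi : forall j, Z j -> point -> R ;
  Psi : forall l, wtype -> Z l -> point -> R ;
  regularity_ge1 : (1 <= S)%N ;
  coarsest_level : (S <= 2 ^ J0)%N ;
  card_Z : exists c C : R, 0 < c /\ forall j, (J0 <= j)%N ->
    c * 2 ^+ (j * d) <= #|Z j|%:R <= C * 2 ^+ (j * d) ;
  measurable_Phi : forall j m, measurable_fun setT (@Phi j m) ;
  measurable_Psi : forall l iota m, measurable_fun setT (@Psi l iota m) ;
  bounded_basis : exists C : R, forall j, (J0 <= j)%N -> forall (m : Z j) x,
    `|Phi m x| <= C * Num.sqrt (2 ^+ (j * d)) /\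
    forall iota, `|Psi iota m x| <= C * Num.sqrt (2 ^+ (j * d)) ;
  (* supports of diameter O(2^-j), hence of Lebesgue measure O(2^(-jd)) *)
  compact_support : exists C : R, forall j, (J0 <= j)%N -> forall m : Z j,
    (exists x0 : point, forall x, Phi m x != 0 ->
      forall i, `|tnth x i - tnth x0 i| <= C / 2 ^+ j) /\
    (forall iota, exists x0 : point, forall x, Psi iota m x != 0 ->
      forall i, `|tnth x i - tnth x0 i| <= C / 2 ^+ j) ;
  (* at each level, the supports have bounded overlap *)
  locally_finite : exists N : nat, forall j, (J0 <= j)%N -> forall x : point,
    (#|[pred m : Z j | Phi m x != 0%R]| <= N)%N /\
    forall iota, (#|[pred m : Z j | Psi iota m x != 0%R]| <= N)%N ;
  orthonormal_Phi : forall j, (J0 <= j)%N -> forall m m' : Z j,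
    inner (Phi m) (Phi m') = (m == m')%:R ;
  orthonormal_Psi : forall l, (J0 <= l)%N -> forall iota iota' (m m' : Z l),
    inner (Psi iota m) (Psi iota' m') = ((iota == iota') && (m == m'))%:R ;
  orthogonal_Psi : forall l l', (J0 <= l)%N -> (J0 <= l')%N -> l != l' ->
    forall iota iota' (m : Z l) (m' : Z l'),
    inner (Psi iota m) (Psi iota' m') = 0 ;
  orthogonal_Phi_Psi : forall l, (J0 <= l)%N ->
    forall iota (m : Z J0) (m' : Z l), inner (Phi m) (Psi iota m') = 0 ;
  (* the span of {Phi_(J0,m), Psi^iota_(l,m)} is dense in L^2([0,1]^d) *)
  complete : forall f : point -> R, measurable_fun setT f ->
    (\int[unif]_(x in cube) (f x ^+ 2)%:E < +oo)%E ->
    forall eps : R, 0 < eps ->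
    exists (L : nat) (c : Z J0 -> R) (w : forall l, wtype -> Z l -> R),
      (\int[unif]_(x in cube) ((f x - \sum_m c m * Phi m x
         - \sum_(J0 <= l < L) \sum_iota \sum_m w l iota m * Psi iota m x) ^+ 2)%:E
       < eps%:E)%E ;
  (* V_(l+1) = V_l + W_l in L^2, where W_l is the span of the wavelets at
     level l; in particular the V_l are nested *)
  multiresolution : forall l, (J0 <= l)%N -> forall f : point -> R,
    (exists c : Z l.+1 -> R,
       {ae unif, forall x, cube x -> f x = \sum_m c m * Phi m x}) <->
    (exists (c : Z l -> R) (w : wtype -> Z l -> R),
       {ae unif, forall x, cube x -> f x = \sum_m c m * Phi m x
          + \sum_iota \sum_m w iota m * Psi iota m x}) ;
  (* V_j contains the monomials, hence all polynomials, of degree <= S - 1 *)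
  polynomials : forall j, (J0 <= j)%N ->
    forall e : 'I_d -> nat, (\sum_i e i <= S.-1)%N ->
    exists c : Z j -> R, {ae unif, forall x, cube x ->
      \prod_i tnth x i ^+ e i = \sum_m c m * Phi m x}
}.

End space.

Section model.
Context (R : realType) (d S J0 : nat) (W : cdv_basis R d S J0).

(* Projection kernel of V_k for k = 2^(jd). *)
Definition proj_kernel (j : nat) (x y : point R d) : R :=
  \sum_(m : Z W j) Phi m x * Phi m y.

Definition holder_ball (alpha M : R) : set (point R d -> R) :=
  [set h | unif_cont h /\
    ((2 `^ (J0%:R * (alpha + d%:R / 2)) *
        \big[Num.max/0]_(m : Z W J0) `|inner h (Phi m)|)%:E
     + ereal_sup [set z | exists l iota (m : Z W l), (J0 <= l)%N /\
         z = (2 `^ (l%:R * (alpha + d%:R / 2)) * `|inner h (Psi iota m)|)%:E]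
     <= M%:E)%E].

(* An observation (X, (A, Y)). *)
Definition obs := (point R d * (measurableTypeR R * measurableTypeR R))%type.

Definition Xo (o : obs) : point R d := o.1.
Definition Ao (o : obs) : R := o.2.1.
Definition Yo (o : obs) : R := o.2.2.

(* f is a version of x |-> E_P[Q | X = x]. *)
Definition is_cond_exp (P : probability obs R) (Q : obs -> R)
    (f : point R d -> R) : Prop :=
  [/\ measurable_fun setT f, P.-integrable setT (EFin \o (f \o Xo)) &
      forall B, measurable B ->
        (\int[P]_(o in Xo @^-1` B) (Q o)%:E
         = \int[P]_(o in Xo @^-1` B) (f (Xo o))%:E)%E].

Definition cond_exp (P : probability obs R) (Q : obs -> R) : point R d -> R :=
  xget (cst 0) [set f | is_cond_exp P Q f].

Definition cond_cov (P : probability obs R) (Q1 Q2 : obs -> R)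
    : point R d -> R :=
  cond_exp P (fun o => (Q1 o - cond_exp P Q1 (Xo o)) *
                       (Q2 o - cond_exp P Q2 (Xo o))).

Definition psi (P : probability obs R) : R :=
  fine 'E_P[cond_cov P Ao Yo \o Xo]%E.

Definition holder_model (C1 C2 alpha beta M : R) : set (probability obs R) :=
  [set P : probability obs R | [/\
    forall B, measurable B -> P (Xo @^-1` B) = unif R d B,
    {ae P, forall o, C1 <= Ao o <= C2},
    {ae P, forall o, C1 <= Yo o <= C2},
    exists2 p, is_cond_exp P Ao p & holder_ball alpha M p &
    exists2 b, is_cond_exp P Yo b & holder_ball beta M b]].

(* The constraints on a regression function are strictly feasible: some
   function lies in the interior of both the range constraint [C1,C2] and the
   Hoelder-norm constraint.  This excludes degenerate constants, for which the
   bias lower bound fails: e.g. C1 = C2 (Y constant), or M so small that no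
   [C1,C2]-valued function lies in the ball (empty model).  It holds whenever
   C1 < 0 < C2, when C1 = 0 < C2, and for any C1 < C2 once M is large. *)
Definition strictly_feasible (C1 C2 alpha M : R) : Prop :=
  exists2 eps : R, 0 < eps & exists2 h, holder_ball alpha (M - eps) h &
    forall x, cube x -> C1 + eps <= h x <= C2 - eps.

Definition b_hat (j n : nat) (D : n.-tuple obs) (x : point R d) : R :=
  n%:R^-1 * \sum_(i < n) Yo (tnth D i) * proj_kernel j (Xo (tnth D i)) x.

Definition psi_NR (j n : nat) (D : n.-tuple obs) : R :=
  n%:R^-1 * \sum_(i < n) Ao (tnth D i) *
    (Yo (tnth D i) - b_hat j D (Xo (tnth D i))).

Definition max_abs_bias (C1 C2 alpha beta M : R) (n j : nat) : \bar R :=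
  ereal_sup [set `| 'E_(power_prob P n)[fun D => (psi_NR j D - psi P)%R] |%E
            | P in holder_model C1 C2 alpha beta M].

Definition max_variance (C1 C2 alpha beta M : R) (n j : nat) : \bar R :=
  ereal_sup [set variance (power_prob P n) (@psi_NR j n)
            | P in holder_model C1 C2 alpha beta M].

End model.

(* C and n0 are uniform over the resolution level j (with k = 2^(jd)), so that
   j, hence k, may depend on n. *)
Definition lesssim (R : realType) (J0 : nat) (a b : nat -> nat -> \bar R) : Prop :=
  exists2 C : R, 0 < C & exists n0 : nat,
    forall n j, (n0 <= n)%N -> (J0 <= j)%N -> (a n j <= C%:E * b n j)%E.

Definition resolution (R : realType) (d j : nat) : R := 2 ^+ (j * d).

Definition bias_rate (R : realType) (d : nat) (alpha beta : R) (n j : nat)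
    : \bar R :=
  (Num.max (resolution R d j `^ (- ((alpha + beta) / d%:R)))
           (resolution R d j / n%:R))%:E.

Definition variance_rate (R : realType) (d : nat) (n j : nat) : \bar R :=
  (1 / n%:R + resolution R d j / n%:R ^+ 2
   + resolution R d j ^+ 2 / n%:R ^+ 3)%:E.

(* Main.v *)
From HB Require Import structures.
From mathcomp Require Import all_boot all_order all_algebra.
From mathcomp Require Import all_classical all_reals all_analysis.
From mathcomp Require Import measurable_realfun.
From mathcomp Require Import ring lra.
Require Import Defs.

(** Write [a_m = E(A Phi_m(X))] and [b_m = E(Y Phi_m(X))] for the scaling functions
    [Phi_m] of the level [j], with [k = 2^(jd)], and [K] for the projection kernel.

    Upper bounds.  Expanding the kernel turns the estimator into a single sum over
    the sample plus a double sum of products [A_i Phi_m(X_i) Y_l Phi_m(X_l)], so that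
    all its moments reduce to the independence of the draws.  Since
    [psi = E(AY) - <p, b>], where the existence of the conditional covariance and
    the identity itself come from the Radon-Nikodym theorem and the pull-out property
    ([cond_exp_exists], [psiE]), the bias is ([biasE])
    [<p, b> - sum a_m b_m + (sum a_m b_m - E(A Y K(X, X))) / n].
    The first difference is the inner product of the residuals of [p] and [b] modulo
    [V_j]; by the completeness and the multiresolution of the basis, the squared norm
    of a residual is the sum of the squared wavelet coefficients from the level [j]
    on, which the Hoelder bound makes [O(2^(-2 j alpha))] ([residual_holder]).  The
    remaining part is of the order of [k/n], the mean of [K(X, X)] being the dimension
    of [V_j].  For the variance, the Hoeffding decomposition leaves a sum of
    independent terms and a degenerate U-statistic, whose second moment involves the
    trace of a covariance form bounded by Bessel's inequality ([variance_plug_in_le]).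

    Lower bound.  When [A = p(X)] and [Y = b(X)] the bias is a bilinear form [F] in
    [(p, b)].  Averaging [F(p + s g, b + t g')] with the weights [s t] over the four
    sign pairs shows that one of these laws has a bias at least [|F(g, g')|], whatever
    the centre [(p, b)] is ([perturbation_bias_le]); strict feasibility provides the
    centre.  The perturbations are multiples of one cosine wave
    [cos(2 pi kappa . x)].  The basis itself cannot be used: its elements need not be
    continuous.  A wave with frequencies of order [2^j], scaled by [2^(-j alpha)],
    lies in the Hoelder ball, because its Taylor polynomials are orthogonal to the
    wavelets at finer levels ([wave_holder]).  The waves with frequencies up to a
    large multiple of [2^j] are orthogonal and far more numerous than the dimension of
    [V_j], so that, by Bessel's inequality, one of them has half of its energy outside
    [V_j] ([rough_wave_exists]); it yields [k^(-(alpha+beta)/d)] when [k/n] is small.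
    Constants lie in [V_j], for them [F] reduces to the diagonal term, and this yields
    [k/n] ([bias_form_constant]).  [bias_lower] combines the two. *)

Set Implicit Arguments.
Unset Strict Implicit.
Unset Printing Implicit Defensive.

Import Order.TTheory GRing.Theory Num.Theory.
Import numFieldNormedType.Exports.

Local Open Scope classical_set_scope.
Local Open Scope ring_scope.

(** * Expectations of essentially bounded functions *)

Section essentially_bounded.
Context d (T : measurableType d) (R : realType) (P : probability T R).
Implicit Types f g : T -> R.

Definition mean f : R := \int[P]_x f x.

Definition ess_bounded f :=
  measurable_fun setT f /\ exists C, {ae P, forall x, `|f x| <= C}.

Lemma eq_ess_bounded f g : f =1 g -> ess_bounded f -> ess_bounded g.
Proof. by move=> /funext ->. Qed.

Lemma ess_boundedW f C : measurable_fun setT f -> (forall x, `|f x| <= C) ->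
  ess_bounded f.
Proof. by move=> mf fC; split => //; exists C; exact: aeW. Qed.

Lemma ess_bounded_cst c : ess_bounded (fun=> c).
Proof. by apply: (@ess_boundedW _ `|c|); [exact: measurable_cst|]. Qed.

Lemma ess_boundedD f g : ess_bounded f -> ess_bounded g ->
  ess_bounded (fun x => f x + g x).
Proof.
move=> [mf [C fC]] [mg [D gD]]; split; first exact: measurable_funD.
exists (C + D); apply: filterS2 fC gD => x fC gD.
by rewrite (le_trans (ler_normD _ _))// lerD.
Qed.

Lemma ess_boundedM f g : ess_bounded f -> ess_bounded g ->
  ess_bounded (fun x => f x * g x).
Proof.
move=> [mf [C fC]] [mg [D gD]]; split; first exact: measurable_funM.
exists (C * D); apply: filterS2 fC gD => x fC gD.
by rewrite normrM ler_pM.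
Qed.

Lemma ess_boundedZ c f : ess_bounded f -> ess_bounded (fun x => c * f x).
Proof. exact/ess_boundedM/ess_bounded_cst. Qed.

Lemma ess_boundedN f : ess_bounded f -> ess_bounded (fun x => - f x).
Proof.
move=> /(ess_boundedZ (-1)); congr (ess_bounded _).
by apply/funext => x; rewrite mulN1r.
Qed.

Lemma ess_boundedB f g : ess_bounded f -> ess_bounded g ->
  ess_bounded (fun x => f x - g x).
Proof. by move=> bf bg; apply: ess_boundedD => //; exact: ess_boundedN. Qed.

Lemma ess_boundedX f n : ess_bounded f -> ess_bounded (fun x => f x ^+ n).
Proof.
move=> bf; elim: n => [|n IH]; first exact: ess_bounded_cst.
apply: eq_ess_bounded (ess_boundedM bf IH) => x; exact/esym/exprS.
Qed.

Lemma ess_bounded_norm f : ess_bounded f -> ess_bounded (fun x => `|f x|).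
Proof.
move=> [mf [C fC]]; split; first exact: measurableT_comp.
by exists C; apply: filterS fC => x; rewrite normr_id.
Qed.

Lemma ess_bounded_sum (I : Type) (r : seq I) (Q : pred I) (F : I -> T -> R) :
  (forall i, Q i -> ess_bounded (F i)) ->
  ess_bounded (fun x => \sum_(i <- r | Q i) F i x).
Proof.
move=> bF; elim: r => [|i r IH].
  apply: (eq_ess_bounded _ (ess_bounded_cst 0)) => x.
  by rewrite /= big_nil.
apply: (@eq_ess_bounded (fun x => if Q i then F i x + \sum_(j <- r | Q j) F j x
    else \sum_(j <- r | Q j) F j x)) => [x|]; first by rewrite big_cons.
by case Qi: (Q i) => //; apply: ess_boundedD => //; exact: bF.
Qed.

Lemma ess_bounded_prod (I : Type) (r : seq I) (Q : pred I) (F : I -> T -> R) :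
  (forall i, Q i -> ess_bounded (F i)) ->
  ess_bounded (fun x => \prod_(i <- r | Q i) F i x).
Proof.
move=> bF; elim: r => [|i r IH].
  apply: (eq_ess_bounded _ (ess_bounded_cst 1)) => x.
  by rewrite /= big_nil.
apply: (@eq_ess_bounded (fun x => if Q i then F i x * \prod_(j <- r | Q j) F j x
    else \prod_(j <- r | Q j) F j x)) => [x|]; first by rewrite big_cons.
by case Qi: (Q i) => //; apply: ess_boundedM => //; exact: bF.
Qed.

Lemma ess_bounded_integrable f : ess_bounded f ->
  P.-integrable setT (EFin \o f).
Proof.
move=> [mf [C fC]]; apply/integrableP; split; first exact/measurable_EFinP.
have C0 : (0 <= `|C|)%R by [].
apply: (@le_lt_trans _ _ `|C|%:E); last exact: ltry.
rewrite -[leRHS]mule1 -(probability_setT P).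
apply: (@integral_le_bound _ _ _ P _ (EFin \o f) `|C|%:E) => //.
  exact/measurable_EFinP.
by apply: filterS fC => x fC _; rewrite lee_fin (le_trans fC)// ler_norm.
Qed.
Hint Resolve ess_bounded_integrable : core.

Lemma mean_cst c : mean (fun=> c) = c.
Proof.
rewrite /mean Rintegral_cst//.
by have /= -> := probability_setT P; rewrite mulr1.
Qed.

Lemma eq_mean f g : f =1 g -> mean f = mean g.
Proof. by move=> /funext ->. Qed.

Lemma meanD f g : ess_bounded f -> ess_bounded g ->
  mean (fun x => f x + g x) = mean f + mean g.
Proof. by move=> bf bg; rewrite /mean RintegralD//; auto. Qed.

Lemma meanB f g : ess_bounded f -> ess_bounded g ->
  mean (fun x => f x - g x) = mean f - mean g.
Proof. by move=> bf bg; rewrite /mean RintegralB//; auto. Qed.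

Lemma meanZ c f : ess_bounded f -> mean (fun x => c * f x) = c * mean f.
Proof. by move=> bf; rewrite /mean RintegralZl//; auto. Qed.

Lemma mean_sum (I : Type) (r : seq I) (Q : pred I) (F : I -> T -> R) :
  (forall i, Q i -> ess_bounded (F i)) ->
  mean (fun x => \sum_(i <- r | Q i) F i x) = \sum_(i <- r | Q i) mean (F i).
Proof.
move=> bF; elim: r => [|i r IH].
  by rewrite big_nil -[RHS]mean_cst; apply: eq_mean => x; rewrite big_nil.
rewrite big_cons (@eq_mean _ (fun x => if Q i then F i x + \sum_(j <- r | Q j) F j x
    else \sum_(j <- r | Q j) F j x)) => [|x]; last by rewrite big_cons.
case Qi: (Q i) => //; rewrite meanD ?IH//; first exact: bF.
exact: ess_bounded_sum.
Qed.

Lemma ae_eq_mean f g : measurable_fun setT f -> measurable_fun setT g ->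
  {ae P, forall x, f x = g x} -> mean f = mean g.
Proof.
move=> mf mg fg; congr fine; apply: ae_eq_integral => //.
- exact/measurable_EFinP.
- exact/measurable_EFinP.
- by apply: filterS fg => x /= ->.
Qed.

Lemma mean_ge0 f : measurable_fun setT f ->
  {ae P, forall x, 0 <= f x} -> 0 <= mean f.
Proof.
move=> mf f0; rewrite (@ae_eq_mean _ (fun x => `|f x|))//.
- exact: Rintegral_ge0.
- exact: measurableT_comp.
- by apply: filterS f0 => x fx; rewrite ger0_norm.
Qed.

Lemma le_mean f g : ess_bounded f -> ess_bounded g ->
  {ae P, forall x, f x <= g x} -> mean f <= mean g.
Proof.
move=> bf bg fg; rewrite -subr_ge0 -meanB//; apply: mean_ge0.
  by have [] := ess_boundedB bg bf.
by apply: filterS fg => x; rewrite subr_ge0.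
Qed.

Lemma mean_sqr_ge0 f : measurable_fun setT f -> 0 <= mean (fun x => f x ^+ 2).
Proof.
move=> mf; apply: mean_ge0; last by apply: aeW => x; exact: sqr_ge0.
exact: measurable_funX.
Qed.

Lemma le_norm_mean f C : ess_bounded f -> {ae P, forall x, `|f x| <= C} ->
  `|mean f| <= C.
Proof.
move=> bf fC.
apply: (le_trans (le_normr_Rintegral measurableT (ess_bounded_integrable bf))).
rewrite -[leRHS]mean_cst.
exact: (@le_mean (fun x => `|f x|) _ (ess_bounded_norm bf) (ess_bounded_cst C)).
Qed.

Lemma EFin_mean f : ess_bounded f -> (\int[P]_x (f x)%:E = (mean f)%:E)%E.
Proof.
move=> bf; rewrite /mean /Rintegral fineK//.
exact: (integrable_fin_num measurableT (ess_bounded_integrable bf)).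
Qed.

(** The discriminant of the nonnegative quadratic polynomial
    [t |-> mean ((t f + g)^2)] is nonpositive. *)
Lemma mean_cauchy_schwarz f g : ess_bounded f -> ess_bounded g ->
  mean (fun x => f x * g x) ^+ 2
    <= mean (fun x => f x ^+ 2) * mean (fun x => g x ^+ 2).
Proof.
move=> bf bg.
set a := mean (fun x => f x ^+ 2); set c := mean (fun x => g x ^+ 2).
set b := mean _.
have bff := ess_boundedX 2 bf; have bgg := ess_boundedX 2 bg.
have bfg := ess_boundedM bf bg.
have quad t : 0 <= t ^+ 2 * a + 2 * t * b + c.
  have := mean_sqr_ge0 (ess_boundedD (ess_boundedZ t bf) bg).1.
  rewrite (@eq_mean _ (fun x => t ^+ 2 * f x ^+ 2 + 2 * t * (f x * g x)
    + g x ^+ 2)); last by move=> x; ring.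
  rewrite meanD//; last by apply: ess_boundedD; exact: ess_boundedZ.
  by rewrite meanD ?meanZ//; exact: ess_boundedZ.
have a0 : 0 <= a by exact: mean_sqr_ge0 bf.1.
have c0 : 0 <= c by exact: mean_sqr_ge0 bg.1.
have [a00|an0] := eqVneq a 0.
  have [->|b0] := eqVneq b 0; first by rewrite expr0n mulr_ge0.
  have := quad (- (c + 1) / (2 * b)).
  rewrite a00 mulr0 add0r (_ : 2 * _ * b + c = -1); last by field.
  by rewrite ler0N1.
have agt0 : 0 < a by rewrite lt_neqAle eq_sym an0.
have := quad (- b / a).
rewrite (_ : _ + c = (a * c - b ^+ 2) / a); last by field.
by rewrite pmulr_lge0 ?invr_gt0// subr_ge0.
Qed.

End essentially_bounded.

#[global] Hint Resolve ess_bounded_cst ess_bounded_integrable : core.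

Section measure_preserving.
Context d d' (S : measurableType d) (T : measurableType d') (R : realType).
Variables (Q : probability S R) (P : probability T R) (phi : S -> T).
Hypothesis mphi : measurable_fun setT phi.
Hypothesis pphi : forall B, measurable B -> Q (phi @^-1` B) = P B.

Lemma ae_preserving (p : T -> Prop) : {ae P, forall x, p x} ->
  {ae Q, forall x, p (phi x)}.
Proof.
move=> [N [mN N0 pN]]; exists (phi @^-1` N); split.
- by rewrite -[X in measurable X]setTI; exact: mphi.
- by rewrite pphi.
- by move=> x /= px; exact: pN.
Qed.

Lemma ess_bounded_preserving f : ess_bounded P f -> ess_bounded Q (f \o phi).
Proof.
move=> [mf [C fC]]; split; first exact: measurableT_comp.
by exists C; exact: (ae_preserving fC).
Qed.

Lemma mean_preserving f : ess_bounded P f -> mean Q (f \o phi) = mean P f.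
Proof.
move=> bf; congr fine.
have mf : measurable_fun setT (EFin \o f) by apply/measurable_EFinP; case: bf.
have := ess_bounded_integrable (ess_bounded_preserving bf).
rewrite -[X in _.-integrable X](preimage_setT phi) => intf.
have := integral_pushforward mphi mf intf measurableT.
rewrite preimage_setT => <-.
by apply: eq_measure_integral => A mA _; exact: pphi.
Qed.

End measure_preserving.

Section product.
Context d d' (S : measurableType d) (T : measurableType d') (R : realType).
Variables (P : probability S R) (Q : probability T R).

Let fst_preserving B : measurable B -> (P \x Q)%E (fst @^-1` B) = P B.
Proof.
move=> mB; rewrite (_ : fst @^-1` B = B `*` setT); last first.
  by apply/seteqP; split=> -[x y]//= [].
by rewrite product_measure1E// [X in (_ * X)%E]probability_setT mule1.
Qed.

Let snd_preserving B : measurable B -> (P \x Q)%E (snd @^-1` B) = Q B.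
Proof.
move=> mB; rewrite (_ : snd @^-1` B = setT `*` B); last first.
  by apply/seteqP; split=> -[x y]//= [].
by rewrite product_measure1E// [X in (X * _)%E]probability_setT mul1e.
Qed.

Lemma ess_bounded_fst f : ess_bounded P f ->
  ess_bounded (P \x Q)%E (fun z => f z.1).
Proof. exact: (ess_bounded_preserving measurable_fst fst_preserving). Qed.

Lemma ess_bounded_snd f : ess_bounded Q f ->
  ess_bounded (P \x Q)%E (fun z => f z.2).
Proof. exact: (ess_bounded_preserving measurable_snd snd_preserving). Qed.

Lemma mean_prod f g : ess_bounded P f -> ess_bounded Q g ->
  mean (P \x Q)%E (fun z => f z.1 * g z.2) = mean P f * mean Q g.
Proof.
move=> bf bg; apply: EFin_inj.
rewrite -EFin_mean; last first.
  by apply: ess_boundedM; [exact: ess_bounded_fst|exact: ess_bounded_snd].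
rewrite -(integral12_prod_meas1 (f := fun z => (f z.1 * g z.2)%:E))/=; last first.
  apply: (@ess_bounded_integrable _ _ _ (P \x Q)%E (fun z => f z.1 * g z.2)).
  by apply: ess_boundedM; [exact: ess_bounded_fst|exact: ess_bounded_snd].
rewrite (eq_integral (fun x => (mean Q g * f x)%:E)).
  by rewrite EFin_mean ?meanZ// 1?mulrC//; exact: ess_boundedZ.
move=> x _; rewrite /fubini_F/=.
by rewrite (EFin_mean (ess_boundedZ (f x) bg)) meanZ// mulrC.
Qed.

End product.

(** * Moments of independent draws *)

Section power_moments.
Context d (T : measurableType d) (R : realType) (P : probability T R).

Let tcons_preserving n B : measurable B ->
  (P \x power_prob P n)%E (@tcons _ T n @^-1` B) = power_prob P n.+1 B.
Proof. by []. Qed.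

Lemma tnth_preserving n (i : 'I_n) B : measurable B ->
  power_prob P n ((fun D => tnth D i) @^-1` B) = P B.
Proof.
move=> mB; elim: n i => [[]//|n IH] i.
rewrite -tcons_preserving; last first.
  by rewrite -[X in measurable X]setTI; exact: measurable_tnth.
have [j ->|->] := unliftP ord0 i.
  rewrite (_ : _ @^-1` _ = setT `*` ((fun D : n.-tuple T => tnth D j) @^-1` B)).
    rewrite product_measure1E//; last first.
      by rewrite -[X in measurable X]setTI; exact: measurable_tnth.
    by rewrite [X in (X * _)%E]probability_setT mul1e; exact: IH.
  by apply/seteqP; split=> -[x D]/=; rewrite tnthS// => -[].
rewrite (_ : _ @^-1` _ = B `*` setT).
  by rewrite product_measure1E// [X in (_ * X)%E]probability_setT mule1.
by apply/seteqP; split=> -[x D]//= [].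
Qed.

Lemma ess_bounded_tnth n (i : 'I_n) f : ess_bounded P f ->
  ess_bounded (power_prob P n) (fun D => f (tnth D i)).
Proof.
exact: (ess_bounded_preserving (measurable_tnth i) (@tnth_preserving n i)).
Qed.

Lemma mean_tnth n (i : 'I_n) f : ess_bounded P f ->
  mean (power_prob P n) (fun D => f (tnth D i)) = mean P f.
Proof.
exact: (mean_preserving (measurable_tnth i) (@tnth_preserving n i)).
Qed.

Lemma ess_bounded_power_prod n (f : 'I_n -> T -> R) :
  (forall i, ess_bounded P (f i)) ->
  ess_bounded (power_prob P n) (fun D => \prod_i f i (tnth D i)).
Proof.
by move=> bf; apply: ess_bounded_prod => i _; exact: ess_bounded_tnth.
Qed.

(** The source of every use of independence below. *)
Lemma mean_power_prod n (f : 'I_n -> T -> R) :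
  (forall i, ess_bounded P (f i)) ->
  mean (power_prob P n) (fun D => \prod_i f i (tnth D i))
    = \prod_i mean P (f i).
Proof.
elim: n f => [|n IH] f bf.
  rewrite big_ord0 (@eq_mean _ _ _ _ _ (fun=> 1)) ?mean_cst// => D.
  by rewrite big_ord0.
have bf' i : ess_bounded P (f (lift ord0 i)) by exact: bf.
rewrite -(mean_preserving (@measurable_tcons _ T n) (@tcons_preserving n))/=.
  rewrite big_ord_recl -IH// -(mean_prod (bf ord0) (ess_bounded_power_prod bf')).
  apply: eq_mean => -[x D] /=; rewrite big_ord_recl; congr (_ * _).
  by apply: eq_bigr => i _; rewrite tnthS.
exact: ess_bounded_power_prod.
Qed.

Lemma prod_pick n (k : 'I_n) (F : 'I_n -> R) :
  \prod_i (if i == k then F i else 1) = F k.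
Proof. by rewrite -big_mkcond big_pred1_eq. Qed.

Lemma mean_tnth2 n (i l : 'I_n) f g : i != l ->
  ess_bounded P f -> ess_bounded P g ->
  mean (power_prob P n) (fun D => f (tnth D i) * g (tnth D l))
    = mean P f * mean P g.
Proof.
move=> il bf bg.
pose F k x := (if k == i then f x else 1) * (if k == l then g x else 1).
have -> : mean (power_prob P n) (fun D => f (tnth D i) * g (tnth D l)) =
    mean (power_prob P n) (fun D => \prod_k F k (tnth D k)).
  by apply: eq_mean => D; rewrite big_split/= !prod_pick.
rewrite mean_power_prod; last first.
  by move=> k; apply: ess_boundedM; case: eqP.
rewrite (bigD1 i)//= (bigD1 l)/= 1?eq_sym//.
rewrite big1 ?mulr1 => [|k /andP[ki kl]].
  rewrite /F eqxx (negbTE il) eq_sym (negbTE il) eqxx; congr (_ * _).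
    by apply: eq_mean => x; rewrite mulr1.
  by apply: eq_mean => x; rewrite mul1r.
by rewrite /F (negbTE ki) (negbTE kl) mulr1 mean_cst.
Qed.

(** Distinct draws are uncorrelated: only the diagonal of the expanded square
    survives. *)
Lemma mean_sqr_sum_centred n f : ess_bounded P f -> mean P f = 0 ->
  mean (power_prob P n) (fun D => (\sum_i f (tnth D i)) ^+ 2)
    = n%:R * mean P (fun x => f x ^+ 2).
Proof.
move=> bf f0.
rewrite (@eq_mean _ _ _ _ _ (fun D => \sum_i \sum_l f (tnth D i) * f (tnth D l)));
  last by move=> D; rewrite expr2 big_distrlr.
have bfi i := @ess_bounded_tnth n i _ bf.
rewrite mean_sum => [|i _]; last first.
  by apply: ess_bounded_sum => l _; exact: ess_boundedM.
transitivity (\sum_(i < n) mean P (fun x => f x ^+ 2)); last first.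
  by rewrite sumr_const card_ord mulr_natl.
apply: eq_bigr => i _; rewrite mean_sum => [|l _]; last exact: ess_boundedM.
rewrite (bigD1 i)//= big1 => [|l li]; last by rewrite mean_tnth2 1?eq_sym// f0 mul0r.
rewrite addr0 -(mean_tnth i (ess_boundedX 2 bf)).
by apply: eq_mean => D; rewrite expr2.
Qed.

(** The draw [i] occurs in the centred factor only. *)
Lemma mean_tnth4_eq0 n (i l i' l' : 'I_n) u v u' v' :
  ess_bounded P u -> ess_bounded P v -> ess_bounded P u' -> ess_bounded P v' ->
  mean P u = 0 -> i != l -> i != i' -> i != l' ->
  mean (power_prob P n) (fun D => u (tnth D i) * v (tnth D l)
     * (u' (tnth D i') * v' (tnth D l'))) = 0.
Proof.
move=> bu bv bu' bv' u0 il ii' il'.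
pose F k x := (if k == i then u x else 1) * (if k == l then v x else 1)
   * ((if k == i' then u' x else 1) * (if k == l' then v' x else 1)).
rewrite (@eq_mean _ _ _ _ _ (fun D => \prod_k F k (tnth D k))); last first.
  by move=> D; rewrite !big_split/= !prod_pick.
rewrite mean_power_prod; last first.
  by move=> k; do 2![apply: ess_boundedM]; case: eqP.
rewrite (bigD1 i)//= [X in X * _](_ : _ = 0) ?mul0r// -[RHS]u0.
apply: eq_mean => x.
by rewrite /F eqxx (negbTE il) (negbTE ii') (negbTE il') !mulr1.
Qed.

(** Two distinct pairs of an asymmetric [Q] always leave some draw that occurs
    exactly once, in a centred factor: the summands of this degenerate U-statistic
    are uncorrelated. *)
Lemma mean_sqr_degenerate n (I : finType) (u v : I -> T -> R) (Q : rel 'I_n) :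
  (forall i, ~~ Q i i) -> (forall i l, Q i l -> ~~ Q l i) ->
  (forall m, ess_bounded P (u m)) -> (forall m, ess_bounded P (v m)) ->
  (forall m, mean P (u m) = 0) -> (forall m, mean P (v m) = 0) ->
  mean (power_prob P n) (fun D => (\sum_i \sum_(l | Q i l)
     \sum_m u m (tnth D i) * v m (tnth D l)) ^+ 2)
  = (\sum_i \sum_(l | Q i l) 1) *
    \sum_m \sum_m' mean P (fun x => u m x * u m' x)
                   * mean P (fun x => v m x * v m' x).
Proof.
move=> Qirr Qasym bu bv u0 v0.
pose H (D : n.-tuple T) (i l : 'I_n) := \sum_m u m (tnth D i) * v m (tnth D l).
have bui i m := @ess_bounded_tnth n i _ (bu m).
have bvi i m := @ess_bounded_tnth n i _ (bv m).
have bH i l : ess_bounded (power_prob P n) (fun D => H D i l).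
  by apply: ess_bounded_sum => m _; exact: ess_boundedM.
set S := (X in _ * X).
have HH i l i' l' : Q i l -> Q i' l' ->
    mean (power_prob P n) (fun D => H D i l * H D i' l')
      = if (i' == i) && (l' == l) then S else 0.
  move=> Qil Qil'.
  rewrite (@eq_mean _ _ _ _ _ (fun D => \sum_m \sum_m'
     u m (tnth D i) * v m (tnth D l) * (u m' (tnth D i') * v m' (tnth D l'))));
    last by move=> D; rewrite /H big_distrlr.
  have b4 m m' : ess_bounded (power_prob P n) (fun D =>
     u m (tnth D i) * v m (tnth D l) * (u m' (tnth D i') * v m' (tnth D l'))).
    by do 2![apply: ess_boundedM].
  rewrite mean_sum => [|m _]; last by apply: ess_bounded_sum.
  have il : i != l by apply: contraTN Qil => /eqP <-.
  have il' : i' != l' by apply: contraTN Qil' => /eqP <-.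
  case: ifPn => [/andP[/eqP ei /eqP el]|nil].
    subst i' l'; apply: eq_bigr => m _; rewrite mean_sum//.
    apply: eq_bigr => m' _; rewrite -(mean_tnth2 il).
    - by apply: eq_mean => D; ring.
    - exact: ess_boundedM.
    - exact: ess_boundedM.
  rewrite big1// => m _; rewrite mean_sum// big1// => m' _.
  have [ei|ii'] := eqVneq i' i.
    subst i'; rewrite eqxx/= in nil.
    rewrite (@eq_mean _ _ _ _ _ (fun D =>
     v m (tnth D l) * u m (tnth D i) * (u m' (tnth D i) * v m' (tnth D l'))));
      last by move=> D; ring.
    by apply: mean_tnth4_eq0 => //; rewrite eq_sym.
  have [ei|il''] := eqVneq i l'.
    subst l'; rewrite (@eq_mean _ _ _ _ _ (fun D =>
     v m (tnth D l) * u m (tnth D i) * (u m' (tnth D i') * v m' (tnth D i))));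
      last by move=> D; ring.
    apply: mean_tnth4_eq0 => //; rewrite 1?eq_sym//.
    by apply: contraTneq Qil' => ->; exact: Qasym.
  by apply: mean_tnth4_eq0 => //; rewrite eq_sym.
rewrite (@eq_mean _ _ _ _ _ (fun D => \sum_i \sum_(l | Q i l) \sum_i'
  \sum_(l' | Q i' l') H D i l * H D i' l')); last first.
  move=> D; rewrite expr2 big_distrl/=; apply: eq_bigr => i _.
  rewrite big_distrl/=; apply: eq_bigr => l _.
  rewrite big_distrr/=; apply: eq_bigr => i' _.
  by rewrite big_distrr.
have bHH i l i' l' := ess_boundedM (bH i l) (bH i' l').
rewrite mean_sum => [|i _]; last first.
  by do 3![apply: ess_bounded_sum => ? _].
rewrite mulr_suml; apply: eq_bigr => i _.
rewrite mean_sum => [|l _]; last by do 2![apply: ess_bounded_sum => ? _].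
rewrite mulr_suml; apply: eq_bigr => l Qil.
rewrite mean_sum => [|i' _]; last by apply: ess_bounded_sum.
rewrite (bigD1 i)//= [X in _ + X]big1 ?addr0 => [|i' ii'].
  rewrite mean_sum// (bigD1 l)//= HH// !eqxx/= big1 ?addr0 ?mul1r// => l'.
  by move=> /andP[Qil' l'l]; rewrite HH// (negbTE l'l) andbF.
rewrite mean_sum// big1// => l' Qil'.
by rewrite HH// (negbTE ii').
Qed.

End power_moments.

(** * Finite orthonormal families *)

Section orthonormal.
Context d (T : measurableType d) (R : realType) (P : probability T R).
Variables (I : finType) (e : I -> T -> R).
Hypothesis be : forall m, ess_bounded P (e m).
Hypothesis orth : forall m m', mean P (fun x => e m x * e m' x) = (m == m')%:R.

Lemma ess_bounded_comb (c : I -> R) :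
  ess_bounded P (fun x => \sum_m c m * e m x).
Proof. by apply: ess_bounded_sum => m _; exact: ess_boundedZ. Qed.

Lemma mean_comb_basis (c : I -> R) m :
  mean P (fun x => (\sum_m' c m' * e m' x) * e m x) = c m.
Proof.
rewrite (@eq_mean _ _ _ _ _ (fun x => \sum_m' c m' * (e m' x * e m x))).
  rewrite mean_sum => [|m' _]; last by apply: ess_boundedZ; exact: ess_boundedM.
  rewrite (bigD1 m)//= big1 ?addr0 => [|m' m'm].
    by rewrite meanZ ?orth ?eqxx ?mulr1//; exact: ess_boundedM.
  by rewrite meanZ ?orth ?(negbTE m'm) ?mulr0//; exact: ess_boundedM.
by move=> x; rewrite mulr_suml; apply: eq_bigr => m' _; rewrite mulrA.
Qed.

Lemma mean_mul_comb f (c : I -> R) : ess_bounded P f ->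
  mean P (fun x => f x * \sum_m c m * e m x)
    = \sum_m c m * mean P (fun x => f x * e m x).
Proof.
move=> bf; rewrite (@eq_mean _ _ _ _ _ (fun x => \sum_m c m * (f x * e m x))).
  rewrite mean_sum => [|m _]; last by apply: ess_boundedZ; exact: ess_boundedM.
  by apply: eq_bigr => m _; rewrite meanZ//; exact: ess_boundedM.
by move=> x; rewrite mulr_sumr; apply: eq_bigr => m _; rewrite mulrCA.
Qed.

Lemma mean_sqr_comb (c : I -> R) :
  mean P (fun x => (\sum_m c m * e m x) ^+ 2) = \sum_m c m ^+ 2.
Proof.
have := mean_mul_comb c (ess_bounded_comb c).
under eq_bigr do rewrite mean_comb_basis -expr2.
by move=> <-; apply: eq_mean => x; rewrite expr2.
Qed.

(** Pythagoras; Bessel's inequality and the optimality of the projection both follow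
    by comparing the nonnegative terms. *)
Lemma mean_sqr_sub_comb f (c : I -> R) : ess_bounded P f ->
  mean P (fun x => (f x - \sum_m c m * e m x) ^+ 2)
    = mean P (fun x => f x ^+ 2) - \sum_m mean P (fun x => f x * e m x) ^+ 2
      + \sum_m (mean P (fun x => f x * e m x) - c m) ^+ 2.
Proof.
move=> bf; have bc := ess_bounded_comb c.
rewrite (@eq_mean _ _ _ _ _ (fun x => f x ^+ 2
  - 2 * (f x * \sum_m c m * e m x) + (\sum_m c m * e m x) ^+ 2)); last first.
  by move=> x; ring.
rewrite meanD; [|apply: ess_boundedB|]; [|exact: ess_boundedX|..]; last 2 first.
- by apply: ess_boundedZ; exact: ess_boundedM.
- exact: ess_boundedX.
rewrite meanB; [|exact: ess_boundedX|]; last first.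
  by apply: ess_boundedZ; exact: ess_boundedM.
rewrite mean_sqr_comb meanZ ?mean_mul_comb//; last exact: ess_boundedM.
rewrite -!addrA; congr (_ + _).
rewrite mulr_sumr -!sumrN -!big_split/=; apply: eq_bigr => m _; ring.
Qed.

Lemma bessel f : ess_bounded P f ->
  \sum_m mean P (fun x => f x * e m x) ^+ 2 <= mean P (fun x => f x ^+ 2).
Proof.
move=> bf; rewrite -subr_ge0.
have bc := ess_bounded_comb (fun m => mean P (fun x => f x * e m x)).
have := mean_sqr_ge0 P (ess_boundedB bf bc).1.
rewrite mean_sqr_sub_comb// [X in _ + X]big1 ?addr0// => m _.
by rewrite subrr expr0n.
Qed.

Lemma best_approximation f (c : I -> R) : ess_bounded P f ->
  mean P (fun x => f x ^+ 2) - \sum_m mean P (fun x => f x * e m x) ^+ 2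
    <= mean P (fun x => (f x - \sum_m c m * e m x) ^+ 2).
Proof.
move=> bf; rewrite mean_sqr_sub_comb// lerDl.
by apply: sumr_ge0 => m _; exact: sqr_ge0.
Qed.

(** The left-hand side is the squared inner product of the residuals of [f] and
    [g], because each residual is orthogonal to the span; Cauchy-Schwarz then
    applies to them. *)
Lemma mean_mul_residual f g : ess_bounded P f -> ess_bounded P g ->
  (mean P (fun x => f x * g x) - \sum_m mean P (fun x => f x * e m x)
       * mean P (fun x => g x * e m x)) ^+ 2
  <= (mean P (fun x => f x ^+ 2) - \sum_m mean P (fun x => f x * e m x) ^+ 2)
   * (mean P (fun x => g x ^+ 2) - \sum_m mean P (fun x => g x * e m x) ^+ 2).
Proof.
move=> bf bg.
pose proj h x := \sum_m mean P (fun y => h y * e m y) * e m x.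
have bp h : ess_bounded P (proj h) by exact: ess_bounded_comb.
have res h : ess_bounded P h -> mean P (fun x => (h x - proj h x) ^+ 2)
    = mean P (fun x => h x ^+ 2) - \sum_m mean P (fun x => h x * e m x) ^+ 2.
  move=> bh; rewrite mean_sqr_sub_comb// [X in _ + X]big1 ?addr0// => m _.
  by rewrite subrr expr0n.
have := mean_cauchy_schwarz (ess_boundedB bf (bp f)) (ess_boundedB bg (bp g)).
rewrite !res// => /(le_trans _); apply.
rewrite le_eqVlt; apply/orP; left; apply/eqP; congr (_ ^+ 2).
rewrite (@eq_mean _ _ _ _ (fun x => (f x - proj f x) * (g x - proj g x))
  (fun x => f x * g x - f x * proj g x - (g x * proj f x - proj f x * proj g x)));
  last by move=> x; ring.
have bfg := ess_boundedM bf (bp g); have bgf := ess_boundedM bg (bp f).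
have bpp := ess_boundedM (bp f) (bp g); have bb := ess_boundedM bf bg.
rewrite meanB; [|exact: ess_boundedB|exact: ess_boundedB].
set S := \sum_m _.
have -> : mean P (fun x => f x * g x - f x * proj g x) = mean P (fun x => f x * g x) - S.
  rewrite meanB// mean_mul_comb//; congr (_ - _).
  by apply: eq_bigr => m _; rewrite mulrC.
have -> : mean P (fun x => g x * proj f x - proj f x * proj g x) = S - S.
  rewrite meanB// !mean_mul_comb//; congr (_ - _).
  by apply: eq_bigr => m _; rewrite mean_comb_basis// mulrC.
by rewrite subrr subr0.
Qed.

Lemma mean_sqr_span f (c : I -> R) : ess_bounded P f ->
  {ae P, forall x, f x = \sum_m c m * e m x} ->
  mean P (fun x => f x ^+ 2) = \sum_m mean P (fun x => f x * e m x) ^+ 2.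
Proof.
move=> bf fE; rewrite (@ae_eq_mean _ _ _ _ _ (fun x => (\sum_m c m * e m x) ^+ 2)).
- rewrite mean_sqr_comb; apply: eq_bigr => m _; congr (_ ^+ 2).
  rewrite -(mean_comb_basis c m); apply: ae_eq_mean.
  + by have [] := ess_boundedM (ess_bounded_comb c) (be m).
  + by have [] := ess_boundedM bf (be m).
  + by apply: filterS fE => x ->.
- by have [] := ess_boundedX 2 bf.
- by have [] := ess_boundedX 2 (ess_bounded_comb c).
- by apply: filterS fE => x ->.
Qed.

End orthonormal.

Section variance_tools.
Context d (T : measurableType d) (R : realType) (P : probability T R).

Lemma mean_centre f : ess_bounded P f -> mean P (fun x => f x - mean P f) = 0.
Proof. by move=> bf; rewrite meanB// mean_cst subrr. Qed.

Lemma mean_sqr_centre_le f : ess_bounded P f ->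
  mean P (fun x => (f x - mean P f) ^+ 2) <= mean P (fun x => f x ^+ 2).
Proof.
move=> bf; set c := mean P f.
rewrite (@eq_mean _ _ _ _ _ (fun x => f x ^+ 2 - (2 * c * f x - c ^+ 2)));
  last by move=> x; ring.
have bcf := ess_boundedZ (2 * c) bf.
rewrite meanB; [|exact: ess_boundedX|exact: ess_boundedB].
rewrite meanB// meanZ// mean_cst -/c lerBlDr lerDl.
by rewrite (_ : _ - _ = c ^+ 2) ?sqr_ge0//; ring.
Qed.

Lemma mean_weight_sqr_le f g c : ess_bounded P f -> ess_bounded P g ->
  {ae P, forall x, `|f x| <= c} ->
  mean P (fun x => (f x * g x) ^+ 2) <= c ^+ 2 * mean P (fun x => g x ^+ 2).
Proof.
move=> bf bg fc; rewrite -meanZ; last exact: ess_boundedX.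
apply: le_mean.
- by apply: ess_boundedX; exact: ess_boundedM.
- by apply: ess_boundedZ; exact: ess_boundedX.
- apply: filterS fc => x fc; rewrite exprMn ler_wpM2r ?sqr_ge0//.
  by rewrite -[f x ^+ 2]real_normK ?num_real// lerXn2r// nnegrE (le_trans _ fc).
Qed.

End variance_tools.

(** * Mean and variance of the plug-in estimator *)

Section plug_in.
Context d (T : measurableType d) (R : realType) (P : probability T R).
Variables (I : finType) (e : I -> T -> R) (A Y : T -> R) (c kappa : R).
Hypothesis be : forall m, ess_bounded P (e m).
Hypothesis orth : forall m m', mean P (fun x => e m x * e m' x) = (m == m')%:R.
Hypotheses (bA : ess_bounded P A) (bY : ess_bounded P Y).
Hypotheses (Ac : {ae P, forall x, `|A x| <= c}) (Yc : {ae P, forall x, `|Y x| <= c}).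

Definition kern x y := \sum_m e m x * e m y.

Definition plug_in n (D : n.-tuple T) : R := n%:R^-1 * \sum_(i < n) A (tnth D i) *
  (Y (tnth D i) - n%:R^-1 * \sum_(l < n) Y (tnth D l) * kern (tnth D l) (tnth D i)).

Let u m x := A x * e m x.
Let v m x := Y x * e m x.
Let a m := mean P (u m).
Let b m := mean P (v m).
Let uc m x := u m x - a m.
Let vc m x := v m x - b m.

Let bu m : ess_bounded P (u m). Proof. exact: ess_boundedM. Qed.
Let bv m : ess_bounded P (v m). Proof. exact: ess_boundedM. Qed.
Let buc m : ess_bounded P (uc m). Proof. exact: ess_boundedB. Qed.
Let bvc m : ess_bounded P (vc m). Proof. exact: ess_boundedB. Qed.
Let uc0 m : mean P (uc m) = 0. Proof. exact: mean_centre. Qed.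
Let vc0 m : mean P (vc m) = 0. Proof. exact: mean_centre. Qed.

(** The terms [l = i] of the double sum, joined to the single sum. *)
Definition plug_in_diag n x := A x * Y x - n%:R^-1 * (A x * Y x * kern x x).

Let bAYK : ess_bounded P (fun x => A x * Y x * kern x x).
Proof.
apply: ess_boundedM; first exact: ess_boundedM.
by apply: ess_bounded_sum => m _; exact: ess_boundedM.
Qed.

Let b_diag n : ess_bounded P (plug_in_diag n).
Proof. by apply: ess_boundedB; [exact: ess_boundedM|exact: ess_boundedZ]. Qed.

Let plug_in_split n (D : n.-tuple T) : plug_in D =
  n%:R^-1 * \sum_i plug_in_diag n (tnth D i)
  - n%:R^-1 ^+ 2 * \sum_i \sum_(l | l != i) \sum_m u m (tnth D i) * v m (tnth D l).
Proof.
rewrite /plug_in expr2 -mulrA -mulrBr; congr (_ * _).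
rewrite mulr_sumr -sumrB; apply: eq_bigr => i _.
rewrite (bigD1 i)//= /plug_in_diag mulrBr -addrA; congr (_ + _).
rewrite -opprD; congr (- _); rewrite mulrCA mulrDr mulrDr; congr (_ + _).
  by rewrite !mulrA.
rewrite mulr_sumr; congr (_ * _); apply: eq_bigr => l _.
rewrite /kern !mulr_sumr; apply: eq_bigr => m _.
by rewrite /u /v; ring.
Qed.

Lemma ess_bounded_plug_in n : ess_bounded (power_prob P n) (@plug_in n).
Proof.
apply: eq_ess_bounded (fun D => esym (plug_in_split D)) _.
apply: ess_boundedB; apply: ess_boundedZ; apply: ess_bounded_sum => i _.
  exact: ess_bounded_tnth (b_diag n).
do 2![apply: ess_bounded_sum => ? _].
by apply: ess_boundedM; [exact: ess_bounded_tnth (bu _)|exact: ess_bounded_tnth (bv _)].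
Qed.

Lemma mean_plug_in n : (0 < n)%N ->
  mean (power_prob P n) (@plug_in n) = mean P (fun x => A x * Y x)
    - n%:R^-1 * mean P (fun x => A x * Y x * kern x x)
    - (1 - n%:R^-1) * \sum_m a m * b m.
Proof.
move=> n0; have nn0 : n%:R != 0 :> R by rewrite pnatr_eq0 -lt0n.
rewrite (eq_mean _ (@plug_in_split n)).
have bd i := @ess_bounded_tnth _ _ _ P n i _ (b_diag n).
have bh i l : ess_bounded (power_prob P n)
    (fun D => \sum_m u m (tnth D i) * v m (tnth D l)).
  apply: ess_bounded_sum => m _; apply: ess_boundedM.
    exact: ess_bounded_tnth (bu _).
  exact: ess_bounded_tnth (bv _).
have bs i : ess_bounded (power_prob P n)
    (fun D => \sum_(l | l != i) \sum_m u m (tnth D i) * v m (tnth D l)).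
  by apply: ess_bounded_sum => l _.
rewrite meanB; [|by apply: ess_boundedZ; exact: ess_bounded_sum..].
rewrite meanZ; last exact: ess_bounded_sum.
rewrite meanZ; last exact: ess_bounded_sum.
rewrite !mean_sum//.
under eq_bigr do rewrite (mean_tnth _ (b_diag n)).
rewrite sumr_const card_ord -(mulr_natl (mean _ _)) mulKf//.
rewrite meanB//; [|exact: ess_boundedM|exact: ess_boundedZ].
rewrite meanZ//; congr (_ - _).
under eq_bigr => i _.
  rewrite mean_sum//.
  under eq_bigr => l li.
    rewrite mean_sum => [|m _]; last first.
      apply: ess_boundedM; first exact: ess_bounded_tnth (bu _).
      exact: ess_bounded_tnth (bv _).
    under eq_bigr => m _ do rewrite mean_tnth2 1?eq_sym//.
    over.
  rewrite sumr_const cardC1 card_ord.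
  over.
rewrite sumr_const card_ord -(mulr_natl (_ *+ n.-1)) -(mulr_natl (\sum_m _)) !mulrA.
congr (_ * _).
by rewrite -subn1 natrB//; field.
Qed.

(** The summands of the linear part of the Hoeffding decomposition, before
    centring: the U-statistic contributes its two first-order projections. *)
Let lin n x := plug_in_diag n x
  - (1 - n%:R^-1) * (A x * (\sum_m b m * e m x) + Y x * (\sum_m a m * e m x)).

(** The degenerate part, split later into the halves [l < i] and [i < l], each of
    which is an asymmetric relation. *)
Let tri n (Q : rel 'I_n) (D : n.-tuple T) :=
  \sum_i \sum_(l | Q i l) \sum_m uc m (tnth D i) * vc m (tnth D l).

Let b_lin n : ess_bounded P (lin n).
Proof.
apply: ess_boundedB => //; apply: ess_boundedZ; apply: ess_boundedD;
  apply: ess_boundedM => //; exact: ess_bounded_comb.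
Qed.

Let mean_lin n : mean P (lin n) = mean P (fun x => A x * Y x)
    - n%:R^-1 * mean P (fun x => A x * Y x * kern x x)
    - (1 - n%:R^-1) * (\sum_m a m * b m + \sum_m a m * b m).
Proof.
have bc f := ess_bounded_comb be f.
have bAb := ess_boundedM bA (bc b); have bYa := ess_boundedM bY (bc a).
rewrite meanB//; last by apply: ess_boundedZ; exact: ess_boundedD.
rewrite meanB//; [|exact: ess_boundedM|exact: ess_boundedZ].
rewrite meanZ// meanZ; last exact: ess_boundedD.
rewrite meanD// !mean_mul_comb//; congr (_ - _ * (_ + _)).
by apply: eq_bigr => m _; rewrite mulrC.
Qed.

Let plug_in_hoeffding n (D : n.-tuple T) : (0 < n)%N ->
  plug_in D - mean (power_prob P n) (@plug_in n) =
  n%:R^-1 * \sum_i (lin n (tnth D i) - mean P (lin n))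
  - n%:R^-1 ^+ 2 * (tri (fun i l : 'I_n => l < i)%N D + tri (fun i l : 'I_n => i < l)%N D).
Proof.
move=> n0; have nn0 : n%:R != 0 :> R by rewrite pnatr_eq0 -lt0n.
rewrite plug_in_split mean_plug_in// mean_lin.
set C := mean P _ - _; set s := \sum_m a m * b m.
pose ua x := \sum_m b m * u m x; pose va x := \sum_m a m * v m x.
have triE : tri (fun i l : 'I_n => l < i)%N D + tri (fun i l : 'I_n => i < l)%N D =
    \sum_(i < n) \sum_(l | l != i) \sum_m uc m (tnth D i) * vc m (tnth D l).
  rewrite -big_split/=; apply: eq_bigr => i _.
  rewrite [RHS](bigID (fun l : 'I_n => (l < i)%N))/=; congr (_ + _).
    by apply: eq_bigl => l; rewrite -(inj_eq val_inj)/=; case: ltngtP.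
  by apply: eq_bigl => l; rewrite -(inj_eq val_inj)/=; case: ltngtP.
have sumC (F : 'I_n -> R) : \sum_(i < n) \sum_(l | l != i) F l
    = (n%:R - 1) * \sum_i F i.
  transitivity (\sum_(i < n) (\sum_l F l - F i)).
    by apply: eq_bigr => i _; rewrite [X in X - _](bigD1 i)//= addrC addrK.
  by rewrite sumrB sumr_const card_ord -(mulr_natl (\sum_l F l)) mulrBl mul1r.
have sumD (F : 'I_n -> R) : \sum_(i < n) \sum_(l < n | l != i) F i
    = (n%:R - 1) * \sum_i F i.
  rewrite mulr_sumr; apply: eq_bigr => i _.
  by rewrite sumr_const cardC1 card_ord -(mulr_natl (F i)) -subn1 natrB.
have -> : tri (fun i l : 'I_n => l < i)%N D + tri (fun i l : 'I_n => i < l)%N D =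
    \sum_(i < n) \sum_(l | l != i) \sum_m u m (tnth D i) * v m (tnth D l)
    - (n%:R - 1) * \sum_i ua (tnth D i) - (n%:R - 1) * \sum_i va (tnth D i)
    + n%:R * (n%:R - 1) * s.
  have <- : \sum_(i < n) \sum_(l < n | l != i) ua (tnth D i)
      = (n%:R - 1) * \sum_i ua (tnth D i) by exact: sumD.
  have <- : \sum_(i < n) \sum_(l < n | l != i) va (tnth D l)
      = (n%:R - 1) * \sum_i va (tnth D i) by exact: (sumC (fun i => va (tnth D i))).
  rewrite triE.
  have -> : n%:R * (n%:R - 1) * s = \sum_(i < n) \sum_(l < n | l != i) s.
    by rewrite (sumD (fun=> s)) sumr_const card_ord -(mulr_natl s); ring.
  rewrite -!sumrB -big_split/=; apply: eq_bigr => i _.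
  rewrite -!sumrB -big_split/=; apply: eq_bigr => l _.
  rewrite /ua /va /s -!sumrB -big_split/=; apply: eq_bigr => m _.
  by rewrite /uc /vc; ring.
have -> : \sum_(i < n) (lin n (tnth D i) - (C - (1 - n%:R^-1) * (s + s))) =
    \sum_(i < n) plug_in_diag n (tnth D i)
    - (1 - n%:R^-1) * (\sum_i ua (tnth D i) + \sum_i va (tnth D i))
    - n%:R * (C - (1 - n%:R^-1) * (s + s)).
  rewrite sumrB sumr_const card_ord -(mulr_natl (C - _)); congr (_ - _).
  rewrite -big_split/= mulr_sumr -sumrB; apply: eq_bigr => i _.
  rewrite /lin /ua /va !mulr_sumr; congr (_ - _ * (_ + _));
    by apply: eq_bigr => m _; rewrite /u /v mulrCA.
by rewrite /C; field.
Qed.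

(** The covariance form of the [Y e_m] is dominated by [c^2] times the identity:
    the variance of [Y * sum x_m e_m] is at most its second moment. *)
Let cov_form_le (x : I -> R) :
  \sum_m \sum_m' x m * x m' * mean P (fun z => vc m z * vc m' z)
    <= c ^+ 2 * \sum_m x m ^+ 2.
Proof.
have bx := ess_bounded_comb be x.
apply: (@le_trans _ _ (mean P (fun z => (Y z * \sum_m x m * e m z) ^+ 2))); last first.
  rewrite -(mean_sqr_comb be orth); exact: mean_weight_sqr_le.
apply: le_trans (mean_sqr_centre_le (ess_boundedM bY bx)).
rewrite mean_mul_comb//.
rewrite le_eqVlt; apply/orP; left; apply/eqP.
under eq_bigr => m _.
  under eq_bigr => m' _.
    rewrite -meanZ; last exact: ess_boundedM.
    over.
  rewrite -mean_sum => [|m' _]; last by apply: ess_boundedZ; exact: ess_boundedM.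
  over.
rewrite -mean_sum => [|m _]; last first.
  by apply: ess_bounded_sum => m' _; apply: ess_boundedZ; exact: ess_boundedM.
apply: eq_mean => z; rewrite mulr_sumr -sumrB expr2 big_distrlr/=.
apply: eq_bigr => m _; apply: eq_bigr => m' _.
by rewrite /vc /b /v; ring.
Qed.

(** The double sum is the second moment of the degenerate kernel; for a fixed first
    draw it is the covariance form at the vector of the [uc m x]. *)
Let cov_product_le : \sum_m \sum_m' mean P (fun x => uc m x * uc m' x)
   * mean P (fun x => vc m x * vc m' x) <= c ^+ 4 * #|I|%:R.
Proof.
pose V m m' := mean P (fun x => vc m x * vc m' x).
have b2 m m' : ess_bounded P (fun x => uc m x * uc m' x * V m m').
  by apply: ess_boundedM => //; exact: ess_boundedM.
have -> : \sum_m \sum_m' mean P (fun x => uc m x * uc m' x) * V m m' =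
    mean P (fun x => \sum_m \sum_m' uc m x * uc m' x * V m m').
  rewrite mean_sum => [|m _]; last exact: ess_bounded_sum.
  apply: eq_bigr => m _; rewrite mean_sum//; apply: eq_bigr => m' _.
  rewrite mulrC -meanZ; last exact: ess_boundedM.
  by apply: eq_mean => x; rewrite mulrC.
apply: (@le_trans _ _ (mean P (fun x => c ^+ 2 * \sum_m uc m x ^+ 2))).
  apply: le_mean.
  - by do 2![apply: ess_bounded_sum => ? _].
  - by apply: ess_boundedZ; apply: ess_bounded_sum => m _; exact: ess_boundedX.
  - by apply: aeW => x; exact: cov_form_le.
rewrite meanZ; last by apply: ess_bounded_sum => m _; exact: ess_boundedX.
rewrite (_ : c ^+ 4 = c ^+ 2 * c ^+ 2); last by ring.
rewrite -mulrA ler_wpM2l ?sqr_ge0// mean_sum => [|m _]; last exact: ess_boundedX.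
have -> : c ^+ 2 * #|I|%:R = \sum_(m : I) c ^+ 2 by rewrite sumr_const mulr_natr.
apply: ler_sum => m _.
apply: le_trans (mean_sqr_centre_le (bu m)) _.
apply: le_trans (mean_weight_sqr_le bA (be m) Ac) _.
rewrite (@eq_mean _ _ _ _ (fun x => e m x ^+ 2) (fun x => e m x * e m x)) => [|x].
  by rewrite orth eqxx mulr1.
by rewrite expr2.
Qed.

Let b_tri n Q : ess_bounded (power_prob P n) (@tri n Q).
Proof.
do 3![apply: ess_bounded_sum => ? _].
by apply: ess_boundedM; [exact: ess_bounded_tnth (buc _)|exact: ess_bounded_tnth (bvc _)].
Qed.

Let tri_le n (Q : rel 'I_n) : (forall i, ~~ Q i i) ->
  (forall i l, Q i l -> ~~ Q l i) ->
  mean (power_prob P n) (fun D => tri Q D ^+ 2) <= n%:R ^+ 2 * (c ^+ 4 * #|I|%:R).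
Proof.
move=> Qirr Qasym; rewrite mean_sqr_degenerate//.
apply: (@le_trans _ _ ((\sum_i \sum_(l | Q i l) 1) * (c ^+ 4 * #|I|%:R))).
  apply: ler_wpM2l; last exact: cov_product_le.
  by do 2![apply: sumr_ge0 => ? _].
apply: ler_wpM2r; first by rewrite mulr_ge0// (exprM c 2 2) sqr_ge0.
apply: (@le_trans _ _ (\sum_(i < n) \sum_(l < n) 1)).
  apply: ler_sum => i _; rewrite [leRHS](bigID (Q i))/= lerDl.
  exact: sumr_ge0.
by rewrite !sumr_const !card_ord -[1 *+ n]/(n%:R) -(mulr_natr n%:R) expr2.
Qed.

Hypothesis c_ge0 : 0 <= c.
Hypothesis kern_le : {ae P, forall x, kern x x <= kappa}.

Let sqr_lin_le n : (0 < n)%N -> mean P (fun x => lin n x ^+ 2)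
  <= 4 * c ^+ 4 * (3 + kappa ^+ 2 / n%:R ^+ 2).
Proof.
move=> n0; pose t : R := 1 - n%:R^-1.
have /andP[n1 n2] : 0 <= (n%:R^-1 : R) <= 1.
  by rewrite invr_ge0 ler0n invf_le1 ?ltr0n// ler1n.
have t1 : t ^+ 2 <= 1 by rewrite /t; nra.
have bc f := ess_bounded_comb be f.
pose p1 x := A x * Y x; pose p2 x := n%:R^-1 * (A x * Y x * kern x x).
pose p3 x := t * (A x * \sum_m b m * e m x).
pose p4 x := t * (Y x * \sum_m a m * e m x).
have bp1 : ess_bounded P p1 by exact: ess_boundedM.
have bp2 : ess_bounded P p2 by exact: ess_boundedZ.
have bp3 : ess_bounded P p3 by apply: ess_boundedZ; exact: ess_boundedM.
have bp4 : ess_bounded P p4 by apply: ess_boundedZ; exact: ess_boundedM.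
have mY : mean P (fun x => Y x ^+ 2) <= c ^+ 2.
  rewrite -[leRHS](mean_cst P); apply: le_mean => //; first exact: ess_boundedX.
  apply: filterS Yc => x Yx; rewrite -[Y x ^+ 2]real_normK ?num_real//.
  by rewrite lerXn2r// nnegrE.
have mA : mean P (fun x => A x ^+ 2) <= c ^+ 2.
  rewrite -[leRHS](mean_cst P); apply: le_mean => //; first exact: ess_boundedX.
  apply: filterS Ac => x Ax; rewrite -[A x ^+ 2]real_normK ?num_real//.
  by rewrite lerXn2r// nnegrE.
have c4 : c ^+ 4 = c ^+ 2 * c ^+ 2 by ring.
have m1 : mean P (fun x => p1 x ^+ 2) <= c ^+ 4.
  rewrite c4; apply: le_trans (mean_weight_sqr_le bA bY Ac) _.
  by rewrite ler_wpM2l ?sqr_ge0.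
have m2 : mean P (fun x => p2 x ^+ 2) <= c ^+ 4 * (kappa ^+ 2 / n%:R ^+ 2).
  rewrite -[leRHS](mean_cst P); apply: le_mean => //; first exact: ess_boundedX.
  apply: filterS3 Ac Yc kern_le => x Ax Yx Kx.
  have K0 : 0 <= kern x x by apply: sumr_ge0 => m _; rewrite -expr2 sqr_ge0.
  rewrite (_ : p2 x ^+ 2 =
      `|A x| ^+ 2 * (`|Y x| ^+ 2 * kern x x ^+ 2) * n%:R^-1 ^+ 2); last first.
    by rewrite !real_normK ?num_real// /p2; ring.
  rewrite (_ : c ^+ 4 * _ = c ^+ 2 * (c ^+ 2 * kappa ^+ 2) * n%:R^-1 ^+ 2); last first.
    by rewrite -exprVn; ring.
  rewrite ler_wpM2r ?sqr_ge0//.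
  have le2 (y z : R) : 0 <= y -> y <= z -> y ^+ 2 <= z ^+ 2.
    by move=> y0 yz; rewrite lerXn2r// nnegrE (le_trans y0).
  by apply: ler_pM; rewrite ?mulr_ge0 ?sqr_ge0//; [exact: le2|
    apply: ler_pM; rewrite ?sqr_ge0//; exact: le2].
have m3 : mean P (fun x => p3 x ^+ 2) <= c ^+ 4.
  rewrite (@eq_mean _ _ _ _ _ (fun x => t ^+ 2 * (A x * \sum_m b m * e m x) ^+ 2));
    last by move=> x; rewrite exprMn.
  rewrite meanZ; last by apply: ess_boundedX; exact: ess_boundedM.
  have := mean_weight_sqr_le bA (bc b) Ac; rewrite mean_sqr_comb// => h.
  have h' := le_trans (bessel be orth bY) mY.
  have : c ^+ 2 * \sum_m b m ^+ 2 <= c ^+ 4 by rewrite c4 ler_wpM2l ?sqr_ge0.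
  move=> /(le_trans h) {}h; apply: le_trans h.
  by rewrite ler_piMl// mean_sqr_ge0//; case: (ess_boundedM bA (bc b)).
have m4 : mean P (fun x => p4 x ^+ 2) <= c ^+ 4.
  rewrite (@eq_mean _ _ _ _ _ (fun x => t ^+ 2 * (Y x * \sum_m a m * e m x) ^+ 2));
    last by move=> x; rewrite exprMn.
  rewrite meanZ; last by apply: ess_boundedX; exact: ess_boundedM.
  have := mean_weight_sqr_le bY (bc a) Yc; rewrite mean_sqr_comb// => h.
  have h' := le_trans (bessel be orth bA) mA.
  have : c ^+ 2 * \sum_m a m ^+ 2 <= c ^+ 4 by rewrite c4 ler_wpM2l ?sqr_ge0.
  move=> /(le_trans h) {}h; apply: le_trans h.
  by rewrite ler_piMl// mean_sqr_ge0//; case: (ess_boundedM bY (bc a)).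
apply: (@le_trans _ _ (mean P (fun x =>
  4 * (p1 x ^+ 2 + p2 x ^+ 2 + (p3 x ^+ 2 + p4 x ^+ 2))))).
  apply: le_mean; first exact: ess_boundedX.
    by apply: ess_boundedZ; do 2![apply: ess_boundedD]; exact: ess_boundedX.
  apply: aeW => x.
  rewrite (_ : lin n x = p1 x - p2 x - p3 x - p4 x); last first.
    by rewrite /lin /plug_in_diag /p1 /p2 /p3 /p4 /t; ring.
  rewrite -subr_ge0 (_ : _ - _ = (p1 x + p2 x) ^+ 2 + (p1 x + p3 x) ^+ 2
     + (p1 x + p4 x) ^+ 2 + (p2 x - p3 x) ^+ 2 + (p2 x - p4 x) ^+ 2
     + (p3 x - p4 x) ^+ 2); last by ring.
  by do 5![apply: addr_ge0; last exact: sqr_ge0]; exact: sqr_ge0.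
have [b1 b2 b3 b4] : [/\ ess_bounded P (fun x => p1 x ^+ 2),
   ess_bounded P (fun x => p2 x ^+ 2), ess_bounded P (fun x => p3 x ^+ 2)
   & ess_bounded P (fun x => p4 x ^+ 2)] by split; exact: ess_boundedX.
rewrite meanZ; last by do 2![apply: ess_boundedD].
rewrite meanD//; [|exact: ess_boundedD..].
rewrite !meanD// -mulrA ler_wpM2l//.
rewrite (_ : c ^+ 4 * _ = c ^+ 4 + c ^+ 4 * (kappa ^+ 2 / n%:R ^+ 2)
  + (c ^+ 4 + c ^+ 4)); last by ring.
by apply: lerD; apply: lerD.
Qed.

(** The three rates come from the linear part ([1/n] and, through the diagonal
    terms, [kappa^2/n^3]) and from the degenerate part ([#|I|/n^2]). *)
Lemma variance_plug_in_le n : (0 < n)%N ->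
  mean (power_prob P n)
    (fun D => (plug_in D - mean (power_prob P n) (@plug_in n)) ^+ 2)
  <= 36 * c ^+ 4 * (1 / n%:R + #|I|%:R / n%:R ^+ 2 + kappa ^+ 2 / n%:R ^+ 3).
Proof.
move=> n0; have nn0 : n%:R != 0 :> R by rewrite pnatr_eq0 -lt0n.
have n_gt0 : (0 : R) < n%:R by rewrite ltr0n.
pose Ql (i l : 'I_n) := (l < i)%N; pose Qr (i l : 'I_n) := (i < l)%N.
pose f x := lin n x - mean P (lin n).
have bf : ess_bounded P f by exact: ess_boundedB.
pose L (D : n.-tuple T) := \sum_i f (tnth D i).
have bL : ess_bounded (power_prob P n) L.
  by apply: ess_bounded_sum => i _; exact: (ess_bounded_tnth i bf).
have b2 g : ess_bounded (power_prob P n) g ->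
  ess_bounded (power_prob P n) (fun x => g x ^+ 2) by exact: ess_boundedX.
have mL : mean (power_prob P n) (fun D => L D ^+ 2)
    <= n%:R * (4 * c ^+ 4 * (3 + kappa ^+ 2 / n%:R ^+ 2)).
  rewrite mean_sqr_sum_centred//; last exact: mean_centre.
  rewrite ler_wpM2l//; apply: le_trans (sqr_lin_le n0).
  exact: mean_sqr_centre_le.
have ml : mean (power_prob P n) (fun D => tri Ql D ^+ 2)
    <= n%:R ^+ 2 * (c ^+ 4 * #|I|%:R).
  by apply: tri_le => [i|i l]; rewrite /Ql ?ltnn// -leqNgt => /ltnW.
have mr : mean (power_prob P n) (fun D => tri Qr D ^+ 2)
    <= n%:R ^+ 2 * (c ^+ 4 * #|I|%:R).
  by apply: tri_le => [i|i l]; rewrite /Qr ?ltnn// -leqNgt => /ltnW.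
set s : R := n%:R^-1.
apply: (@le_trans _ _ (mean (power_prob P n) (fun D => 3 *
   (s ^+ 2 * L D ^+ 2 + (s ^+ 4 * tri Ql D ^+ 2 + s ^+ 4 * tri Qr D ^+ 2))))).
  apply: le_mean.
  - apply: b2; apply: ess_boundedB => //; exact: ess_bounded_plug_in.
  - apply: ess_boundedZ; apply: ess_boundedD; last apply: ess_boundedD;
      by apply: ess_boundedZ; exact: b2.
  - apply: aeW => D; rewrite plug_in_hoeffding// -/s -/Ql -/Qr -/f -/(L D).
    rewrite -subr_ge0 (_ : _ - _ = (s * L D + s ^+ 2 * tri Ql D) ^+ 2
      + (s * L D + s ^+ 2 * tri Qr D) ^+ 2
      + (s ^+ 2 * tri Ql D - s ^+ 2 * tri Qr D) ^+ 2); last by ring.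
    by do 2![apply: addr_ge0; last exact: sqr_ge0]; exact: sqr_ge0.
have bs r g : ess_bounded (power_prob P n) g ->
  ess_bounded (power_prob P n) (fun x => r * g x ^+ 2).
  by move=> bg; apply: ess_boundedZ; exact: b2.
rewrite meanZ; last by apply: ess_boundedD; [|apply: ess_boundedD]; exact: bs.
rewrite meanD; [|exact: bs|by apply: ess_boundedD; exact: bs].
rewrite meanD; [|exact: bs..].
rewrite !meanZ; [|exact: b2..].
apply: (@le_trans _ _ (3 * (s ^+ 2 * (n%:R * (4 * c ^+ 4 * (3 + kappa ^+ 2 / n%:R ^+ 2)))
  + (s ^+ 4 * (n%:R ^+ 2 * (c ^+ 4 * #|I|%:R))
   + s ^+ 4 * (n%:R ^+ 2 * (c ^+ 4 * #|I|%:R)))))).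
  rewrite ler_wpM2l//; apply: lerD; first by rewrite ler_wpM2l// sqr_ge0.
  by apply: lerD; rewrite ler_wpM2l// exprn_ge0// invr_ge0.
rewrite /s (_ : 3 * _ = c ^+ 4 * (36 / n%:R + 6 * (#|I|%:R / n%:R ^+ 2)
  + 12 * (kappa ^+ 2 / n%:R ^+ 3))); last by field.
rewrite (mulrC 36 (c ^+ 4)) -(mulrA (c ^+ 4) 36) ler_wpM2l ?exprn_ge0// !mulrDr mul1r.
have h1 : 0 <= #|I|%:R / n%:R ^+ 2 :> R by rewrite divr_ge0// sqr_ge0.
have h2 : 0 <= kappa ^+ 2 / n%:R ^+ 3 by rewrite divr_ge0 ?sqr_ge0// exprn_ge0.
by lra.
Qed.

End plug_in.

(** * Conditional expectation given the design point *)

Section conditional_expectation.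
Context (R : realType) (d : nat) (P : probability (obs R d) R).
Hypothesis PX : forall B, measurable B -> P (@Xo R d @^-1` B) = unif R d B.

Lemma measurable_Xo : measurable_fun setT (@Xo R d).
Proof. exact: measurable_fst. Qed.

Let measurable_preXo B : measurable B -> measurable (@Xo R d @^-1` B).
Proof. by move=> mB; rewrite -[X in measurable X]setTI; exact: measurable_Xo. Qed.

Lemma ess_bounded_Xo f : ess_bounded (unif R d) f ->
  ess_bounded P (fun o => f (Xo o)).
Proof. exact: (ess_bounded_preserving measurable_Xo PX). Qed.

Lemma mean_Xo f : ess_bounded (unif R d) f ->
  mean P (fun o => f (Xo o)) = mean (unif R d) f.
Proof. exact: (mean_preserving measurable_Xo PX). Qed.

(** The set functions [B |-> E(Q ; X \in B)] have densities with respect to the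
    law of [X]. *)
Lemma cond_exp_exists Q : ess_bounded P Q -> exists f, is_cond_exp P Q f.
Proof.
move=> bQ; have iQ := ess_bounded_integrable bQ.
pose nuX := measure_function_pushforward__canonical__charge_Charge
  (induced_charge iQ) measurable_Xo.
have dom : nuX `<< unif R d.
  apply/null_content_dominatesP => B mB B0.
  rewrite /nuX/= /pushforward /induced_charge.
  apply: null_set_integral; first exact: measurable_preXo.
    by apply: measurable_funTS; exact: (measurable_int P iQ).
  by rewrite -B0; exact: PX.
have intf := Radon_Nikodym_integrable dom.
pose f x := fine (Radon_Nikodym nuX (unif R d) x).
have fE x : (f x)%:E = Radon_Nikodym nuX (unif R d) x.
  by rewrite /f fineK//; exact: Radon_Nikodym_fin_num.
have mf : measurable_fun setT f.
  apply/measurable_EFinP; rewrite (_ : _ \o _ = Radon_Nikodym nuX (unif R d)).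
    exact: (measurable_int (unif R d)).
  by apply/funext => x; exact: fE.
have mf' : measurable_fun setT (EFin \o f) by exact/measurable_EFinP.
have intfX : P.-integrable setT (EFin \o (f \o @Xo R d)).
  apply/integrableP; split.
    by apply/measurable_EFinP; apply: measurableT_comp => //; exact: measurable_Xo.
  move/integrableP : intf => [_].
  rewrite (eq_integral (abse \o (EFin \o f))); last by move=> x _; rewrite -fE.
  have mabs : measurable_fun setT (abse \o (EFin \o f)) by exact: measurableT_comp.
  have := ge0_integral_pushforward measurable_Xo P measurableT mabs (fun _ _ => abse_ge0 _).
  rewrite preimage_setT => <-.
  apply: le_lt_trans; rewrite le_eqVlt; apply/orP; left; apply/eqP.
  apply: eq_measure_integral => [|? B mB _]; first exact: measurable_Xo.
  exact: PX.
exists f; split => // B mB.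
transitivity (nuX B) => //.
rewrite (Radon_Nikodym_integral dom mB).
rewrite (eq_integral (EFin \o f)); last by move=> x _; rewrite -fE.
have iB : P.-integrable (@Xo R d @^-1` B) ((EFin \o f) \o @Xo R d).
  by apply: integrableS intfX => //; exact: measurable_preXo.
rewrite -(integral_pushforward measurable_Xo mf' iB mB).
symmetry; apply: eq_measure_integral => [|? C mC _]; first exact: measurable_Xo.
exact: PX.
Qed.

Lemma cond_expP Q : ess_bounded P Q -> is_cond_exp P Q (cond_exp P Q).
Proof. by move=> /cond_exp_exists; exact: xgetPex. Qed.

Lemma is_cond_exp_indic Q f B : ess_bounded P Q -> is_cond_exp P Q f ->
  measurable B ->
  (\int[P]_(o in @Xo R d @^-1` B) (Q o - f (Xo o))%:E = 0)%E.
Proof.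
move=> bQ [mf If fE] mB; have mXB := measurable_preXo mB.
rewrite integralB_EFin//.
- rewrite fE// subee// integrable_fin_num//.
  exact: integrableS If.
- exact: integrableS (ess_bounded_integrable bQ).
- exact: integrableS If.
Qed.

(** On the event [f X > C >= |Q|] the difference [f X - Q] is positive but has
    integral zero; likewise on [f X < - C]. *)
Lemma ess_bounded_cond_exp Q f : ess_bounded P Q -> is_cond_exp P Q f ->
  ess_bounded P (fun o => f (Xo o)).
Proof.
move=> bQ cf; have [mQ [C QC]] := bQ; have [mf If _] := cf.
have mfX : measurable_fun setT (fun o => f (Xo o)).
  by apply: measurableT_comp => //; exact: measurable_Xo.
(* [s] is a sign: one argument for the two tails *)
have null (s : R) (B : set (point R d)) : measurable B ->
    (forall x, B x -> C < s * f x) -> `|s| = 1 ->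
    {ae P, forall o, ~ B (Xo o)}.
  move=> mB Bs s1; have mXB := measurable_preXo mB.
  pose h o := s * (f (Xo o) - Q o).
  have mh : measurable_fun setT (EFin \o h).
    by apply/measurable_EFinP; apply: measurable_funM => //; exact: measurable_funB.
  have hpos : {ae P, forall o, B (Xo o) -> 0 < h o}.
    apply: filterS QC => o QC /Bs Bo; rewrite /h mulrBr subr_gt0.
    by rewrite (le_lt_trans _ Bo)// (le_trans _ QC)// (le_trans (ler_norm _))// normrM s1 mul1r.
  have : (\int[P]_(o in @Xo R d @^-1` B) `|(h o)%:E| = 0)%E.
    rewrite (ae_eq_integral (EFin \o h))//.
    + rewrite (eq_integral (fun o => (- s)%:E * (Q o - f (Xo o))%:E)%E); last first.
        by move=> o _; rewrite -EFinM /= /h mulNr -mulrN opprB.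
      rewrite integralZl//; first by rewrite is_cond_exp_indic// mule0.
      rewrite (_ : (fun x => _) = (EFin \o Q) \- (EFin \o (f \o @Xo R d)))%E//.
      apply: integrableB => //; first exact: integrableS (ess_bounded_integrable bQ).
      exact: integrableS If.
    + by apply: measurable_funTS; exact: measurableT_comp.
    + exact: measurable_funTS.
    + by apply: filterS hpos => o ho /ho ?; rewrite /= ger0_norm// ltW.
  move=> /(ae_eq_integral_abs P mXB (measurable_funTS mh)).
  apply: filterS2 hpos => o ho h0 Bo.
  have := ho Bo; have := h0 Bo => /= -[->].
  by rewrite ltxx.
split => //; exists C.
have m1 : measurable [set x | C < f x].
  have := mf; move=> /(_ measurableT [set` `]C, +oo[]) /(_ (measurable_itv _)).
  by rewrite setTI; congr measurable; apply/seteqP; split=> x/=; rewrite in_itv/= andbT.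
have m2 : measurable [set x | f x < - C].
  have := mf; move=> /(_ measurableT [set` `]-oo, (- C)[]) /(_ (measurable_itv _)).
  by rewrite setTI; congr measurable; apply/seteqP; split=> x/=; rewrite in_itv.
have n1 : {ae P, forall o, ~ C < f (Xo o)}.
  by apply: (null 1 _ m1) => [x|]; rewrite ?mul1r ?normr1.
have n2 : {ae P, forall o, ~ f (Xo o) < - C}.
  by apply: (null (-1) _ m2) => [x|]; rewrite ?mulN1r ?normrN1// ltrNr.
apply: filterS2 n1 n2 => o /negP h1 /negP h2.
by rewrite ler_norml leNgt h2 leNgt h1.
Qed.

(** A bounded [g] is the uniform limit of the functions taking the values [k/N]
    on the level sets of the integer part of [N g], up to a translation that makes
    [g] nonnegative. *)
Lemma cond_exp_pull_out Q f g : ess_bounded P Q -> is_cond_exp P Q f ->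
  ess_bounded (unif R d) g ->
  mean P (fun o => Q o * g (Xo o)) = mean P (fun o => f (Xo o) * g (Xo o)).
Proof.
move=> bQ cf bg.
have bf := ess_bounded_cond_exp bQ cf.
pose h o := Q o - f (Xo o).
have bh : ess_bounded P h by exact: ess_boundedB.
have bgX := ess_bounded_Xo bg.
suff h0 : mean P (fun o => h o * g (Xo o)) = 0.
  apply/eqP; rewrite -subr_eq0 -meanB; [|exact: ess_boundedM..].
  by rewrite -[X in _ == X]h0; apply/eqP/eq_mean => o; rewrite -mulrBl.
have [mg [K gK]] := bg.
have K0 : 0 <= `|K| by [].
pose g' x := Num.max 0 (Num.min (`|K| + `|K|) (g x + `|K|)).
have mg' : measurable_fun setT g'.
  apply: measurable_maxr; first exact: measurable_cst.
  by apply: measurable_minr; [exact: measurable_cst|exact: measurable_funD].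
have g'0 x : 0 <= g' x by rewrite le_max lexx.
have g'K x : g' x <= `|K| + `|K|.
  by rewrite ge_max addr_ge0// ge_min lexx.
have h_indic B : measurable B -> mean P (fun o => h o * \1_B (Xo o)) = 0.
  move=> mB; rewrite /mean /Rintegral.
  rewrite -[RHS]/(fine 0%E) -(is_cond_exp_indic bQ cf mB) [in RHS]integral_mkcond.
  congr fine; apply: eq_integral => o _; rewrite patchE indicE.
  rewrite (_ : (o \in _) = (Xo o \in B))//.
  by case: ifP => _; rewrite ?mulr1 ?mulr0.
pose N0 (N : nat) : R := N.+1%:R.
have N0_gt0 N : 0 < N0 N by rewrite ltr0n.
pose q N x := Num.truncn (N0 N * g' x).
pose gN N x : R := (q N x)%:R / N0 N.
have gN_near N x : `|g' x - gN N x| <= (N0 N)^-1.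
  have Ng0 : 0 <= N0 N * g' x by rewrite mulr_ge0.
  have /andP[le1 lt1] := truncn_itv Ng0.
  rewrite (_ : g' x - gN N x = (N0 N * g' x - (q N x)%:R) / N0 N); last first.
    by rewrite /gN; field; rewrite gt_eqF.
  rewrite ger0_norm; last by rewrite divr_ge0// ?subr_ge0// ltW.
  rewrite ler_pdivrMr// mulVf ?gt_eqF// lerBlDr.
  by rewrite (le_trans (ltW lt1))// -natr1 addrC.
pose m N := (Num.truncn (N0 N * (`|K| + `|K|))).+1.
have q_lt N x : (q N x < m N)%N.
  by rewrite ltnS le_truncn// ler_wpM2l// ltW.
have mlev N k : measurable [set x | q N x = k].
  rewrite (_ : [set _ | _] = (fun x => N0 N * g' x) @^-1` [set` `[k%:R, k.+1%:R[]).
    rewrite -[X in measurable X]setTI.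
    have mNg : measurable_fun setT (fun x => N0 N * g' x).
      by apply: measurable_funM.
    by apply: mNg => //; exact: measurable_itv.
  apply/seteqP; split=> x /=; rewrite in_itv/=.
    by move=> <-; apply: truncn_itv; rewrite mulr_ge0// ltW.
  exact: truncn_def.
have gNE N x : gN N x = \sum_(k < m N) (k%:R / N0 N) * \1_[set x | q N x = k] x.
  rewrite (bigD1 (Ordinal (q_lt N x)))//= big1 ?addr0 => [|k kq].
    by rewrite indicE mem_set// mulr1.
  rewrite indicE memNset ?mulr0//= => qk; move: kq.
  by rewrite -(inj_eq val_inj)/= -qk eqxx.
have b1 B : measurable B -> ess_bounded (unif R d) (\1_B : _ -> R).
  move=> mB; apply: (@ess_boundedW _ _ _ _ _ 1); first exact: measurable_indic.
  by move=> x; rewrite indicE; case: (_ \in _); rewrite ?normr1 ?normr0.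
have h_gN N : mean P (fun o => h o * gN N (Xo o)) = 0.
  rewrite (@eq_mean _ _ _ _ _ (fun o => \sum_(k < m N)
      (k%:R / N0 N) * (h o * \1_[set x | q N x = k] (Xo o)))); last first.
    by move=> o; rewrite gNE mulr_sumr; apply: eq_bigr => k _; rewrite mulrCA.
  have bh1 (k : nat) : ess_bounded P (fun o => h o * \1_[set x | q N x = k] (Xo o)).
    by apply: ess_boundedM => //; apply: ess_bounded_Xo; exact: b1.
  rewrite mean_sum => [|k _]; last exact: ess_boundedZ.
  by apply: big1 => k _; rewrite meanZ// h_indic// mulr0.
have [mh [C hC]] := bh.
have bg' : ess_bounded (unif R d) g'.
  by apply: (@ess_boundedW _ _ _ _ _ (`|K| + `|K|)) => // x; rewrite ger0_norm.
have bgN N : ess_bounded (unif R d) (gN N).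
  apply: (eq_ess_bounded (fun x => esym (gNE N x))).
  by apply: ess_bounded_sum => k _; apply: ess_boundedZ; exact: b1.
have h_g' : mean P (fun o => h o * g' (Xo o)) = 0.
  have bhg := ess_boundedM bh (ess_bounded_Xo bg').
  apply/eqP; rewrite -normr_le0; apply/ler_addgt0Pr => e e0; rewrite add0r.
  pose N := Num.truncn (`|C| / e).
  rewrite -[X in `|X|]subr0 -(h_gN N) -meanB//; last first.
    by apply: ess_boundedM => //; exact: ess_bounded_Xo.
  apply: le_norm_mean.
    apply: ess_boundedB => //.
    by apply: ess_boundedM => //; exact: ess_bounded_Xo.
  apply: filterS hC => o hC; rewrite -mulrBr normrM.
  apply: (@le_trans _ _ (`|C| * (N0 N)^-1)).
    by apply: ler_pM => //; exact: le_trans hC (ler_norm _).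
  rewrite ler_pdivrMr// mulrC -ler_pdivrMr//.
  exact/ltW/truncnS_gt.
have gE : {ae unif R d, forall x, g x = g' x - `|K|}.
  apply: filterS gK => x gK; have := le_trans gK (ler_norm K).
  rewrite ler_norml => /andP[g1 g2]; rewrite /g' min_r ?lerD2r//.
  by rewrite max_r ?addrK// -lerBlDr sub0r.
rewrite (@ae_eq_mean _ _ _ _ _ (fun o => h o * g' (Xo o) - `|K| * (h o * \1_setT (Xo o)))).
- have bh1 : ess_bounded P (fun o => h o * \1_setT (Xo o)).
    by apply: ess_boundedM => //; apply: ess_bounded_Xo; exact: b1.
  rewrite meanB; [|by apply: ess_boundedM => //; exact: ess_bounded_Xo|exact: ess_boundedZ].
  by rewrite h_g' meanZ// h_indic// mulr0 subr0.
- by have [] := ess_boundedM bh bgX.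
- have bh1 : ess_bounded P (fun o => h o * \1_setT (Xo o)).
    by apply: ess_boundedM => //; apply: ess_bounded_Xo; exact: b1.
  have [] // := ess_boundedB (ess_boundedM bh (ess_bounded_Xo bg')) (ess_boundedZ `|K| bh1).
- apply: filterS (ae_preserving measurable_Xo PX gE) => o ->.
  by rewrite indicT mulr1 mulrBr; congr (_ - _); rewrite mulrC.
Qed.

Lemma ess_bounded_Xo_inv f : measurable_fun setT f ->
  ess_bounded P (fun o => f (@Xo R d o)) -> ess_bounded (unif R d) f.
Proof.
move=> mf [_ [C [N [mN N0 NC]]]]; split=> //; exists C.
have mB : measurable [set x | C < `|f x|].
  have mnf : measurable_fun setT (fun x => `|f x|) by exact: measurableT_comp.
  have := mnf measurableT [set` `]C, +oo[] (measurable_itv _).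
  by rewrite setTI; congr measurable; apply/seteqP; split=> x/=; rewrite in_itv/= andbT.
exists [set x | C < `|f x|]; split => //.
- apply: (eq_trans (esym (PX mB))).
  apply: (subset_measure0 (measurable_preXo mB) mN _ N0).
  by move=> o /= Co; apply: NC => /=; apply/negP; rewrite -ltNge.
- by move=> x /= /negP; rewrite -ltNge.
Qed.

Lemma cond_exp_ess_bounded Q f : ess_bounded P Q -> is_cond_exp P Q f ->
  ess_bounded (unif R d) f.
Proof.
move=> bQ cf; apply: ess_bounded_Xo_inv; first by case: cf.
exact: ess_bounded_cond_exp cf.
Qed.

Lemma mean_cond_exp Q f g : ess_bounded P Q -> is_cond_exp P Q f ->
  ess_bounded (unif R d) g ->
  mean P (fun o => Q o * g (Xo o)) = mean (unif R d) (fun x => f x * g x).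
Proof.
move=> bQ cf bg; rewrite (cond_exp_pull_out bQ cf bg).
have bf := cond_exp_ess_bounded bQ cf.
exact: (mean_Xo (ess_boundedM bf bg)).
Qed.

(** [E Cov(A, Y | X) = E(AY) - E(p(X) b(X))]; pulling out twice replaces the versions
    of the regression functions chosen inside [psi] by [p] and [b]. *)
Lemma psiE p b : ess_bounded P (@Ao R d) -> ess_bounded P (@Yo R d) ->
  is_cond_exp P (@Ao R d) p -> is_cond_exp P (@Yo R d) b ->
  psi P = mean P (fun o => Ao o * Yo o) - mean (unif R d) (fun x => p x * b x).
Proof.
move=> bA bY cp cb.
set p' := cond_exp P (@Ao R d); set b' := cond_exp P (@Yo R d).
rewrite (_ : psi P =
  fine 'E_P[cond_exp P (fun o => (Ao o - p' (Xo o)) * (Yo o - b' (Xo o))) \o @Xo R d])//.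
have cp' : is_cond_exp P (@Ao R d) p' := cond_expP bA.
have cb' : is_cond_exp P (@Yo R d) b' := cond_expP bY.
have bp' := cond_exp_ess_bounded bA cp'; have bb' := cond_exp_ess_bounded bY cb'.
have bp := cond_exp_ess_bounded bA cp; have bb := cond_exp_ess_bounded bY cb.
have bp'X := ess_bounded_Xo bp'; have bb'X := ess_bounded_Xo bb'.
have bAY := ess_boundedM bA bY.
have bAb := ess_boundedM bA bb'X; have bpY := ess_boundedM bp'X bY.
have bpb := ess_boundedM bp'X bb'X.
have bQ := ess_boundedM (ess_boundedB bA bp'X) (ess_boundedB bY bb'X).
have := cond_expP bQ.
set f := cond_exp P _; move=> [mf If fE].
rewrite unlock.
have := fE setT measurableT; rewrite preimage_setT => <-.
rewrite EFin_mean//= (@eq_mean _ _ _ _ _ (fun o => (Ao o * Yo o - Ao o * b' (Xo o))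
  - (p' (Xo o) * Yo o - p' (Xo o) * b' (Xo o)))); last first.
  by move=> o; rewrite mulrBl !mulrBr.
rewrite meanB; [|exact: ess_boundedB..].
rewrite !meanB//.
have -> : mean P (fun o => p' (Xo o) * Yo o) = mean P (fun o => p' (Xo o) * b' (Xo o)).
  rewrite (@eq_mean _ _ _ _ _ (fun o => Yo o * p' (Xo o))); last by move=> o; rewrite mulrC.
  rewrite (cond_exp_pull_out bY cb' bp').
  by apply: eq_mean => o; rewrite mulrC.
rewrite subrr subr0; congr (_ - _).
rewrite (cond_exp_pull_out bA cp bb').
rewrite (@eq_mean _ _ _ _ _ (fun o => b' (Xo o) * p (Xo o))); last by move=> o; rewrite mulrC.
rewrite -(cond_exp_pull_out bY cb' bp) (mean_cond_exp bY cb bp).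
by apply: eq_mean => x; rewrite mulrC.
Qed.

End conditional_expectation.

(** * Wavelet expansions *)

Section unit_cube.
Context (R : realType) (d : nat).

Lemma ae_cube : {ae unif R d, forall x, cube x}.
Proof.
have u01 : {ae uniform_prob (@ltr01 R), forall t, 0 <= t <= 1}.
  exists (~` [set` `[0, 1]]); split.
  - by apply: measurableC; exact: measurable_itv.
  - rewrite probability_setC; last exact: measurable_itv.
    have u1 : uniform_prob (@ltr01 R) [set` `[0, 1]] = 1%E.
      by apply: integral_uniform_pdf1 => //; exact: ltr01.
    by rewrite [X in (_ - X)%E]u1 subee.
  - by move=> t /= /negP; rewrite in_itv/= => /negP.
have : {ae unif R d, forall x : point R d, forall i, 0 <= tnth x i <= 1}.
  apply: filter_forall => i.
  exact: (ae_preserving (measurable_tnth i) (@tnth_preserving _ _ _ _ _ i) u01).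
by [].
Qed.

Lemma measurable_cube : measurable (@cube R d).
Proof.
rewrite (_ : @cube R d = \bigcap_(i in [set: 'I_d])
    ((fun x : point R d => tnth x i) @^-1` [set` `[0, 1]])).
  apply: fin_bigcap_measurable => // i _.
  rewrite -[X in measurable X]setTI.
  exact: (measurable_tnth i measurableT (measurable_itv _)).
apply/seteqP; split=> x /= h i; last by have := h i I; rewrite /= in_itv.
by move=> _; rewrite /= in_itv/=; exact: h.
Qed.

Lemma integral_cube (f : point R d -> R) : ess_bounded (unif R d) f ->
  (\int[unif R d]_(x in @cube R d) (f x)%:E = (mean (unif R d) f)%:E)%E.
Proof.
move=> bf; have [mf _] := bf; rewrite -EFin_mean// integral_mkcond.
have mf' : measurable_fun setT (EFin \o f) by exact/measurable_EFinP.
apply: ae_eq_integral => //.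
- apply/(measurable_restrictT _ measurable_cube).
  exact: measurable_funTS.
- by apply: filterS ae_cube => x cx _; rewrite patchE mem_set.
Qed.

Lemma inner_mean (f g : point R d -> R) : measurable_fun setT f ->
  measurable_fun setT g -> inner f g = mean (unif R d) (fun x => f x * g x).
Proof.
move=> mf mg; have mfg := measurable_funM mf mg.
rewrite /inner Rintegral_mkcond; apply: ae_eq_mean => //.
- apply/(measurable_restrictT _ measurable_cube).
  exact: measurable_funTS.
- by apply: filterS ae_cube => x cx; rewrite patchE mem_set.
Qed.

Lemma eq_inner (f f' g : point R d -> R) : (forall x, cube x -> f x = f' x) ->
  inner f g = inner f' g.
Proof.
by move=> ff'; apply: eq_Rintegral => x; rewrite inE => cx /=; rewrite ff'.
Qed.

End unit_cube.

Section wavelets.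
Context (R : realType) (d S J0 : nat) (W : cdv_basis R d S J0).

Local Notation U := (unif R d).

Let bounded_level j C (f : point R d -> R) : measurable_fun setT f ->
  (forall x, `|f x| <= C * Num.sqrt (2 ^+ (j * d))) -> ess_bounded U f.
Proof. by move=> mf fC; exact: ess_boundedW mf fC. Qed.

Lemma ess_bounded_Phi j (m : Z W j) : (J0 <= j)%N -> ess_bounded U (Phi m).
Proof.
move=> j0; have [C bC] := bounded_basis W.
by apply: (bounded_level (measurable_Phi m)) => x; have [h _] := bC j j0 m x; exact: h.
Qed.

Lemma ess_bounded_Psi l iota (m : Z W l) : (J0 <= l)%N ->
  ess_bounded U (Psi iota m).
Proof.
move=> l0; have [C bC] := bounded_basis W.
by apply: (bounded_level (measurable_Psi iota m)) => x; have [_ h] := bC l l0 m x; exact: h.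
Qed.

Definition Psi_pair l (q : wtype d * Z W l) := Psi q.1 q.2.

(** The second orthonormal basis of [V_(l+1)] given by the multiresolution. *)
Definition level_basis l (q : Z W l + wtype d * Z W l) : point R d -> R :=
  match q with inl m => Phi m | inr im => Psi_pair im end.

Lemma mean_Phi_Phi j (m m' : Z W j) : (J0 <= j)%N ->
  mean U (fun x => Phi m x * Phi m' x) = (m == m')%:R.
Proof.
move=> j0; rewrite -(orthonormal_Phi j0) inner_mean//; exact: measurable_Phi.
Qed.

Lemma mean_Psi_Psi l (q q' : wtype d * Z W l) : (J0 <= l)%N ->
  mean U (fun x => Psi_pair q x * Psi_pair q' x) = (q == q')%:R.
Proof.
move=> l0; case: q q' => [i m] [i' m'].
rewrite xpair_eqE -(orthonormal_Psi l0) inner_mean//; exact: measurable_Psi.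
Qed.

Lemma mean_Psi_Psi0 l l' (q : wtype d * Z W l) (q' : wtype d * Z W l') :
  (J0 <= l)%N -> (J0 <= l')%N -> l != l' ->
  mean U (fun x => Psi_pair q x * Psi_pair q' x) = 0.
Proof.
move=> l0 l0' ll'.
rewrite -(orthogonal_Psi l0 l0' ll' q.1 q'.1 q.2 q'.2) inner_mean//; exact: measurable_Psi.
Qed.

Let level_sum l (c : Z W l -> R) (w : wtype d -> Z W l -> R) x :
  \sum_m c m * Phi m x + \sum_iota \sum_m w iota m * Psi iota m x
  = \sum_q (match q with inl m => c m | inr im => w im.1 im.2 end)
           * level_basis q x.
Proof. by rewrite big_sumType/= pair_bigA. Qed.

Lemma Phi_refine l (m : Z W l.+1) : (J0 <= l)%N ->
  exists c, {ae U, forall x, Phi m x = \sum_q c q * @level_basis l q x}.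
Proof.
move=> l0; case: (multiresolution W l0 (Phi m)) => + _; case=> [|c [w cw]].
  exists (fun m' => (m' == m)%:R); apply: aeW => x _.
  by rewrite (bigD1 m)//= big1 ?addr0 ?eqxx ?mul1r// => m' /negbTE ->; rewrite mul0r.
exists (fun q => match q with inl m => c m | inr im => w im.1 im.2 end).
by apply: filterS2 cw (ae_cube R d) => x cw cx; rewrite cw// level_sum.
Qed.

Lemma level_basis_coarse l (q : Z W l + wtype d * Z W l) : (J0 <= l)%N ->
  exists c : Z W l.+1 -> R, {ae U, forall x, level_basis q x = \sum_m c m * Phi m x}.
Proof.
move=> l0; case: (multiresolution W l0 (level_basis q)) => _; case=> [|c cE].
  exists (fun m => (q == inl m)%:R), (fun i m => (q == inr (i, m))%:R).
  apply: aeW => x _; rewrite level_sum (bigD1 q)//= big1 ?addr0.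
    by case: q => [m|[i m]]; rewrite eqxx mul1r.
  by move=> [m|[i m]]; rewrite eq_sym => /negbTE ->; rewrite mul0r.
by exists c; apply: filterS2 cE (ae_cube R d) => x cE cx; rewrite cE.
Qed.

Lemma mean_ae_comb (I : finType) (e : I -> point R d -> R) (c : I -> R) f g :
  (forall i, ess_bounded U (e i)) -> ess_bounded U f -> ess_bounded U g ->
  {ae U, forall x, g x = \sum_i c i * e i x} ->
  mean U (fun x => f x * g x) = \sum_i c i * mean U (fun x => f x * e i x).
Proof.
move=> be bf bg gE; rewrite -mean_mul_comb//; apply: ae_eq_mean.
- by have [] := ess_boundedM bf bg.
- by have [] := ess_boundedM bf (ess_bounded_comb be c).
- by apply: filterS gE => x ->.
Qed.

Lemma ess_bounded_level l q : (J0 <= l)%N -> ess_bounded U (@level_basis l q).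
Proof. by move=> l0; case: q => [m|im]; [exact: ess_bounded_Phi|exact: ess_bounded_Psi]. Qed.

Let base l l' (m : Z W l) (q : wtype d * Z W l') : J0 = l -> (l <= l')%N ->
  mean U (fun x => Phi m x * Psi_pair q x) = 0.
Proof.
move=> J0l; case: l / J0l m => m l'0.
by rewrite -(orthogonal_Phi_Psi l'0 q.1 m q.2) inner_mean//;
  [exact: measurable_Phi|exact: measurable_Psi].
Qed.

(** Known at the coarsest level, orthogonality to the finer wavelets propagates
    through the refinement relation. *)
Lemma mean_Phi_Psi l l' (m : Z W l) (q : wtype d * Z W l') :
  (J0 <= l)%N -> (l <= l')%N ->
  mean U (fun x => Phi m x * Psi_pair q x) = 0.
Proof.
move=> l0; elim: l l0 m => [|l IH] l0 m ll'.
  by apply: base => //; apply/eqP; rewrite -leqn0.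
have l'0 : (J0 <= l')%N := leq_trans l0 ll'.
have bq : ess_bounded U (Psi_pair q) by exact: ess_bounded_Psi.
move: l0; rewrite leq_eqVlt => /orP[/eqP J0l|l0]; first exact: base.
rewrite ltnS in l0.
have [c cE] := Phi_refine m l0.
rewrite (@eq_mean _ _ _ _ _ (fun x => Psi_pair q x * Phi m x)); last first.
  by move=> x; rewrite mulrC.
rewrite (mean_ae_comb _ bq _ cE).
- rewrite big1// => -[m'|q'] _ /=.
    rewrite (@eq_mean _ _ _ _ _ (fun x => Phi m' x * Psi_pair q x)).
      by rewrite IH ?mulr0// ltnW.
    by move=> x; rewrite mulrC.
  by rewrite mean_Psi_Psi0 ?mulr0// gtn_eqF.
- by move=> q'; exact: ess_bounded_level.
- by apply: ess_bounded_Phi; exact: leqW.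
Qed.

Lemma mean_level l (q q' : Z W l + wtype d * Z W l) : (J0 <= l)%N ->
  mean U (fun x => level_basis q x * level_basis q' x) = (q == q')%:R.
Proof.
move=> l0; case: q q' => [m|q] [m'|q'] /=.
- exact: mean_Phi_Phi.
- exact: mean_Phi_Psi.
- rewrite (@eq_mean _ _ _ _ _ (fun x => Phi m' x * Psi_pair q x)) ?mean_Phi_Psi//.
  by move=> x; rewrite mulrC.
- exact: mean_Psi_Psi.
Qed.

(** The squared distance from [f] to [V_j]. *)
Definition residual j f := mean U (fun x => f x ^+ 2)
  - \sum_(m : Z W j) mean U (fun x => f x * Phi m x) ^+ 2.

Lemma residual_ge0 j f : (J0 <= j)%N -> ess_bounded U f -> 0 <= residual j f.
Proof.
move=> j0 bf; rewrite subr_ge0; apply: bessel => //.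
  by move=> m; exact: ess_bounded_Phi.
by move=> m m'; exact: mean_Phi_Phi.
Qed.

(** The squared norm of the projection of [f] on [V_(l+1)] is computed in the two
    orthonormal bases of that space. *)
Lemma residual_step l f : (J0 <= l)%N -> ess_bounded U f ->
  residual l f = residual l.+1 f
    + \sum_(q : wtype d * Z W l) mean U (fun x => f x * Psi_pair q x) ^+ 2.
Proof.
move=> l0 bf; rewrite /residual -addrA; congr (_ + _).
have bPhi (m : Z W l.+1) : ess_bounded U (Phi m) by apply: ess_bounded_Phi; exact: leqW.
have oPhi (m m' : Z W l.+1) : mean U (fun x => Phi m x * Phi m' x) = (m == m')%:R.
  by apply: mean_Phi_Phi; exact: leqW.
have bE q := @ess_bounded_level l q l0.
pose a (m : Z W l.+1) := mean U (fun x => f x * Phi m x).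
pose p x := \sum_m a m * Phi m x.
have bp : ess_bounded U p by exact: ess_bounded_comb.
have pE : exists c, {ae U, forall x, p x = \sum_q c q * @level_basis l q x}.
  case: (multiresolution W l0 p) => + _; case=> [|c [w cw]].
    by exists a; apply: aeW => x _.
  exists (fun q => match q with inl m => c m | inr im => w im.1 im.2 end).
  by apply: filterS2 cw (ae_cube R d) => x cw cx; rewrite cw// level_sum.
have [c cE] := pE.
have := mean_sqr_span bE (fun q q' => mean_level q q' l0) bp cE.
rewrite mean_sqr_comb// => ->.
rewrite big_sumType/= opprD -addrA [X in _ = _ + X](_ : _ = 0) ?addr0.
  congr (- _); apply: eq_bigr => m _; congr (_ ^+ 2).
  have [e eE] := level_basis_coarse (inl m) l0.
  rewrite (mean_ae_comb bPhi bf (bE (inl m)) eE) (mean_ae_comb bPhi bp (bE (inl m)) eE).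
  by apply: eq_bigr => m' _; rewrite mean_comb_basis.
apply/eqP; rewrite addrC subr_eq0; apply/eqP; apply: eq_bigr => q _; congr (_ ^+ 2).
have [e eE] := level_basis_coarse (inr q) l0.
rewrite (mean_ae_comb bPhi bf (bE (inr q)) eE) (mean_ae_comb bPhi bp (bE (inr q)) eE).
by apply: eq_bigr => m' _; rewrite mean_comb_basis.
Qed.

Lemma residual_telescope j L f : (J0 <= j)%N -> (j <= L)%N -> ess_bounded U f ->
  residual j f = residual L f + \sum_(j <= l < L)
    \sum_(q : wtype d * Z W l) mean U (fun x => f x * Psi_pair q x) ^+ 2.
Proof.
move=> j0 jL bf; elim: L jL => [|L IH].
  by rewrite leqn0 => /eqP ->; rewrite big_geq ?addr0.
rewrite leq_eqVlt => /orP[/eqP <-|jL]; first by rewrite big_geq ?addr0.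
rewrite big_nat_recr//= IH// (residual_step (leq_trans j0 jL) bf) -addrA.
by congr (_ + _); rewrite addrC.
Qed.

(** The approximant provided by completeness lies in [V_L] for every large [L], and
    the projection on [V_L] is at least as close to [f]. *)
Lemma residual_small j f (eps : R) : (J0 <= j)%N -> ess_bounded U f -> 0 < eps ->
  exists2 L, (j <= L)%N & residual L f < eps.
Proof.
move=> j0 bf eps0; have [mf _] := bf.
have f2fin : (\int[U]_(x in @cube R d) (f x ^+ 2)%:E < +oo)%E.
  have i2 := ess_bounded_integrable (ess_boundedX 2 bf).
  rewrite ltey_eq integrable_fin_num//; first exact: measurable_cube.
  by apply: integrableS i2 => //; exact: measurable_cube.
have [L0 [c [w cw]]] := complete W mf f2fin eps0.
pose w' l := if (l < L0)%N then w l else fun _ _ => 0.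
pose T L x := \sum_m c m * Phi m x
  + \sum_(J0 <= l < L) \sum_iota \sum_m w' l iota m * Psi iota m x.
have TE k : exists c' : Z W (k + J0) -> R,
    {ae U, forall x, cube x -> T (k + J0)%N x = \sum_m c' m * Phi m x}.
  elim: k => [|k [c' c'E]].
    by exists c; apply: aeW => x _; rewrite /T big_geq ?addr0.
  apply/(multiresolution W (leq_addl k J0) (T (k.+1 + J0)%N)); exists c', (w' (k + J0)%N).
  apply: filterS c'E => x c'E cx; rewrite -c'E// /T addSn big_nat_recr ?leq_addl//=.
  by rewrite addrA.
pose L := maxn L0 j.
have jL : (j <= L)%N by exact: leq_maxr.
have {}TE : exists c' : Z W L -> R,
    {ae U, forall x, cube x -> T L x = \sum_m c' m * Phi m x}.
  by rewrite -(subnK (leq_trans j0 jL)); exact: TE.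
have [c' c'E] := TE.
exists L => //; apply: le_lt_trans (best_approximation _ _ c' bf) _.
- by move=> m; apply: ess_bounded_Phi; exact: leq_trans jL.
- by move=> m m'; apply: mean_Phi_Phi; exact: leq_trans jL.
have TL x : T L x = \sum_m c m * Phi m x
    + \sum_(J0 <= l < L0) \sum_iota \sum_m w l iota m * Psi iota m x.
  rewrite /T; congr (_ + _).
  have w0 a b : (L0 <= a)%N ->
      \sum_(a <= l < b) \sum_iota \sum_m w' l iota m * Psi iota m x = 0.
    move=> L0a; rewrite big_nat big1// => l /andP[al _].
    rewrite big1// => iota _; rewrite big1// => m _.
    by rewrite /w' ltnNge (leq_trans L0a al)/= mul0r.
  have [J0L0|L0J0] := leqP J0 L0; last by rewrite w0 ?(ltnW L0J0)// big_geq// ltnW.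
  rewrite (@big_cat_nat _ _ _ L0)//= ?leq_maxl// (w0 L0 L)// addr0.
  apply: eq_big_nat => l /andP[_ lL0]; rewrite /w' lL0//.
have bT : ess_bounded U (T L).
  apply: ess_boundedD.
    by apply: ess_bounded_comb => m; exact: ess_bounded_Phi.
  apply: (@eq_ess_bounded _ _ _ _ (fun x => \sum_(l <- index_iota J0 L | (J0 <= l < L)%N)
     \sum_iota \sum_m w' l iota m * Psi iota m x)).
    by move=> x; rewrite [RHS]big_nat_cond; apply: eq_bigl => l; rewrite andbT.
  apply: ess_bounded_sum => l /andP[l0 _].
  do 2![apply: ess_bounded_sum => ? _]; apply: ess_boundedZ.
  exact: ess_bounded_Psi.
rewrite -lte_fin; apply: le_lt_trans cw.
rewrite (_ : (\int[U]_(x in cube (d:=d)) _)%E =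
  (\int[U]_(x in @cube R d) ((f x - T L x) ^+ 2)%:E)%E); last first.
  by apply: eq_integral => x _; rewrite TL opprD addrA.
rewrite (integral_cube (f := fun x => (f x - T L x) ^+ 2)); last first.
  by apply: ess_boundedX; exact: ess_boundedB.
rewrite lee_fin le_eqVlt; apply/orP; left; apply/eqP.
have bc : ess_bounded U (fun x => \sum_m c' m * Phi m x).
  by apply: ess_bounded_comb => m; apply: ess_bounded_Phi; exact: leq_trans jL.
apply: ae_eq_mean.
- by have [] := ess_boundedX 2 (ess_boundedB bf bc).
- by have [] := ess_boundedX 2 (ess_boundedB bf bT).
- by apply: filterS2 c'E (ae_cube R d) => x c'E cx; rewrite c'E.
Qed.

Lemma holder_ballP a M h : holder_ball W a M h -> forall l iota (m : Z W l),
  (J0 <= l)%N -> 2 `^ (l%:R * (a + d%:R / 2)) * `|inner h (Psi iota m)| <= M.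
Proof.
move=> [_ hM] l iota m l0; rewrite -lee_fin; apply: le_trans hM.
rewrite -[leLHS]add0e; apply: leeD.
  rewrite lee_fin mulr_ge0 ?powR_ge0//.
  by elim/big_ind: _ => // x y x0 y0; rewrite le_max x0.
by apply: ereal_sup_ubound; exists l, iota, m.
Qed.

(** At level [l] there are at most a constant times [2^(ld)] coefficients, each at
    most [M 2^(-l(a + d/2))]: the level contributes [O(2^(-2la))]. *)
Lemma residual_holder (a M : R) : 0 < a -> exists2 C, 0 < C &
  forall h, ess_bounded U h -> holder_ball W a M h -> forall j, (J0 <= j)%N ->
  residual j h <= C * (2 `^ (- (j%:R * a))) ^+ 2.
Proof.
move=> a0; have [c0 [C0 [_ cardC]]] := card_Z W.
pose r : R := 2 `^ (- (2 * a)).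
have r0 : 0 < r by exact: powR_gt0.
have r1 : r < 1.
  by rewrite /r /powR gt_eqF// expR_lt1 mulNr oppr_lt0 !mulr_gt0// ln_gt0// ltr1n.
have rE l : (2 `^ (- (l%:R * a))) ^+ 2 = r ^+ l.
  rewrite -(powR_mulrn 2 (powR_ge0 _ _)) -(powR_mulrn l (powR_ge0 _ _)) -!powRrM.
  by congr (_ `^ _); ring.
pose B := #|wtype d|%:R * `|C0| * M ^+ 2.
have B0 : 0 <= B by rewrite /B mulr_ge0 ?sqr_ge0// mulr_ge0.
exists ((B + 1) / (1 - r)); first by rewrite divr_gt0 ?subr_gt0// ltr_wpDl.
move=> h bh hM j j0; rewrite rE.
have level l : (J0 <= l)%N ->
    \sum_(q : wtype d * Z W l) mean U (fun x => h x * Psi_pair q x) ^+ 2 <= B * r ^+ l.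
  move=> l0; set t : R := 2 `^ (l%:R * (a + d%:R / 2)).
  have t0 : 0 < t by exact: powR_gt0.
  have t2 : t ^+ 2 * r ^+ l = 2 ^+ (l * d).
    rewrite -rE -(@powR_mulrn _ 2 (l * d))// -!(powR_mulrn 2 (powR_ge0 _ _)) -!powRrM.
    rewrite -powRD; last by rewrite pnatr_eq0 implybT.
    by congr (_ `^ _); rewrite natrM; field.
  have h1 : \sum_(q : wtype d * Z W l) mean U (fun x => h x * Psi_pair q x) ^+ 2 <=
      \sum_(q : wtype d * Z W l) (M / t) ^+ 2.
    apply: ler_sum => q _; have := holder_ballP hM q.1 q.2 l0.
    rewrite inner_mean//; [|by case: bh|exact: measurable_Psi].
    rewrite mulrC -ler_pdivlMr// => hq; rewrite -[leLHS]real_normK ?num_real//.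
    by rewrite lerXn2r// nnegrE// (le_trans _ hq).
  apply: (le_trans h1).
  rewrite sumr_const card_prod -mulr_natl natrM.
  have /andP[_ cZ] := cardC l l0.
  rewrite (_ : B * r ^+ l = #|wtype d|%:R * (`|C0| * 2 ^+ (l * d)) * (M / t) ^+ 2).
    apply: ler_wpM2r; first exact: sqr_ge0.
    by rewrite ler_wpM2l// (le_trans cZ)// ler_wpM2r ?exprn_ge0// ler_norm.
  by rewrite -t2 /B; field; rewrite gt_eqF.
have geo L : \sum_(j <= l < L) B * r ^+ l <= B / (1 - r) * r ^+ j.
  have r10 : 0 < 1 - r by rewrite subr_gt0.
  have [jL|Lj] := leqP j L; last first.
    rewrite big_geq; last exact: ltnW.
    by apply: mulr_ge0; [apply: divr_ge0|apply: exprn_ge0] => //; exact: ltW.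
  rewrite -(@ler_pM2r _ (1 - r))// mulrAC divfK ?gt_eqF//.
  rewrite mulr_suml (@eq_big_nat _ _ _ _ _ _ (fun l => - (B * r ^+ l.+1) - - (B * r ^+ l))).
    by rewrite telescope_sumr// opprK addrC lerBlDr lerDl mulr_ge0// exprn_ge0// ltW.
  by move=> l _; rewrite exprS; ring.
apply/ler_addgt0Pr => eps eps0.
have [L jL resL] := residual_small j0 bh eps0.
rewrite (residual_telescope j0 jL bh) addrC lerD ?ltW//.
apply: le_lt_trans (_ : _ <= B / (1 - r) * r ^+ j) _; last first.
  rewrite ltr_pM2r ?exprn_gt0// ltr_pM2r ?invr_gt0 ?subr_gt0//.
  by rewrite ltrDl.
apply: le_trans (geo L).
rewrite !big_nat; apply: ler_sum => l /andP[jl _].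
by apply: level; exact: leq_trans jl.
Qed.

End wavelets.

(** * Cosine waves *)

Section one_dimensional.
Context (R : realType).

Lemma mean_value_bound (F dF : R -> R) n :
  (forall u : R, is_derive u (1 : R) F (dF u)) -> F 0 = 0 ->
  (forall u, `|dF u| <= `|u| ^+ n) -> forall u, `|F u| <= `|u| ^+ n.+1.
Proof.
move=> FdF F0 dFn u.
have cF (A : set R) : {within A, continuous F}.
  apply: continuous_subspaceT => x; apply: differentiable_continuous.
  by apply/derivable1_diffP; have [] := FdF x.
have [u0|u0] := leP 0 u.
  have [c] := MVT_segment u0 (fun x _ => FdF x) (cF _).
  rewrite in_itv/= => /andP[c0 cu]; rewrite F0 !subr0 => ->.
  rewrite normrM exprSr ler_wpM2r// (le_trans (dFn c))// lerXn2r ?nnegrE//.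
  by rewrite !ger0_norm.
have [c] := MVT_segment (ltW u0) (fun x _ => FdF x) (cF _).
rewrite in_itv/= => /andP[c0 cu]; rewrite F0 !sub0r => /eqP.
rewrite eqr_oppLR => /eqP ->; rewrite normrN normrM normrN exprSr ler_wpM2r//.
rewrite (le_trans (dFn c))// lerXn2r ?nnegrE//.
by rewrite !ler0_norm ?lerN2// ltW.
Qed.

(** By induction: the expansion of [cos (phi + pi/2 + u) = - sin (phi + u)] is
    integrated in [u]. *)
Lemma cos_taylor n (phi : R) : exists2 p : {poly R}, (size p <= n)%N &
  forall u, `|cos (phi + u) - p.[u]| <= `|u| ^+ n.
Proof.
elim: n phi => [|n IH] phi.
  by exists 0; rewrite ?size_poly0// => u; rewrite horner0 subr0 expr0 cos_max.
have [p sp pP] := IH (phi + pi / 2).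
pose q := \poly_(i < n.+1) (if i is k.+1 then p`_k / k.+1%:R else cos phi).
have qd : q^`() = p.
  apply/polyP => i; rewrite coef_deriv coef_poly ltnS.
  case: ltnP => [_|ni]; last by rewrite mul0rn nth_default// (leq_trans sp).
  by rewrite -(mulr_natr (_ / _)) divfK// pnatr_eq0.
exists q; first exact: size_poly.
pose F (u : R) := cos (phi + u) - q.[u].
have F'E (u : R) : is_derive u (1 : R) F (cos (phi + pi / 2 + u) - p.[u]).
  have -> : cos (phi + pi / 2 + u) - p.[u] = - sin (phi + u) * 1 - q^`().[u].
    by rewrite mulr1 qd -cosDpihalf; congr (cos _ - _); ring.
  apply: is_deriveB; apply: (is_derive1_comp (f := cos)).
  by rewrite -[X in is_derive _ _ _ X]add0r; apply: is_deriveD.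
have F0 : F 0 = 0 by rewrite /F addr0 horner_coef0 coef_poly/= subrr.
exact: mean_value_bound F'E F0 pP.
Qed.

Lemma cos_lipschitz (x y : R) : `|cos x - cos y| <= `|x - y|.
Proof.
have [p sp pP] := cos_taylor 1 y.
have := pP (x - y); have := pP 0.
rewrite (size1_polyC sp) !hornerC normr0 expr1 expr1 addr0 subrKC normr_le0 subr_eq0.
by move=> /eqP ->.
Qed.

Lemma continuous_cos_affine (w phi : R) : continuous (fun t : R => cos (phi + w * t)).
Proof.
move=> t; apply: (@continuous_comp _ _ _ (fun t : R => phi + w * t) cos).
  apply: continuousD; first exact: cst_continuous.
  by apply: continuousM; [exact: cst_continuous|exact: cvg_id].
exact: continuous_cos.
Qed.

Lemma measurable_cos_affine (w phi : R) :
  measurable_fun setT (fun t : measurableTypeR R => cos (phi + w * t)).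
Proof. by apply: continuous_measurable_fun; exact: continuous_cos_affine. Qed.

Local Notation U1 := (uniform_prob (@ltr01 R)).

Lemma ess_bounded_cos d (T : measurableType d) (P : probability T R) (f : T -> R) :
  measurable_fun setT f -> ess_bounded P (fun x => cos (f x)).
Proof.
move=> mf; apply: (@ess_boundedW _ _ _ _ _ 1); last by move=> x; exact: cos_max.
apply: measurableT_comp => //.
by apply: continuous_measurable_fun; exact: continuous_cos.
Qed.

(** The nonnegative [1 + cos] is integrated in place of [cos]. *)
Lemma mean_cos_uniform (k : int) phi : k != 0 ->
  mean U1 (fun t => cos (phi + (2 * pi * k%:~R) * t)) = 0.
Proof.
move=> k0; set w := 2 * pi * k%:~R.
have w0 : w != 0 by rewrite !mulf_neq0 ?intr_eq0// gt_eqF// pi_gt0.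
have bcos : ess_bounded U1 (fun t => cos (phi + w * t)).
  apply: (@ess_boundedW _ _ _ _ _ 1); last by move=> x; exact: cos_max.
  exact: measurable_cos_affine.
suff : mean U1 (fun t => 1 + cos (phi + w * t)) = 1.
  rewrite meanD// mean_cst => /eqP.
  by rewrite -subr_eq0 addrAC subrr add0r => /eqP.
apply: EFin_inj; rewrite -EFin_mean; last exact: ess_boundedD.
have m1 : measurable_fun setT (fun t : measurableTypeR R => (1 + cos (phi + w * t))%:E).
  by apply/measurable_EFinP; apply: measurable_funD => //; exact: measurable_cos_affine.
have p1 t : (0 <= (1 + cos (phi + w * t))%:E)%E.
  by rewrite lee_fin -lerBlDl sub0r; have := cos_geN1 (phi + w * t).
rewrite (integral_uniform (@ltr01 R) m1 p1).
rewrite subr0 invr1 mul1e.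
pose F (t : R) := t + w^-1 * sin (phi + w * t).
have F'E (t : R) : is_derive t (1 : R) F (1 + cos (phi + w * t)).
  have -> : 1 + cos (phi + w * t) = 1 + w^-1 *: (cos (phi + w * t) * w).
    by rewrite -[_ *: _]/(_ * _); field.
  apply: is_deriveD; apply: is_deriveZ.
  apply: (is_derive1_comp (f := sin)).
  rewrite -[X in is_derive _ _ _ X]add0r; apply: is_deriveD.
  rewrite -[X in is_derive _ _ _ X]mulr1; exact: is_deriveZ.
have cF : continuous F.
  move=> x; apply: differentiable_continuous.
  by apply/derivable1_diffP; have [] := F'E x.
rewrite (@continuous_FTC2 _ _ F)//.
- have -> : F 1 = 1 + F 0.
    rewrite /F mulr0 mulr1 add0r addr0; congr (_ + _ * _).
    rewrite /w; case: (k) => n.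
      rewrite (_ : phi + _ = phi + (pi *+ 2) *+ n) ?(periodicn (@sinD2pi R))//.
      by rewrite -[(pi *+ 2) *+ n]mulr_natr; ring.
    rewrite -[LHS](periodicn (@sinD2pi R) n.+1) NegzE; congr sin.
    by rewrite -[(pi *+ 2) *+ n.+1]mulr_natr mulrNz -[n.+1%:Z%:~R]/(n.+1%:R); ring.
  by rewrite -EFinB addrK.
- apply: continuous_subspaceT => x.
  by apply: continuousD; [exact: cst_continuous|exact: continuous_cos_affine].
- split.
  + by move=> x _; have [] := F'E x.
  + by apply: cvg_at_right_filter; exact: cF.
  + by apply: cvg_at_left_filter; exact: cF.
- by move=> x _; rewrite derive1E; have [_ ->] := F'E x.
Qed.

End one_dimensional.

Section waves.
Context (R : realType).
Local Notation U1 := (uniform_prob (@ltr01 R)).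

Definition phase n (w : 'I_n -> R) (x : n.-tuple (measurableTypeR R)) : R :=
  \sum_i w i * tnth x i.

Lemma measurable_phase n (w : 'I_n -> R) : measurable_fun setT (phase w).
Proof.
apply: measurable_sum => i; apply: measurable_funM => //.
exact: measurable_tnth.
Qed.

Lemma ess_bounded_wave n (P : probability (n.-tuple (measurableTypeR R)) R)
  (w : 'I_n -> R) phi : ess_bounded P (fun x => cos (phi + phase w x)).
Proof.
by apply: ess_bounded_cos; apply: measurable_funD => //; exact: measurable_phase.
Qed.

(** The addition formula splits off the first coordinate; the phase is kept general
    because [sin] is a shifted [cos]. *)
Lemma mean_wave n (k : 'I_n -> int) phi : (exists i, k i != 0) ->
  mean (power_prob U1 n) (fun x => cos (phi + phase (fun i => 2 * pi * (k i)%:~R) x)) = 0.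
Proof.
elim: n k phi => [k phi [[]]//|n IH] k phi knz.
set w : 'I_n.+1 -> R := fun i => 2 * pi * (k i)%:~R.
pose w' i := w (lift ord0 i).
rewrite -(mean_preserving (@measurable_tcons _ _ n) (P := power_prob U1 n.+1)
  (fun B mB => erefl _)) /=; last exact: ess_bounded_wave.
have b1 f : ess_bounded U1 (fun t => cos (f + w ord0 * t)).
  apply: (@ess_boundedW _ _ _ _ _ 1); last by move=> x; exact: cos_max.
  exact: measurable_cos_affine.
have b2 := ess_bounded_wave (power_prob U1 n) w'.
rewrite (@eq_mean _ _ _ _ _ (fun z : measurableTypeR R * n.-tuple (measurableTypeR R) =>
    cos (phi + w ord0 * z.1) * cos (0 + phase w' z.2)
  - cos (phi - pi / 2 + w ord0 * z.1) * cos (- (pi / 2) + phase w' z.2))); last first.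
  move=> [t x] /=; rewrite /phase big_ord_recl /= add0r addrA.
  rewrite [LHS](cosD (phi + w ord0 * t)).
  rewrite (_ : phi - pi / 2 + w ord0 * t = phi + w ord0 * t - pi / 2); last by ring.
  rewrite [- (pi / 2) + _]addrC !cosBpihalf.
  by congr (_ * cos _ - _ * sin _); apply: eq_bigr => i _; rewrite tnthS.
rewrite meanB.
- rewrite (mean_prod (b1 phi) (b2 0)) (mean_prod (b1 (phi - pi / 2)) (b2 (- (pi / 2)))).
  have [k0|k0] := eqVneq (k ord0) 0; last first.
    by rewrite !mean_cos_uniform// !mul0r subrr.
  have [i ki] := knz.
  have knz' : exists i, k (lift ord0 i) != 0.
    move: ki; case: (unliftP ord0 i) => [j ->|->]; first by exists j.
    by rewrite k0 eqxx.
  by rewrite !IH// !mulr0 subrr.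
- exact: (ess_boundedM (ess_bounded_fst _ (b1 phi)) (ess_bounded_snd _ (b2 0))).
- exact: (ess_boundedM (ess_bounded_fst _ (b1 (phi - pi / 2)))
    (ess_bounded_snd _ (b2 (- (pi / 2))))).
Qed.

Definition freq d N (kappa : {ffun 'I_d -> 'I_N}) (i : 'I_d) : R :=
  2 * pi * (kappa i).+1%:R.

Definition wave d (w : 'I_d -> R) (x : d.-tuple (measurableTypeR R)) : R :=
  cos (phase w x).

Lemma ess_bounded_waveE d (w : 'I_d -> R) : ess_bounded (unif R d) (wave w).
Proof.
apply: (eq_ess_bounded _ (ess_bounded_wave _ w 0)) => x.
by rewrite add0r.
Qed.

(** Product-to-sum: the frequencies [kappa + kappa'] never vanish, since the
    coordinates of [kappa] are positive. *)
Lemma mean_wave_wave d N (kappa kappa' : {ffun 'I_d -> 'I_N}) : (0 < d)%N ->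
  mean (unif R d) (fun x => wave (freq kappa) x * wave (freq kappa') x)
    = (kappa == kappa')%:R / 2.
Proof.
move=> d0; pose ks (s : int) i : int := (kappa i).+1%:Z + s * (kappa' i).+1%:Z.
rewrite (@eq_mean _ _ _ _ _ (fun x =>
    2^-1 * (cos (0 + phase (fun i => 2 * pi * (ks 1 i)%:~R) x)
     + cos (0 + phase (fun i => 2 * pi * (ks (-1) i)%:~R) x)))); last first.
  move=> x; rewrite !add0r /wave.
  have -> : phase (fun i => 2 * pi * (ks 1 i)%:~R) x = phase (freq kappa) x + phase (freq kappa') x.
    rewrite /phase -big_split/=; apply: eq_bigr => i _.
    by rewrite -mulrDl /freq /ks mul1r rmorphD/= -mulrDr.
  have -> : phase (fun i => 2 * pi * (ks (-1) i)%:~R) x =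
      phase (freq kappa) x - phase (freq kappa') x.
    rewrite /phase -sumrB/=; apply: eq_bigr => i _.
    by rewrite -mulrBl /freq /ks mulN1r rmorphB/= -mulrBr.
  by rewrite cosD cosB; field.
rewrite meanZ; last by apply: ess_boundedD; exact: ess_bounded_wave.
rewrite meanD; [|exact: ess_bounded_wave..].
rewrite mean_wave; last by exists (Ordinal d0).
rewrite add0r mulrC; congr (_ / _).
have [e|kk'] := eqVneq kappa kappa'.
  rewrite (@eq_mean _ _ _ _ _ (fun=> 1)) ?mean_cst// => x.
  rewrite add0r /phase big1 ?cos0// => i _.
  by rewrite /ks -e mulN1r subrr mulr0 mul0r.
apply: mean_wave.
have [i ki] : exists i, kappa i != kappa' i.
  apply/existsP; apply: contraNT kk' => /existsPn h; apply/eqP/ffunP => i.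
  by apply/eqP; have := h i; rewrite negbK.
exists i; rewrite /ks mulN1r subr_eq0; apply: contra ki => /eqP [h].
by apply/eqP/val_inj.
Qed.

End waves.

Section rough_wave.
Context (R : realType) (d S J0 : nat) (W : cdv_basis R d S J0).
Local Notation U := (unif R d).

(** Among the [2^((j+r)d)] orthogonal waves with frequencies below [2^(j+r)], the
    [O(2^(jd))]-dimensional space [V_j] can capture most of the energy of only a
    few: by Bessel's inequality, applied to each [Phi_(jm)], the squared norms of
    their projections sum to at most the dimension. *)
Lemma rough_wave_exists : (0 < d)%N -> exists r : nat, forall j, (J0 <= j)%N ->
  exists kappa : {ffun 'I_d -> 'I_(2 ^ (j + r))}, 4^-1 <= residual W j (wave (freq R kappa)).
Proof.
move=> d0; have [c [C [_ cardC]]] := card_Z W.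
(* [2^(rd)] exceeds twice the dimension constant [C], so that at least half of the
   energy of an average wave lies outside [V_j] *)
pose r := Num.truncn (2 * C); exists r => j j0.
pose N := (2 ^ (j + r))%N.
pose e (kappa : {ffun 'I_d -> 'I_N}) x := Num.sqrt 2 * wave (freq R kappa) x.
have bw (kappa : {ffun 'I_d -> 'I_N}) := ess_bounded_waveE (freq R kappa).
have be kappa : ess_bounded U (e kappa) by exact: ess_boundedZ.
have oe kappa kappa' : mean U (fun x => e kappa x * e kappa' x) = (kappa == kappa')%:R.
  rewrite (@eq_mean _ _ _ _ _ (fun x => 2 * (wave (freq R kappa) x * wave (freq R kappa') x))).
    rewrite meanZ; last exact: ess_boundedM.
    by rewrite mean_wave_wave// mulrC divfK.
  by move=> x; rewrite /e mulrACA -expr2 sqr_sqrtr.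
have [/existsP[kappa h]|/existsPn h] := boolP [exists kappa : {ffun 'I_d -> 'I_N},
    4^-1 <= residual W j (wave (freq R kappa))]; first by exists kappa.
exfalso.
pose p (kappa : {ffun 'I_d -> 'I_N}) (m : Z W j) :=
  mean U (fun x => wave (freq R kappa) x * Phi m x).
have plow (kappa : {ffun 'I_d -> 'I_N}) : 4^-1 <= \sum_m p kappa m ^+ 2.
  have := h kappa; rewrite -ltNge /residual.
  rewrite (@eq_mean _ _ _ _ (fun x => wave (freq R kappa) x ^+ 2)
    (fun x => wave (freq R kappa) x * wave (freq R kappa) x)).
    rewrite mean_wave_wave// eqxx mul1r => hk.
    have : 2^-1 - \sum_m p kappa m ^+ 2 < 4^-1 := hk.
    by set s := \sum_m _; lra.
  by move=> x; rewrite expr2.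
have bessel_m (m : Z W j) : \sum_kappa p kappa m ^+ 2 <= 2^-1.
  have := bessel be oe (ess_bounded_Phi m j0).
  rewrite (@eq_mean _ _ _ _ (fun x => Phi m x ^+ 2) (fun x => Phi m x * Phi m x)); last first.
    by move=> x; rewrite expr2.
  rewrite mean_Phi_Phi// eqxx => hb.
  rewrite -(@ler_pM2l _ 2)// divff// mulr_sumr; apply: le_trans hb.
  rewrite le_eqVlt; apply/orP; left; apply/eqP; apply: eq_bigr => kappa _.
  rewrite (@eq_mean _ _ _ _ (fun x => Phi m x * e kappa x)
    (fun x => Num.sqrt 2 * (wave (freq R kappa) x * Phi m x))).
    rewrite meanZ; last by apply: ess_boundedM => //; exact: ess_bounded_Phi.
    by rewrite exprMn sqr_sqrtr.
  by move=> x; rewrite /e; ring.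
have : #|{ffun 'I_d -> 'I_N}|%:R * 4^-1 <= #|Z W j|%:R * 2^-1 :> R.
  apply: (@le_trans _ _ (\sum_(kappa : {ffun 'I_d -> 'I_N}) \sum_m p kappa m ^+ 2)).
    rewrite mulr_natl -sumr_const; exact: ler_sum.
  rewrite exchange_big/= mulr_natl -sumr_const; exact: ler_sum.
rewrite card_ffun !card_ord; apply/negP; rewrite -ltNge.
have /andP[_ cZ] := cardC j j0.
have NdE : (N ^ d)%:R = 2 ^+ (j * d) * 2 ^+ (r * d) :> R.
  by rewrite /N -expnM mulnDl expnD natrM !natrX.
rewrite NdE; have p1 : (0 : R) < 2 ^+ (j * d) by rewrite exprn_gt0.
have Cr : 2 * C < 2 ^+ (r * d).
  apply: lt_le_trans (truncnS_gt (2 * C)) _; rewrite -natrX ler_nat.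
  apply: (@leq_trans (2 ^ r)%N); first exact: ltn_expl.
  by rewrite leq_exp2l// leq_pmulr.
have := ltr_pM2l p1 (2 * C) (2 ^+ (r * d)); rewrite Cr.
by move=> h1; nra.
Qed.

End rough_wave.

(** * Waves in the Hoelder balls *)

Section wave_coefficients.
Context (R : realType) (d S J0 : nat) (W : cdv_basis R d S J0).
Local Notation U := (unif R d).

Lemma ess_bounded_coord i : ess_bounded U (fun x => tnth x i).
Proof.
split; first exact: measurable_tnth.
exists 1; apply: filterS (ae_cube R d) => x /(_ i) /andP[x0 x1].
by rewrite ger0_norm.
Qed.

Lemma ess_bounded_phase w : ess_bounded U (phase w).
Proof.
apply: ess_bounded_sum => i _; apply: ess_boundedZ.
exact: ess_bounded_coord.
Qed.

Let monomial (e : 'I_d -> nat) (x : point R d) : R := \prod_i tnth x i ^+ e i.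

Let ess_bounded_monomial e : ess_bounded U (monomial e).
Proof.
by apply: ess_bounded_prod => i _; apply: ess_boundedX; exact: ess_bounded_coord.
Qed.

(** Vanishing moments, by expanding one power of the affine form at a time. *)
Lemma mean_monomial_affine l (q : wtype d * Z W l) (w : 'I_d -> R) c s e :
  (J0 <= l)%N -> (\sum_i e i + s <= S.-1)%N ->
  mean U (fun x => monomial e x * (phase w x - c) ^+ s * Psi_pair q x) = 0.
Proof.
move=> l0; have bq : ess_bounded U (Psi_pair q) by exact: ess_bounded_Psi.
have bL s' : ess_bounded U (fun x => (phase w x - c) ^+ s').
  by apply: ess_boundedX; apply: ess_boundedB => //; exact: ess_bounded_phase.
elim: s e => [|s IH] e es.
  rewrite addn0 in es; have [a aE] := polynomials W l0 es.
  have bm (m : Z W l) := ess_bounded_Phi m l0.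
  rewrite (@eq_mean _ _ _ _ _ (fun x => Psi_pair q x * monomial e x)); last first.
    by move=> x; rewrite expr0 mulr1 mulrC.
  rewrite (mean_ae_comb bm bq (ess_bounded_monomial e) (c := a)); last first.
    by apply: filterS2 aE (ae_cube R d) => x h cx; exact: h.
  rewrite big1// => m _.
  rewrite (@eq_mean _ _ _ _ _ (fun x => Phi m x * Psi_pair q x)).
    by rewrite mean_Phi_Psi// mulr0.
  by move=> x; rewrite mulrC.
pose up i (k : 'I_d) := (e k + (k == i))%N.
have upE i x : monomial (up i) x = monomial e x * tnth x i.
  rewrite /monomial /up; under eq_bigr do rewrite exprD.
  rewrite big_split/=; congr (_ * _).
  rewrite (bigD1 i)//= big1 ?mulr1 ?eqxx ?expr1// => k /negbTE ->.
  by rewrite expr0.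
rewrite (@eq_mean _ _ _ _ _ (fun x =>
   \sum_i w i * (monomial (up i) x * (phase w x - c) ^+ s * Psi_pair q x)
   - c * (monomial e x * (phase w x - c) ^+ s * Psi_pair q x))); last first.
  move=> x.
  rewrite (eq_bigr (fun i =>
    w i * tnth x i * (monomial e x * (phase w x - c) ^+ s * Psi_pair q x))).
    by rewrite -mulr_suml -/(phase w x) exprS; ring.
  by move=> i _; rewrite upE; ring.
have b3 e' : ess_bounded U (fun x => monomial e' x * (phase w x - c) ^+ s * Psi_pair q x).
  by apply: ess_boundedM => //; exact: ess_boundedM.
rewrite meanB; [|by apply: ess_bounded_sum => i _; exact: ess_boundedZ|exact: ess_boundedZ].
rewrite mean_sum => [|i _]; last exact: ess_boundedZ.
rewrite meanZ// IH; last by rewrite (leq_trans _ es)// leq_add2l.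
rewrite mulr0 subr0 big1// => i _; rewrite meanZ// IH ?mulr0//.
rewrite (leq_trans _ es)// /up big_split/= -addnA leq_add2l.
rewrite (bigD1 i)//= big1 ?addn0 ?eqxx// => k /negbTE ->.
by [].
Qed.

Lemma mean_poly_affine l (q : wtype d * Z W l) (w : 'I_d -> R) c (p : {poly R}) :
  (J0 <= l)%N -> (size p <= S)%N ->
  mean U (fun x => p.[phase w x - c] * Psi_pair q x) = 0.
Proof.
move=> l0 pS; have bq : ess_bounded U (Psi_pair q) by exact: ess_bounded_Psi.
rewrite (@eq_mean _ _ _ _ _ (fun x => \sum_(s < size p)
   p`_s * (monomial (fun=> 0%N) x * (phase w x - c) ^+ s * Psi_pair q x))); last first.
  move=> x; rewrite horner_coef mulr_suml; apply: eq_bigr => s _.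
  by rewrite /monomial big1 ?mul1r ?mulrA// => i _; rewrite expr0.
rewrite mean_sum => [|s _]; last first.
  apply: ess_boundedZ; apply: ess_boundedM => //; apply: ess_boundedM => //.
  by apply: ess_boundedX; apply: ess_boundedB => //; exact: ess_bounded_phase.
rewrite big1// => s _; rewrite meanZ; last first.
  apply: ess_boundedM => //; apply: ess_boundedM => //.
  by apply: ess_boundedX; apply: ess_boundedB => //; exact: ess_bounded_phase.
rewrite mean_monomial_affine ?mulr0// big1// add0n.
by rewrite -ltnS prednK ?(regularity_ge1 W)// (leq_trans (ltn_ord s)).
Qed.

Let indic_itv (t0 rho t : R) :
  (`|t - t0| <= rho)%R%:R = \1_([set` `[t0 - rho, t0 + rho]]) t :> R.
Proof.
rewrite indicE (_ : (t \in _) = (t \in `[t0 - rho, t0 + rho]%R)).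
  by rewrite in_itv/= ler_distl.
by apply/idP/idP => [/set_mem|/mem_set].
Qed.

Let ess_bounded_itv (t0 rho : R) :
  ess_bounded (uniform_prob (@ltr01 R)) (fun t => (`|t - t0| <= rho)%R%:R).
Proof.
suff h : ess_bounded (uniform_prob (@ltr01 R)) (\1_[set` `[t0 - rho, t0 + rho]] : _ -> R).
  by refine (eq_ess_bounded _ h) => t; rewrite indic_itv.
apply: (@ess_boundedW _ _ _ _ _ 1).
  by apply: measurable_indic; exact: measurable_itv.
by move=> t; rewrite indicE; case: (_ \in _); rewrite ?normr1 ?normr0.
Qed.

Let mean_interval (t0 rho : R) : 0 <= rho ->
  mean (uniform_prob (@ltr01 R)) (fun t => (`|t - t0| <= rho)%R%:R) <= 2 * rho.
Proof.
move=> rho0; rewrite -lee_fin -EFin_mean; last exact: ess_bounded_itv.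
pose A : set R := [set` `[t0 - rho, t0 + rho]].
have mA : measurable A by exact: measurable_itv.
have -> : (\int[uniform_prob (@ltr01 R)]_t (`|t - t0| <= rho)%R%:R%:E)%E
    = (\int[uniform_prob (@ltr01 R)]_t (\1_A t)%:E)%E.
  by apply: eq_integral => t _; rewrite indic_itv.
rewrite integral_indic// setIT.
apply: (@le_trans _ _ (\int[lebesgue_measure]_(x in A) 1%:E)%E).
  apply: ge0_le_integral => //.
  - by move=> t _; rewrite lee_fin uniform_pdf_ge0.
  - by apply/measurable_EFinP/measurable_funTS; exact: measurable_uniform_pdf.
  - by move=> t _; rewrite lee_fin /uniform_pdf subr0 invr1; case: ifP.
rewrite integral_cst// mul1e.
have muA := lebesgue_measure_itv `[t0 - rho, t0 + rho]%R.
rewrite [leLHS]muA /=.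
case: ifP => _; last by rewrite lee_fin mulr_ge0.
by rewrite -EFinB lee_fin le_eqVlt; apply/orP; left; apply/eqP; ring.
Qed.

Let mean_box (x0 : point R d) rho : 0 <= rho ->
  mean U (fun x => \prod_i (`|tnth x i - tnth x0 i| <= rho)%R%:R) <= (2 * rho) ^+ d.
Proof.
move=> rho0; pose f i (t : measurableTypeR R) : R := (`|t - tnth x0 i| <= rho)%R%:R.
have bf i : ess_bounded (uniform_prob (@ltr01 R)) (f i) by exact: ess_bounded_itv.
rewrite (mean_power_prod bf).
rewrite -[d in leRHS]card_ord -prodr_const; apply: ler_prod => i _.
rewrite mean_interval// andbT; apply: mean_ge0; first by have [] := bf i.
by apply: aeW => t; rewrite /f.
Qed.

(** A height of order [2^(ld/2)] on a support of measure of order [2^(-ld)]. *)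
Lemma mean_norm_Psi : exists2 D, 0 <= D & forall l (q : wtype d * Z W l),
  (J0 <= l)%N -> mean U (fun x => `|Psi_pair q x|) <= D / Num.sqrt (2 ^+ (l * d)).
Proof.
have [C1 bC] := bounded_basis W; have [C2 sC] := compact_support W.
exists (`|C1| * (2 * `|C2|) ^+ d) => [|l q l0].
  by rewrite mulr_ge0// exprn_ge0// mulr_ge0.
have [_ /(_ q.1) [x0 x0P]] := sC l l0 q.2.
pose rho := `|C2| / 2 ^+ l.
have rho0 : 0 <= rho by rewrite divr_ge0// exprn_ge0.
have bbox : ess_bounded U (fun x => \prod_i (`|tnth x i - tnth x0 i| <= rho)%R%:R).
  apply: ess_bounded_prod => i _.
  exact: (ess_bounded_tnth i (ess_bounded_itv (tnth x0 i) rho)).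
have bq : ess_bounded U (Psi_pair q) by exact: ess_bounded_Psi.
have s0 : 0 <= Num.sqrt (2 ^+ (l * d)) :> R by exact: sqrtr_ge0.
apply: (@le_trans _ _ (mean U (fun x => `|C1| * Num.sqrt (2 ^+ (l * d)) *
    \prod_i (`|tnth x i - tnth x0 i| <= rho)%R%:R))).
  apply: le_mean; [exact: ess_bounded_norm|exact: ess_boundedZ|].
  apply: aeW => x; have [Px0|Pxn0] := eqVneq (Psi_pair q x) 0.
    by rewrite Px0 normr0 mulr_ge0 ?mulr_ge0//; apply: prodr_ge0 => i _.
  rewrite big1 => [|i _].
    rewrite mulr1; have [_ /(_ q.1) h] := bC l l0 q.2 x.
    by apply: le_trans h _; rewrite ler_wpM2r// ler_norm.
  have := x0P x Pxn0 i => h.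
  suff -> : `|tnth x i - tnth x0 i| <= rho by [].
  by apply: le_trans h _; rewrite ler_wpM2r ?invr_ge0 ?exprn_ge0// ler_norm.
rewrite meanZ//; apply: (le_trans (ler_wpM2l _ (mean_box x0 rho0))).
  by rewrite mulr_ge0.
rewrite /rho mulrA expr_div_n -exprM -mulrA -!mulrA ler_wpM2l//.
rewrite mulrCA ler_wpM2l ?exprn_ge0 ?mulr_ge0//.
rewrite -[X in _ / X](@sqr_sqrtr _ (2 ^+ (l * d))) ?exprn_ge0//.
have sn0 : Num.sqrt (2 ^+ (l * d)) != 0 :> R by rewrite sqrtr_eq0 -ltNge exprn_gt0.
by rewrite le_eqVlt; apply/orP; left; apply/eqP; field.
Qed.

Lemma ess_bounded_horner (p : {poly R}) f : ess_bounded U f ->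
  ess_bounded U (fun x => p.[f x]).
Proof.
move=> bf; apply: (@eq_ess_bounded _ _ _ _ (fun x => \sum_(s < size p) p`_s * f x ^+ s)).
  by move=> x; rewrite horner_coef.
by apply: ess_bounded_sum => s _; apply: ess_boundedZ; exact: ess_boundedX.
Qed.

(** Below the wavelength, only the support of the wavelet matters; beyond it, the
    Taylor polynomial of the wave at the centre of the support is annihilated. *)
Lemma mean_wave_Psi : exists2 D, 0 <= D & forall Omega (w : 'I_d -> R) l
    (q : wtype d * Z W l), 0 <= Omega -> (forall i, `|w i| <= Omega) -> (J0 <= l)%N ->
  `|mean U (fun x => wave w x * Psi_pair q x)|
    <= D * Num.min 1 ((Omega / 2 ^+ l) ^+ S) / Num.sqrt (2 ^+ (l * d)).
Proof.
have [D D0 DP] := mean_norm_Psi; have [C2 sC] := compact_support W.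
pose E := (d%:R * `|C2|) ^+ S.
have E0 : 0 <= E by rewrite exprn_ge0// mulr_ge0.
exists (D * (1 + E)) => [|Omega w l q Omega0 wO l0].
  by rewrite mulr_ge0// addr_ge0.
have bq : ess_bounded U (Psi_pair q) by exact: ess_bounded_Psi.
have bw := ess_bounded_waveE w; have bnq := ess_bounded_norm bq.
set s := Num.sqrt _; have s0 : 0 <= s by exact: sqrtr_ge0.
have mnorm f t : ess_bounded U f -> (forall x, Psi_pair q x != 0 -> `|f x| <= t) ->
    0 <= t -> `|mean U (fun x => f x * Psi_pair q x)| <= t * (D / s).
  move=> bf ft t0.
  apply: (le_trans (le_normr_Rintegral measurableT
    (ess_bounded_integrable (ess_boundedM bf bq)))).
  apply: (@le_trans _ _ (mean U (fun x => t * `|Psi_pair q x|))).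
    apply: (@le_mean _ _ _ _ (fun x => `|f x * Psi_pair q x|)).
    - by apply: ess_bounded_norm; exact: ess_boundedM.
    - exact: ess_boundedZ.
    - apply: aeW => x; rewrite normrM; have [->|Pn0] := eqVneq (Psi_pair q x) 0.
        by rewrite normr0 !mulr0.
      by rewrite ler_wpM2r// ft.
  by rewrite meanZ// ler_wpM2l// DP.
have h1 : `|mean U (fun x => wave w x * Psi_pair q x)| <= 1 * (D / s).
  by apply: mnorm => // x _; exact: cos_max.
have h2 : `|mean U (fun x => wave w x * Psi_pair q x)|
    <= E * (Omega / 2 ^+ l) ^+ S * (D / s).
  have [_ /(_ q.1) [x0 x0P]] := sC l l0 q.2.
  have [p sp pP] := cos_taylor S (phase w x0).
  have bp : ess_bounded U (fun x => p.[phase w x - phase w x0]).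
    apply: ess_bounded_horner; apply: ess_boundedB => //; exact: ess_bounded_phase.
  have -> : mean U (fun x => wave w x * Psi_pair q x) =
      mean U (fun x => (wave w x - p.[phase w x - phase w x0]) * Psi_pair q x).
    have -> : mean U (fun x => (wave w x - p.[phase w x - phase w x0]) * Psi_pair q x) =
        mean U (fun x => wave w x * Psi_pair q x - p.[phase w x - phase w x0] * Psi_pair q x).
      by apply: eq_mean => x; rewrite mulrBl.
    by rewrite meanB ?(mean_poly_affine q w _ l0 sp) ?subr0//; exact: ess_boundedM.
  apply: mnorm; first exact: ess_boundedB.
    move=> x Px; rewrite -exprMn.
    have := pP (phase w x - phase w x0); rewrite subrKC => /le_trans; apply.
    rewrite lerXn2r ?nnegrE//; first by rewrite !mulr_ge0// invr_ge0 exprn_ge0.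
    rewrite /phase -sumrB; apply: (le_trans (ler_norm_sum _ _ _)).
    apply: (@le_trans _ _ (\sum_(i < d) Omega * (`|C2| / 2 ^+ l))).
      apply: ler_sum => i _; rewrite -mulrBr normrM; apply: ler_pM => //.
      by apply: le_trans (x0P x Px i) _; rewrite ler_wpM2r ?invr_ge0 ?exprn_ge0// ler_norm.
    rewrite sumr_const card_ord -mulr_natl le_eqVlt; apply/orP; left; apply/eqP; ring.
  by rewrite mulr_ge0// exprn_ge0// divr_ge0// exprn_ge0.
have Ds0 : 0 <= D / s by rewrite divr_ge0.
set m := (Omega / 2 ^+ l) ^+ S in h2 *.
have m0 : 0 <= m by rewrite exprn_ge0// divr_ge0// exprn_ge0.
rewrite (_ : D * (1 + E) * _ / s = (1 + E) * Num.min 1 m * (D / s)); last by ring.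
have [m1|m1] := leP 1 m.
  by apply: le_trans h1 _; rewrite ler_wpM2r// mulr1 lerDl.
by apply: le_trans h2 _; rewrite ler_wpM2r// ler_wpM2r// lerDr.
Qed.

Lemma holder_ballI a A B M h : unif_cont h -> 0 <= A ->
  (forall m : Z W J0, 2 `^ (J0%:R * (a + d%:R / 2)) * `|inner h (Phi m)| <= A) ->
  (forall l iota (m : Z W l), (J0 <= l)%N ->
     2 `^ (l%:R * (a + d%:R / 2)) * `|inner h (Psi iota m)| <= B) ->
  A + B <= M -> holder_ball W a M h.
Proof.
move=> ch A0 hA hB AB; split=> //; apply: (@le_trans _ _ (A%:E + B%:E)%E); last first.
  by rewrite -EFinD lee_fin.
apply: leeD.
  have t0 : 0 < 2 `^ (J0%:R * (a + d%:R / 2)) :> R by exact: powR_gt0.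
  rewrite lee_fin mulrC -ler_pdivlMr//; apply/bigmax_leP; split.
    by rewrite divr_ge0// ltW.
  by move=> m _; rewrite ler_pdivlMr// mulrC.
apply: ge_ereal_sup => _ [l [iota [m [l0 ->]]]]; rewrite lee_fin.
exact: hB.
Qed.

(** With frequencies of order [2^s] and amplitude [2^(-sa)], the coefficients at a
    level [l <= s] are bounded trivially and those at a level [l > s] decay like
    [2^((s-l)S)], faster than the required [2^((s-l)a)]: here the regularity has to
    exceed [a]. *)
Lemma wave_holder a Omega : 0 < a -> a < S%:R -> 0 <= Omega ->
  exists2 K, 0 < K & forall s (w : 'I_d -> R) delta eps,
    (forall i, `|w i| <= Omega * 2 ^+ s) -> 0 <= delta -> delta * K <= eps ->
    holder_ball W a eps (fun x => delta * 2 `^ (- (s%:R * a)) * wave w x).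
Proof.
move=> a0 aS Omega0; have [D D0 DP] := mean_wave_Psi.
pose A : R := 2 `^ (J0%:R * (a + d%:R / 2)).
have A0 : 0 < A by exact: powR_gt0.
have O1 : 0 <= 1 + Omega ^+ S by rewrite addr_ge0// exprn_ge0.
exists (A + D * (1 + Omega ^+ S)); first by rewrite ltr_wpDr// mulr_ge0.
move=> s w delta eps wO delta0 deltaK.
set t : R := 2 `^ (- (s%:R * a)); have t0 : 0 <= t by exact: powR_ge0.
have t1 : t <= 1.
  by rewrite /t -[leRHS](powRr0 2) ler_powR// ?ler1n// oppr_le0 mulr_ge0// ltW.
have bw := ess_bounded_waveE w; have [mw _] := bw.
have mdw : measurable_fun setT (fun x : point R d => delta * t * wave w x).
  exact: measurable_funM.
apply: (@holder_ballI _ (delta * A) (delta * (D * (1 + Omega ^+ S)))).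
- move=> eps' eps'0; pose B := delta * t * \sum_i `|w i|.
  have B0 : 0 <= B by rewrite mulr_ge0 ?mulr_ge0//; apply: sumr_ge0.
  have B1 : 0 < B + 1 by rewrite ltr_wpDl.
  exists (eps' / (B + 1)); first by rewrite divr_gt0.
  move=> x y _ _ xy; rewrite -mulrBr normrM (ger0_norm (mulr_ge0 _ _))//.
  apply: (@le_lt_trans _ _ (B * (eps' / (B + 1)))).
    rewrite /B -mulrA -mulrA -[leRHS]mulrA; apply: ler_wpM2l => //.
    apply: ler_wpM2l => //; apply: (le_trans (cos_lipschitz _ _)).
    rewrite /phase -sumrB mulr_suml; apply: (le_trans (ler_norm_sum _ _ _)).
    apply: ler_sum => i _; rewrite -mulrBr normrM ler_wpM2l//.
    exact/ltW/xy.
  by rewrite mulrCA gtr_pMr// ltr_pdivrMr// mul1r ltrDl.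
- by rewrite mulr_ge0// ltW.
- move=> m; rewrite inner_mean//; last exact: measurable_Phi.
  have bm := ess_bounded_Phi m (leqnn J0).
  have -> : mean U (fun x => delta * t * wave w x * Phi m x) =
      delta * t * mean U (fun x => wave w x * Phi m x).
    by rewrite -meanZ; [apply: eq_mean => x; rewrite mulrA|exact: ess_boundedM].
  have c1 : `|mean U (fun x => wave w x * Phi m x)| <= 1.
    rewrite -(@ler_pXn2r _ 2)// ?nnegrE// expr1n real_normK ?num_real//.
    apply: le_trans (mean_cauchy_schwarz bw bm) _.
    have -> : mean U (fun x => Phi m x ^+ 2) = 1.
      rewrite -[RHS](_ : (m == m)%:R = _); last by rewrite eqxx.
      by rewrite -mean_Phi_Phi//; apply: eq_mean => x; rewrite expr2.
    rewrite mulr1 -[leRHS](mean_cst U); apply: le_mean => //.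
      exact: ess_boundedX.
    apply: aeW => x; rewrite -[leLHS]real_normK ?num_real// expr_le1//.
    exact: cos_max.
  rewrite -/A !normrM (ger0_norm delta0) (ger0_norm t0) mulrC ler_wpM2r ?(ltW A0)//.
  by rewrite -mulrA ler_piMr// mulr_ile1.
- move=> l iota m l0; rewrite inner_mean//; last exact: measurable_Psi.
  have bm := ess_bounded_Psi iota m l0.
  have -> : mean U (fun x => delta * t * wave w x * Psi iota m x) =
      delta * t * mean U (fun x => wave w x * Psi iota m x).
    by rewrite -meanZ; [apply: eq_mean => x; rewrite mulrA|exact: ess_boundedM].
  have O2 : 0 <= Omega * 2 ^+ s by rewrite mulr_ge0// exprn_ge0.
  have := DP _ w l (iota, m) O2 wO l0; rewrite /Psi_pair/=.
  set c := `|mean _ _|; set mn := Num.min _ _ => hc.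
  rewrite !normrM (ger0_norm delta0) (ger0_norm t0) -/c.
  have lE : 2 `^ (l%:R * (a + d%:R / 2)) = 2 `^ (l%:R * a) * Num.sqrt (2 ^+ (l * d)) :> R.
    rewrite -powR12_sqrt ?exprn_ge0// -powR_mulrn// -powRrM -powRD ?pnatr_eq0 ?implybT//.
    by congr (_ `^ _); rewrite natrM; ring.
  have sq0 : 0 < Num.sqrt (2 ^+ (l * d)) :> R by rewrite sqrtr_gt0 exprn_gt0.
  rewrite lE; set sq := Num.sqrt _ in hc sq0 *.
  have c1 : sq * c <= D * mn by rewrite mulrC -ler_pdivlMr.
  have mn0 : 0 <= mn.
    by rewrite /mn le_min ler01 exprn_ge0// divr_ge0// exprn_ge0.
  have key : 2 `^ (l%:R * a) * t * mn <= 1 + Omega ^+ S.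
    rewrite /t -powRD; last by rewrite pnatr_eq0 implybT.
    have [ls|sl] := leqP l s.
      apply: (@le_trans _ _ (1 * 1)); last by rewrite mulr1 lerDl exprn_ge0.
      apply: ler_pM; [exact: powR_ge0|exact: mn0| |by rewrite /mn ge_min lexx].
      rewrite -[leRHS](powRr0 2) ler_powR// ?ler1n// subr_le0.
      by rewrite ler_wpM2r ?(ltW a0)// ler_nat.
    apply: (@le_trans _ _ (1 * Omega ^+ S)); last by rewrite mul1r lerDr.
    apply: (@le_trans _ _ (2 `^ (l%:R * a - s%:R * a) * (Omega * 2 ^+ s / 2 ^+ l) ^+ S)).
      by rewrite ler_wpM2l ?powR_ge0// /mn ge_min lexx orbT.
    rewrite -(mulrA Omega) exprMn mulrCA mulrC ler_wpM2r ?exprn_ge0//.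
    have -> : (2 ^+ s / 2 ^+ l) ^+ S = 2 `^ ((s%:R - l%:R) * S%:R) :> R.
      rewrite powRrM powR_mulrn ?powR_ge0// powRB ?powR_mulrn//.
      by rewrite pnatr_eq0 implybT.
    rewrite -powRD; last by rewrite pnatr_eq0 implybT.
    rewrite -[leRHS](powRr0 2) ler_powR// ?ler1n//.
    rewrite (_ : _ + _ = (l%:R - s%:R) * (a - S%:R)); last by ring.
    apply: mulr_ge0_le0; first by rewrite subr_ge0 ler_nat ltnW.
    by rewrite subr_le0 ltW.
  rewrite (_ : _ * _ * _ = delta * (2 `^ (l%:R * a) * t) * (sq * c)); last by ring.
  apply: (@le_trans _ _ (delta * (2 `^ (l%:R * a) * t) * (D * mn))).
    by rewrite ler_wpM2l// mulr_ge0// mulr_ge0// powR_ge0.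
  rewrite (_ : _ * (D * mn) = delta * (D * (2 `^ (l%:R * a) * t * mn))); last by ring.
  by rewrite ler_wpM2l// ler_wpM2l.
- by rewrite -mulrDr.
Qed.

End wave_coefficients.

(** * Bias and variance over the Hoelder model *)

Section estimator.
Context (R : realType) (d S J0 : nat) (W : cdv_basis R d S J0).
Local Notation U := (unif R d).

(** The bias of the plug-in estimator for the regression functions [p] and [b], when
    [v] is the value of [E(A Y K(X, X))]. *)
Definition bias_value (n j : nat) (p b : point R d -> R) (v : R) : R :=
  mean U (fun x => p x * b x)
  - (1 - n%:R^-1) * \sum_(m : Z W j) mean U (fun x => p x * Phi m x)
      * mean U (fun x => b x * Phi m x)
  - n%:R^-1 * v.

(** The bias when [A = p(X)] and [Y = b(X)], a bilinear form in [(p, b)]. *)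
Definition bias_form (n j : nat) (p b : point R d -> R) : R :=
  bias_value n j p b (mean U (fun x => p x * b x * proj_kernel W j x x)).

Lemma ess_bounded_kernel j : (J0 <= j)%N -> ess_bounded U (fun x => proj_kernel W j x x).
Proof.
move=> j0; apply: ess_bounded_sum => m _.
by apply: ess_boundedM; exact: ess_bounded_Phi.
Qed.

Lemma mean_kernel j : (J0 <= j)%N ->
  mean U (fun x => proj_kernel W j x x) = #|Z W j|%:R.
Proof.
move=> j0; have bm (m : Z W j) := ess_bounded_Phi m j0.
rewrite mean_sum => [|m _]; last exact: ess_boundedM.
rewrite (eq_bigr (fun=> 1)) => [|m _]; first by rewrite sumr_const.
by rewrite mean_Phi_Phi// eqxx.
Qed.

Lemma kernel_ge0 j x : 0 <= proj_kernel W j x x.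
Proof. by apply: sumr_ge0 => m _; rewrite -expr2 sqr_ge0. Qed.

(** Boundedly many scaling functions are nonzero at [x], each of square [O(2^(jd))]. *)
Lemma kernel_diag_le : exists2 C, 0 <= C & forall j, (J0 <= j)%N -> forall x,
  proj_kernel W j x x <= C * 2 ^+ (j * d).
Proof.
have [C bC] := bounded_basis W; have [N fN] := locally_finite W.
exists (N%:R * C ^+ 2) => [|j j0 x]; first by rewrite mulr_ge0// sqr_ge0.
have [cN _] := fN j j0 x.
rewrite /proj_kernel (bigID (fun m : Z W j => Phi m x != 0))/= [X in _ + X]big1 ?addr0; last first.
  by move=> m; rewrite negbK => /eqP ->; rewrite mul0r.
apply: (@le_trans _ _ (\sum_(m : Z W j | Phi m x != 0) C ^+ 2 * 2 ^+ (j * d))).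
  apply: ler_sum => m _; have [h _] := bC j j0 m x.
  rewrite -expr2 -[leLHS]real_normK ?num_real//.
  rewrite -[X in _ * X](@sqr_sqrtr _ (2 ^+ (j * d))) ?exprn_ge0// -exprMn.
  by rewrite lerXn2r// nnegrE (le_trans _ h).
rewrite sumr_const -(mulr_natl (C ^+ 2 * _)) mulrA.
rewrite ler_wpM2r ?exprn_ge0// ler_wpM2r ?sqr_ge0//.
by rewrite ler_nat; apply: leq_trans cN.
Qed.

Lemma measurable_Ao : measurable_fun setT (@Ao R d).
Proof. by apply: (measurableT_comp measurable_fst); exact: measurable_snd. Qed.

Lemma measurable_Yo : measurable_fun setT (@Yo R d).
Proof. by apply: (measurableT_comp measurable_snd); exact: measurable_snd. Qed.

Section one_law.
Variables (P : probability (obs R d) R) (p b : point R d -> R) (c : R) (j n : nat).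
Hypothesis PX : forall B, measurable B -> P (@Xo R d @^-1` B) = U B.
Hypotheses (Ac : {ae P, forall o, `|Ao o| <= c}) (Yc : {ae P, forall o, `|Yo o| <= c}).
Hypotheses (cp : is_cond_exp P (@Ao R d) p) (cb : is_cond_exp P (@Yo R d) b).
Hypotheses (j0 : (J0 <= j)%N) (n0 : (0 < n)%N) (c0 : 0 <= c).

Let e (m : Z W j) (o : obs R d) := Phi m (Xo o).

Let bA : ess_bounded P (@Ao R d).
Proof. by split; [exact: measurable_Ao|exists c]. Qed.

Let bY : ess_bounded P (@Yo R d).
Proof. by split; [exact: measurable_Yo|exists c]. Qed.

Let be m : ess_bounded P (e m).
Proof. by apply: (ess_bounded_Xo PX); exact: ess_bounded_Phi. Qed.

Let oe m m' : mean P (fun o => e m o * e m' o) = (m == m')%:R.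
Proof.
rewrite -mean_Phi_Phi//; apply: (mean_Xo PX (f := fun x => Phi m x * Phi m' x)).
by apply: ess_boundedM; exact: ess_bounded_Phi.
Qed.

Let b_psi : ess_bounded (power_prob P n) (@psi_NR _ _ _ _ W j n).
Proof. exact: (ess_bounded_plug_in be bA bY). Qed.

Lemma biasE : ('E_(power_prob P n)[fun D => (psi_NR W j D - psi P)%R]
  = (bias_value n j p b
       (mean P (fun o => Ao o * Yo o * proj_kernel W j (Xo o) (Xo o))))%:E)%E.
Proof.
rewrite unlock (EFin_mean (ess_boundedB b_psi (ess_bounded_cst _ _))); congr EFin.
rewrite /bias_value meanB// mean_cst (psiE PX bA bY cp cb).
rewrite (mean_plug_in be bA bY n0)/=.
under [in LHS]eq_bigr => m _.
  rewrite (mean_cond_exp PX bA cp (ess_bounded_Phi m j0)).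
  rewrite (mean_cond_exp PX bY cb (ess_bounded_Phi m j0)).
  over.
set u := mean P _; set v := mean P _; set s := \sum_m _; set t := mean U _.
rewrite (_ : kern e = fun o o' => proj_kernel W j (Xo o) (Xo o')) in v *; last by [].
by rewrite -/v; ring.
Qed.

Lemma variance_le kappa : (forall x, proj_kernel W j x x <= kappa) ->
  (variance (power_prob P n) (@psi_NR _ _ _ _ W j n) <=
   (36 * c ^+ 4 * (1 / n%:R + #|Z W j|%:R / n%:R ^+ 2 + kappa ^+ 2 / n%:R ^+ 3))%:E)%E.
Proof.
move=> Kk; rewrite /variance unlock unlock.
rewrite (_ : fine (\int[_]_w _)%E = mean (power_prob P n) (@psi_NR _ _ _ _ W j n))//.
set mu := mean _ _.
rewrite (_ : (\int[power_prob P n]_w _)%E =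
  (\int[power_prob P n]_D ((psi_NR W j D - mu) ^+ 2)%:E)%E); last first.
  by apply: eq_integral => D _; rewrite mulrfctE expr2.
have b2 : ess_bounded (power_prob P n) (fun D => (psi_NR W j D - mu) ^+ 2).
  by apply: ess_boundedX; exact: ess_boundedB.
rewrite (EFin_mean b2) lee_fin.
apply: (variance_plug_in_le be oe bA bY Ac Yc c0 _ n0).
by apply: aeW => o; exact: Kk.
Qed.

(** Up to [1/n] times second moments and the diagonal term [E(A Y K(X, X))], of the
    order of the dimension, the bias is the inner product of the residuals. *)
Lemma abs_bias_le :
  `|bias_value n j p b (mean P (fun o => Ao o * Yo o * proj_kernel W j (Xo o) (Xo o)))|
  <= Num.sqrt (residual W j p * residual W j b)
     + c ^+ 2 * (1 + #|Z W j|%:R) / n%:R.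
Proof.
have bp := cond_exp_ess_bounded PX bA cp; have bb := cond_exp_ess_bounded PX bY cb.
have bPhi (m : Z W j) := ess_bounded_Phi m j0.
have oPhi (m m' : Z W j) := mean_Phi_Phi m m' j0.
have nn0 : 0 < n%:R^-1 :> R by rewrite invr_gt0 ltr0n.
rewrite /bias_value; set u := mean U _; set s := \sum_m _; set v := mean P _.
rewrite (_ : _ - _ = (u - s) + (s - v) / n%:R); last by ring.
apply: (le_trans (ler_normD _ _)); apply: lerD.
  rewrite -[leLHS]ger0_norm// -sqrtr_sqr ler_wsqrtr// real_normK ?num_real//.
  exact: mean_mul_residual.
rewrite normrM (ger0_norm (ltW nn0)) ler_wpM2r ?(ltW nn0)//.
apply: (le_trans (ler_normB _ _)); rewrite mulrDr mulr1; apply: lerD.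
  have sq (Q : obs R d -> R) : ess_bounded P Q -> {ae P, forall o, `|Q o| <= c} ->
      \sum_m mean P (fun o => Q o * e m o) ^+ 2 <= c ^+ 2.
    move=> bQ Qc; apply: (le_trans (bessel be oe bQ)).
    rewrite -[leRHS](mean_cst P); apply: le_mean => //; first exact: ess_boundedX.
    apply: filterS Qc => o Qo; rewrite -[leLHS]real_normK ?num_real//.
    by rewrite lerXn2r// nnegrE.
  apply: (le_trans (ler_norm_sum _ _ _)).
  apply: (@le_trans _ _ (\sum_m (mean P (fun o => Ao o * e m o) ^+ 2
     + mean P (fun o => Yo o * e m o) ^+ 2) / 2)).
    apply: ler_sum => m _.
    rewrite (mean_cond_exp PX bA cp (bPhi m)) (mean_cond_exp PX bY cb (bPhi m)).
    set x := mean U _; set y := mean U _.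
    have := sqr_ge0 (`|x| - `|y|); rewrite sqrrB !real_normK ?num_real// normrM.
    by set xx := `|x| * `|y|; lra.
  rewrite -mulr_suml big_split/= ler_pdivrMr//.
  by have := sq _ bA Ac; have := sq _ bY Yc; lra.
have bK := ess_bounded_Xo PX (ess_bounded_kernel j0).
apply: (@le_trans _ _ (mean P (fun o => c ^+ 2 * proj_kernel W j (Xo o) (Xo o)))); last first.
  rewrite meanZ// (mean_Xo PX (f := fun x => proj_kernel W j x x)) ?mean_kernel//.
  exact: ess_bounded_kernel.
have bAYK := ess_boundedM (ess_boundedM bA bY) bK.
apply: (le_trans (le_normr_Rintegral measurableT (ess_bounded_integrable bAYK))).
apply: (@le_mean _ _ _ _ (fun o => `|Ao o * Yo o * proj_kernel W j (Xo o) (Xo o)|)).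
- exact: ess_bounded_norm.
- exact: ess_boundedZ.
- apply: filterS2 Ac Yc => o Ao_c Yo_c; rewrite normrM (ger0_norm (kernel_ge0 _ _)).
  by rewrite ler_wpM2r ?kernel_ge0// normrM expr2 ler_pM.
Qed.

End one_law.

Lemma bound_of_range (C1 C2 t : R) : C1 <= t <= C2 -> `|t| <= `|C1| + `|C2|.
Proof.
move=> /andP[t1 t2]; rewrite ler_norml; apply/andP; split.
  by rewrite (le_trans _ t1)// lerNl (le_trans (ler_norm _))// normrN lerDl.
by rewrite (le_trans t2)// (le_trans (ler_norm _))// lerDr.
Qed.

Lemma resolution_powR (a : R) j : (0 < d)%N ->
  resolution R d j `^ (- (a / d%:R)) = 2 `^ (- (j%:R * a)).
Proof.
move=> d0; rewrite /resolution -powR_mulrn// -powRrM; congr (_ `^ _).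
by rewrite natrM; field; rewrite pnatr_eq0 -lt0n.
Qed.

Lemma resolution_ge1 j : 1 <= resolution R d j.
Proof. by rewrite /resolution exprn_ege1// ler1n. Qed.

Lemma bias_upper C1 C2 alpha beta M : (0 < d)%N -> 0 < alpha -> 0 < beta ->
  lesssim J0 (max_abs_bias W C1 C2 alpha beta M) (bias_rate d alpha beta).
Proof.
move=> d0 a0 b0; have [Ca Ca0 resa] := residual_holder W M a0.
have [Cb Cb0 resb] := residual_holder W M b0.
have [c' [C0 [_ cardC]]] := card_Z W.
pose c : R := `|C1| + `|C2|; have c0 : 0 <= c by rewrite addr_ge0.
pose K : R := Num.sqrt (Ca * Cb) + c ^+ 2 * (1 + `|C0|).
exists (K + 1).
  by rewrite ltr_wpDl// addr_ge0 ?sqrtr_ge0// mulr_ge0 ?sqr_ge0// addr_ge0.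
exists 1%N => n j n0 j0; apply: ge_ereal_sup => _ [P [PX rA rY [p cp hp] [b cb hb]] <-].
have Ac : {ae P, forall o, `|Ao o| <= c} by apply: filterS rA => o; exact: bound_of_range.
have Yc : {ae P, forall o, `|Yo o| <= c} by apply: filterS rY => o; exact: bound_of_range.
have bA : ess_bounded P (@Ao R d) by split; [exact: measurable_Ao|exists c].
have bY : ess_bounded P (@Yo R d) by split; [exact: measurable_Yo|exists c].
have bp := cond_exp_ess_bounded PX bA cp; have bb := cond_exp_ess_bounded PX bY cb.
rewrite (biasE PX Ac Yc cp cb j0 n0) /bias_rate abse_EFin -EFinM lee_fin.
apply: (le_trans (abs_bias_le PX Ac Yc cp cb j0 n0 c0)).
set k := resolution R d j; set m := Num.max _ _.
have k1 : 1 <= k := resolution_ge1 j.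
have m1 : k `^ (- ((alpha + beta) / d%:R)) <= m by rewrite le_max lexx.
have m2 : k / n%:R <= m by rewrite le_max lexx orbT.
have m0 : 0 <= m by apply: le_trans m1; exact: powR_ge0.
have nn0 : 0 < n%:R^-1 :> R by rewrite invr_gt0 ltr0n.
apply: (@le_trans _ _ (K * m)); last by rewrite ler_wpM2r// lerDl.
rewrite /K [leRHS]mulrDl; apply: lerD.
  apply: (@le_trans _ _ (Num.sqrt (Ca * Cb) * k `^ (- ((alpha + beta) / d%:R)))); last first.
    by rewrite ler_wpM2l// sqrtr_ge0.
  set ta : R := 2 `^ (- (j%:R * alpha)); set tb : R := 2 `^ (- (j%:R * beta)).
  have -> : k `^ (- ((alpha + beta) / d%:R)) = ta * tb.
    rewrite resolution_powR// /ta /tb -powRD; last by rewrite pnatr_eq0 implybT.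
    by congr (_ `^ _); ring.
  have tab : 0 <= ta * tb by rewrite mulr_ge0// powR_ge0.
  have Cab : 0 <= Ca * Cb by rewrite mulr_ge0// ltW.
  have -> : Num.sqrt (Ca * Cb) * (ta * tb) =
      Num.sqrt ((Ca * ta ^+ 2) * (Cb * tb ^+ 2)).
    rewrite (_ : Ca * ta ^+ 2 * _ = (Ca * Cb) * (ta * tb) ^+ 2); last by ring.
    by rewrite [RHS]sqrtrM// sqrtr_sqr ger0_norm.
  rewrite ler_wsqrtr//.
  by apply: ler_pM; [exact: residual_ge0|exact: residual_ge0|exact: resa|exact: resb].
rewrite -(mulrA (c ^+ 2) _ n%:R^-1) -(mulrA (c ^+ 2) _ m) ler_wpM2l ?sqr_ge0//.
apply: (@le_trans _ _ ((1 + `|C0|) * (k / n%:R))); last by rewrite ler_wpM2l// addr_ge0.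
rewrite mulrA ler_wpM2r ?(ltW nn0)// mulrDl mul1r; apply: lerD => //.
have /andP[_ cZ] := cardC j j0; apply: (le_trans cZ).
by rewrite ler_wpM2r ?ler_norm// (le_trans _ k1).
Qed.

Lemma variance_upper C1 C2 alpha beta M :
  lesssim J0 (max_variance W C1 C2 alpha beta M) (@variance_rate R d).
Proof.
have [c' [C0 [_ cardC]]] := card_Z W; have [K K0 KP] := kernel_diag_le.
pose c : R := `|C1| + `|C2|; have c0 : 0 <= c by rewrite addr_ge0.
pose B := 1 + `|C0| + K ^+ 2.
have B0 : 0 <= B by rewrite !addr_ge0// sqr_ge0.
exists (36 * c ^+ 4 * B + 1).
  by rewrite ltr_wpDl// !mulr_ge0// exprn_ge0.
exists 1%N => n j n0 j0; apply: ge_ereal_sup => _ [P [PX rA rY [p cp hp] [b cb hb]] <-].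
have Ac : {ae P, forall o, `|Ao o| <= c} by apply: filterS rA => o; exact: bound_of_range.
have Yc : {ae P, forall o, `|Yo o| <= c} by apply: filterS rY => o; exact: bound_of_range.
apply: (le_trans (variance_le PX Ac Yc j0 n0 c0 (KP j j0))).
rewrite /variance_rate -EFinM lee_fin; set k := resolution R d j.
have k0 : 0 <= k by rewrite (le_trans _ (resolution_ge1 j)).
have nn0 i : 0 <= (n%:R ^+ i)^-1 :> R by rewrite invr_ge0 exprn_ge0.
set r := 1 / n%:R + k / n%:R ^+ 2 + k ^+ 2 / n%:R ^+ 3.
have r0 : 0 <= r by rewrite !addr_ge0// mulr_ge0 ?sqr_ge0// ?invr_ge0.
apply: (@le_trans _ _ (36 * c ^+ 4 * B * r)); last by rewrite ler_wpM2r// lerDl.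
rewrite -(mulrA (36 * c ^+ 4) B) ler_wpM2l ?mulr_ge0 ?exprn_ge0//.
have /andP[_ cZ] := cardC j j0.
have cZ' : #|Z W j|%:R <= `|C0| * k :> R.
  by apply: (le_trans cZ); rewrite ler_wpM2r ?ler_norm.
have r1 : 0 <= 1 / n%:R :> R by rewrite divr_ge0.
have r2 : 0 <= k / n%:R ^+ 2 by rewrite mulr_ge0.
have r3 : 0 <= k ^+ 2 / n%:R ^+ 3 by rewrite mulr_ge0// sqr_ge0.
have K2 : 0 <= K ^+ 2 by rewrite sqr_ge0.
rewrite /r !mulrDr. apply: lerD; [apply: lerD|].
- by rewrite -[leLHS]mul1r ler_wpM2r// /B -addrA lerDl addr_ge0.
- apply: (@le_trans _ _ (`|C0| * (k / n%:R ^+ 2))); first by rewrite mulrA ler_wpM2r.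
  by rewrite ler_wpM2r// /B addrAC addrC lerDl addr_ge0.
- rewrite exprMn -mulrA ler_wpM2r// /B addrC lerDl addr_ge0//.
Qed.

End estimator.

(** * Noiseless laws and the lower bound for the bias *)

Section noiseless.
Context (R : realType) (d : nat) (p b : point R d -> R).
Hypotheses (mp : measurable_fun setT p) (mb : measurable_fun setT b).
Local Notation U := (unif R d).

Definition graph (x : point R d) : obs R d := (x, (p x, b x)).

Lemma measurable_graph : measurable_fun setT graph.
Proof. by apply: measurable_fun_pair => //; exact: measurable_fun_pair. Qed.

HB.instance Definition _ := isMeasurableFun.Build _ _ _ _ graph measurable_graph.

Definition noiseless_law : probability (obs R d) R := distribution U graph.

Lemma noiseless_Xo B : measurable B -> noiseless_law (@Xo R d @^-1` B) = U B.
Proof. by []. Qed.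

Lemma ae_noiseless (B : set (obs R d)) : measurable B ->
  (forall x, cube x -> B (graph x)) -> {ae noiseless_law, forall o, B o}.
Proof.
move=> mB Bg; exists (~` B); split=> //; first exact: measurableC.
have [N [mN N0 NB]] := ae_cube R d.
have mgB : measurable (graph @^-1` (~` B)).
  by rewrite -[X in measurable X]setTI; apply: measurable_graph => //; exact: measurableC.
apply: (subset_measure0 mgB mN _ N0) => x /= Bx; apply: NB => /= /Bg.
exact: Bx.
Qed.

Lemma mean_noiseless f : ess_bounded noiseless_law f ->
  mean noiseless_law f = mean U (f \o graph).
Proof.
move=> bf; rewrite (mean_preserving measurable_graph (P := noiseless_law))//.
Qed.

Lemma noiseless_cond_exp (Q : obs R d -> R) f :
  measurable_fun setT Q -> ess_bounded U f ->
  (forall x, Q (graph x) = f x) -> is_cond_exp noiseless_law Q f.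
Proof.
move=> mQ bf Qf; have [mf _] := bf.
have bfX := ess_bounded_Xo noiseless_Xo bf.
have mfX : measurable_fun setT (fun o : obs R d => f (Xo o)) by case: bfX.
have QfX : {ae noiseless_law, forall o, Q o = f (Xo o)}.
  apply: (@ae_noiseless [set o | Q o = f (Xo o)]) => [|x _]; last exact: Qf.
  have mQf : measurable_fun setT (fun o : obs R d => Q o - f (Xo o)).
    exact: measurable_funB.
  have := mQf measurableT [set 0] (measurable_set1 _).
  rewrite setTI; congr measurable; apply/seteqP; split=> o /= /eqP.
    by rewrite subr_eq0 => /eqP.
  by rewrite -subr_eq0 => /eqP.
split=> //; first exact: ess_bounded_integrable bfX.
move=> B mB; apply: ae_eq_integral.
- by rewrite -[X in measurable X]setTI; exact: measurable_Xo.
- by apply: measurable_funTS; apply/measurable_EFinP.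
- by apply: measurable_funTS; apply/measurable_EFinP.
- by apply: filterS QfX => o -> .
Qed.

End noiseless.

Section extension.
Context (R : realType) (d : nat).
Local Notation U := (unif R d).

Let cl (t : R) := Num.max 0 (Num.min 1 t).

Let cl01 t : 0 <= cl t <= 1.
Proof. by rewrite /cl le_max lexx/= ge_max ler01 ge_min lexx. Qed.

(** The projection on the cube; composing with it turns a function that is controlled
    on the cube only into a measurable function on the whole space. *)
Definition clamp (x : point R d) : point R d := [tuple of map cl x].

Lemma clamp_cube x : cube (clamp x).
Proof. by move=> i; rewrite tnth_map. Qed.

Lemma clampE x : cube x -> clamp x = x.
Proof.
move=> cx; apply: eq_from_tnth => i; rewrite tnth_map.
by have /andP[x0 x1] := cx i; rewrite /cl min_r// max_r.
Qed.

(** The pointwise limit of the functions that are constant on the cells of a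
    regular grid. *)
Lemma measurable_clamp h : unif_cont h -> measurable_fun setT (h \o clamp).
Proof.
move=> uc.
pose N0 (N : nat) : R := N.+1%:R.
have N0_gt0 N : 0 < N0 N by rewrite ltr0n.
pose q N (x : point R d) i : nat := Num.truncn (N0 N * cl (tnth x i)).
have q_lt N x i : (q N x i < N.+2)%N.
  rewrite ltnS -[leqRHS](@natrK R) le_truncn//.
  by rewrite -[leRHS]mulr1 ler_wpM2l ?(ltW (N0_gt0 N))//; case/andP: (cl01 (tnth x i)).
pose qf N x : {ffun 'I_d -> 'I_N.+2} := [ffun i => Ordinal (q_lt N x i)].
pose g N (k : {ffun 'I_d -> 'I_N.+2}) : point R d := [tuple (k i)%:R / N0 N | i < d].
pose hN N x := h (g N (qf N x)).
have hNE N x : hN N x = \sum_(k : {ffun 'I_d -> 'I_N.+2})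
    h (g N k) * \prod_i (q N x i == k i)%:R.
  rewrite (bigD1 (qf N x))//= [X in _ + X]big1 ?addr0 => [|k kq].
    by rewrite big1 ?mulr1// => i _; rewrite ffunE eqxx.
  have [i ki] : exists i, k i != qf N x i.
    apply/existsP; apply: contraNT kq => /existsPn h'; apply/eqP/ffunP => i.
    by apply/eqP; have := h' i; rewrite negbK.
  rewrite (bigD1 i)//= [(q N x i == k i)](_ : _ = false) ?mul0r ?mulr0//.
  apply/negbTE; apply: contra ki => /eqP qk; apply/eqP/val_inj.
  by rewrite ffunE.
have mcl : measurable_fun setT cl.
  apply: measurable_maxr; first exact: measurable_cst.
  by apply: measurable_minr; [exact: measurable_cst|exact: measurable_id].
have mhN N : measurable_fun setT (hN N).
  rewrite (_ : hN N = fun x => \sum_(k : {ffun 'I_d -> 'I_N.+2})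
    h (g N k) * \prod_i (q N x i == k i)%:R); last by apply/funext => x; exact: hNE.
  apply: measurable_sum => k; apply: measurable_funM => //.
  apply: measurable_prod => i _.
  have mlev : measurable [set x | q N x i = k i :> nat].
    rewrite (_ : [set _ | _] = (fun x => N0 N * cl (tnth x i)) @^-1`
        [set` `[(k i)%:R, (k i).+1%:R[]).
      rewrite -[X in measurable X]setTI.
      have mNg : measurable_fun setT (fun x : point R d => N0 N * cl (tnth x i)).
        apply: measurable_funM => //; apply: measurableT_comp => //.
        exact: measurable_tnth.
      by apply: mNg => //; exact: measurable_itv.
    have c0 x : 0 <= N0 N * cl (tnth x i).
      by rewrite mulr_ge0 ?(ltW (N0_gt0 N))//; case/andP: (cl01 (tnth x i)).
    apply/seteqP; split=> x /=; rewrite in_itv/=.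
      by move=> <-; apply: truncn_itv.
    exact: truncn_def.
  rewrite (_ : (fun x => _) = \1_[set x | q N x i = k i :> nat]).
    exact: measurable_indic.
  apply/funext => x; rewrite indicE; congr (_%:R); congr nat_of_bool.
  by apply/idP/idP => [/eqP h'|/set_mem /= ->//]; exact/mem_set.
apply: (measurable_fun_cvg (h := hN)) => //.
move=> x _ /=; apply/cvgrPdist_lt => eps eps0.
have [delta delta0 hd] := uc _ eps0.
exists (Num.truncn delta^-1) => // N /= dN.
apply: hd; first exact: clamp_cube.
  move=> i; rewrite tnth_mktuple divr_ge0//= ?(ltW (N0_gt0 N))//.
  by rewrite ler_pdivrMr// mul1r ler_nat -ltnS.
move=> i; rewrite tnth_mktuple ffunE tnth_map/=.
have c0 : 0 <= N0 N * cl (tnth x i).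
  by rewrite mulr_ge0 ?(ltW (N0_gt0 N))//; case/andP: (cl01 (tnth x i)).
have /andP[le1 lt1] := truncn_itv c0.
have Nn0 : N0 N != 0 by rewrite gt_eqF.
rewrite (_ : _ - _ = (N0 N * cl (tnth x i) - (q N x i)%:R) / N0 N); last by field.
rewrite ger0_norm; last by rewrite divr_ge0 ?subr_ge0// ltW.
rewrite ltr_pdivrMr//; apply: (@lt_le_trans _ _ 1).
  by rewrite ltrBlDr addrC natr1.
rewrite -ler_pdivrMl// mulr1; apply: le_trans (ltW (truncnS_gt _)) _.
by rewrite /N0 ler_nat.
Qed.

End extension.

Section lower_bound.
Context (R : realType) (d S J0 : nat) (W : cdv_basis R d S J0).
Local Notation U := (unif R d).

Lemma inner_meanD f g h : ess_bounded U f -> ess_bounded U g -> ess_bounded U h ->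
  inner (fun x => f x + g x) h = inner f h + inner g h.
Proof.
move=> bf bg bh; have [mf _] := bf; have [mg _] := bg; have [mh _] := bh.
rewrite !inner_mean//; last exact: measurable_funD.
rewrite -meanD; [|exact: ess_boundedM..].
by apply: eq_mean => x; rewrite mulrDl.
Qed.

Lemma inner_meanN f h : ess_bounded U f -> ess_bounded U h ->
  inner (fun x => - f x) h = - inner f h.
Proof.
move=> bf bh; have [mf _] := bf; have [mh _] := bh.
rewrite !inner_mean//; last by case: (ess_boundedN bf).
rewrite -mulN1r -meanZ; last exact: ess_boundedM.
by apply: eq_mean => x; rewrite mulN1r mulNr.
Qed.

Lemma eq_holder_ball a M f g : (forall x, cube x -> f x = g x) ->
  holder_ball W a M f -> holder_ball W a M g.
Proof.
move=> fg [uf fM]; split.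
  move=> eps /uf[delta d0 h]; exists delta => // x y cx cy xy.
  by rewrite -!fg//; exact: h.
rewrite (eq_bigr (fun m => `|inner f (Phi m)|)); last first.
  by move=> m _; rewrite (eq_inner _ fg).
apply: le_trans fM; apply: leeD => //.
apply: ereal_sup_le => _ [l [iota [m [l0 ->]]]].
by exists l, iota, m; rewrite (eq_inner _ fg).
Qed.

Lemma holder_ballN a M f : ess_bounded U f -> holder_ball W a M f ->
  holder_ball W a M (fun x => - f x).
Proof.
move=> bf [uf fM]; split.
  move=> eps /uf[delta d0 h]; exists delta => // x y cx cy xy.
  by rewrite -opprD normrN; exact: h.
rewrite (eq_bigr (fun m => `|inner f (Phi m)|)); last first.
  by move=> m _; rewrite inner_meanN ?normrN//; exact: ess_bounded_Phi.
apply: le_trans fM; apply: leeD => //.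
apply: ereal_sup_le => _ [l [iota [m [l0 ->]]]].
exists l, iota, m; split=> //; rewrite inner_meanN ?normrN//.
exact: ess_bounded_Psi.
Qed.

Lemma holder_ballD a M1 M2 f g : ess_bounded U f -> ess_bounded U g ->
  holder_ball W a M1 f -> holder_ball W a M2 g ->
  holder_ball W a (M1 + M2) (fun x => f x + g x).
Proof.
move=> bf bg [uf fM] [ug gM]; split.
  move=> eps eps0; have e2 : 0 < eps / 2 by rewrite divr_gt0.
  have [d1 d10 h1] := uf _ e2; have [d2 d20 h2] := ug _ e2.
  exists (Num.min d1 d2) => [|x y cx cy xy]; first by rewrite lt_min d10.
  rewrite (_ : _ - _ = (f x - f y) + (g x - g y)); last by ring.
  apply: (le_lt_trans (ler_normD _ _)); rewrite [ltRHS]splitr; apply: ltrD.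
    by apply: h1 => // i; have := xy i; rewrite lt_min => /andP[].
  by apply: h2 => // i; have := xy i; rewrite lt_min => /andP[].
rewrite EFinD; apply: le_trans (leeD fM gM).
rewrite addeACA -EFinD; apply: leeD.
  rewrite lee_fin -mulrDr ler_wpM2l ?powR_ge0//.
  apply/bigmax_leP; split.
    rewrite addr_ge0//; elim/big_ind: _ => // x y x0 y0; rewrite le_max x0//.
  move=> m _; rewrite inner_meanD//; last exact: ess_bounded_Phi.
  by apply: (le_trans (ler_normD _ _)); apply: lerD; exact: le_bigmax.
apply: ge_ereal_sup => _ [l [iota [m [l0 ->]]]].
rewrite inner_meanD//; last exact: ess_bounded_Psi.
apply: (@le_trans _ _ ((2 `^ (l%:R * (a + d%:R / 2)) * `|inner f (Psi iota m)|)%:E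
   + (2 `^ (l%:R * (a + d%:R / 2)) * `|inner g (Psi iota m)|)%:E)%E).
  by rewrite -EFinD lee_fin -mulrDr ler_wpM2l ?powR_ge0// ler_normD.
by apply: leeD; apply: ereal_sup_ubound; exists l, iota, m.
Qed.

Lemma ess_bounded_range (f : point R d -> R) C1 C2 : measurable_fun setT f ->
  (forall x, cube x -> C1 <= f x <= C2) -> ess_bounded U f.
Proof.
move=> mf fC; split=> //; exists (`|C1| + `|C2|).
by apply: filterS (ae_cube R d) => x /fC; exact: bound_of_range.
Qed.

Lemma bias_formC n j p b : bias_form W n j p b = bias_form W n j b p.
Proof.
rewrite /bias_form /bias_value; congr (_ - _ * _ - _ * _).
- by apply: eq_mean => x; rewrite mulrC.
- by apply: eq_bigr => m _; rewrite mulrC.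
- by apply: eq_mean => x; rewrite [p x * _]mulrC.
Qed.

Lemma bias_form_lin n j c p p' b : (J0 <= j)%N ->
  ess_bounded U p -> ess_bounded U p' -> ess_bounded U b ->
  bias_form W n j (fun x => p x + c * p' x) b
    = bias_form W n j p b + c * bias_form W n j p' b.
Proof.
move=> j0 bp bp' bb; have bK := ess_bounded_kernel W j0.
have bPhi (m : Z W j) := ess_bounded_Phi m j0.
have lin h : ess_bounded U h -> mean U (fun x => (p x + c * p' x) * h x)
    = mean U (fun x => p x * h x) + c * mean U (fun x => p' x * h x).
  move=> bh; rewrite -meanZ; last exact: ess_boundedM.
  rewrite -meanD; [|exact: ess_boundedM|by apply: ess_boundedZ; exact: ess_boundedM].
  by apply: eq_mean => x; rewrite mulrDl mulrA.
have assoc q : mean U (fun x => q x * b x * proj_kernel W j x x)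
    = mean U (fun x => q x * (b x * proj_kernel W j x x)).
  by apply: eq_mean => x; rewrite mulrA.
rewrite /bias_form /bias_value !assoc !lin//; last exact: ess_boundedM.
set s := \sum_m _; set s1 := \sum_m _; set s2 := \sum_m _.
have -> : s = s1 + c * s2.
  rewrite /s /s1 /s2 mulr_sumr -big_split/=; apply: eq_bigr => m _.
  by rewrite lin// mulrDl mulrA.
by ring.
Qed.

Lemma bias_form_linr n j c p b b' : (J0 <= j)%N ->
  ess_bounded U p -> ess_bounded U b -> ess_bounded U b' ->
  bias_form W n j p (fun x => b x + c * b' x)
    = bias_form W n j p b + c * bias_form W n j p b'.
Proof.
by move=> j0 bp bb bb'; rewrite bias_formC bias_form_lin// !(bias_formC _ _ p).
Qed.

Section fixed_constants.
Variables (C1 C2 alpha beta M : R).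

Lemma noiseless_bias_le n j p b : (0 < n)%N -> (J0 <= j)%N ->
  measurable_fun setT p -> measurable_fun setT b ->
  (forall x, cube x -> C1 <= p x <= C2) -> (forall x, cube x -> C1 <= b x <= C2) ->
  holder_ball W alpha M p -> holder_ball W beta M b ->
  (`|bias_form W n j p b|%:E <= max_abs_bias W C1 C2 alpha beta M n j)%E.
Proof.
move=> n0 j0 mp mb pC bC hp hb.
have bp := ess_bounded_range mp pC; have bb := ess_bounded_range mb bC.
pose P := noiseless_law mp mb.
have PX := @noiseless_Xo _ _ _ _ mp mb : forall B, measurable B -> P (@Xo R d @^-1` B) = U B.
have cp : is_cond_exp P (@Ao R d) p.
  by apply: noiseless_cond_exp => //; exact: measurable_Ao.
have cb : is_cond_exp P (@Yo R d) b.
  by apply: noiseless_cond_exp => //; exact: measurable_Yo.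
have mrange (Q : obs R d -> R) : measurable_fun setT Q -> measurable [set o | C1 <= Q o <= C2].
  move=> mQ; have := mQ measurableT [set` `[C1, C2]] (measurable_itv _).
  by rewrite setTI; congr measurable; apply/seteqP; split=> o/=; rewrite in_itv.
have rA : {ae P, forall o, C1 <= Ao o <= C2}.
  apply: (@ae_noiseless _ _ p b mp mb [set o | C1 <= Ao o <= C2]).
    by apply: mrange; exact: measurable_Ao.
  by move=> x cx; exact: pC.
have rY : {ae P, forall o, C1 <= Yo o <= C2}.
  apply: (@ae_noiseless _ _ p b mp mb [set o | C1 <= Yo o <= C2]).
    by apply: mrange; exact: measurable_Yo.
  by move=> x cx; exact: bC.
pose c : R := `|C1| + `|C2|.
have Ac : {ae P, forall o, `|Ao o| <= c} by apply: filterS rA => o; exact: bound_of_range.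
have Yc : {ae P, forall o, `|Yo o| <= c} by apply: filterS rY => o; exact: bound_of_range.
have bA : ess_bounded P (@Ao R d) by split; [exact: measurable_Ao|exists c].
have bY : ess_bounded P (@Yo R d) by split; [exact: measurable_Yo|exists c].
have bK := ess_bounded_Xo PX (ess_bounded_kernel W j0).
apply: ereal_sup_ubound; exists P.
  by split=> //; [exists p|exists b].
rewrite (biasE W PX Ac Yc cp cb j0 n0) abse_EFin; congr (`|bias_value _ _ _ _ _ _|%:E).
exact: (mean_noiseless (ess_boundedM (ess_boundedM bA bY) bK)).
Qed.

(** Averaging [s t F(p + s g, b + t g')] over the four sign pairs leaves
    [F(g, g')], for the bilinear form [F] of the bias. *)
Lemma perturbation_bias_le n j p b g g' : (0 < n)%N -> (J0 <= j)%N ->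
  ess_bounded U p -> ess_bounded U b -> ess_bounded U g -> ess_bounded U g' ->
  (forall s t : bool, (`|bias_form W n j (fun x => p x + (-1) ^+ s * g x)
     (fun x => b x + (-1) ^+ t * g' x)|%:E <= max_abs_bias W C1 C2 alpha beta M n j)%E) ->
  (`|bias_form W n j g g'|%:E <= max_abs_bias W C1 C2 alpha beta M n j)%E.
Proof.
move=> n0 j0 bp bb bg bg'; set mx := max_abs_bias _ _ _ _ _ _ _ _.
case: mx => [r| |] H; last 2 first.
- exact: leey.
- by have := H true true; rewrite leeNy_eq.
have {}H (s t : bool) : `|bias_form W n j (fun x => p x + (-1) ^+ s * g x)
     (fun x => b x + (-1) ^+ t * g' x)| <= r by have := H s t; rewrite lee_fin.
have E (s t : bool) : bias_form W n j (fun x => p x + (-1) ^+ s * g x)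
     (fun x => b x + (-1) ^+ t * g' x) =
    bias_form W n j p b + (-1) ^+ t * bias_form W n j p g'
    + (-1) ^+ s * (bias_form W n j g b + (-1) ^+ t * bias_form W n j g g').
  rewrite bias_form_lin//; last by apply: ess_boundedD => //; exact: ess_boundedZ.
  by rewrite !bias_form_linr.
have := (H true true, H true false, H false true, H false false).
rewrite !E expr0 expr1 lee_fin.
set F0 := bias_form W n j p b; set F1 := bias_form W n j p g'.
set F2 := bias_form W n j g b; set F3 := bias_form W n j g g'.
rewrite !ler_norml => -[[[/andP[? ?] /andP[? ?]] /andP[? ?]] /andP[? ?]].
by apply/andP; split; lra.
Qed.

(** Strict feasibility leaves room to add waves of Hoelder-calibrated amplitude to
    both regression functions, with either sign. *)
Lemma wave_bias_le Omega : 0 < alpha -> 0 < beta -> alpha < S%:R -> beta < S%:R ->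
  0 <= Omega -> strictly_feasible W C1 C2 alpha M -> strictly_feasible W C1 C2 beta M ->
  exists2 gamma, 0 < gamma & forall n j s (w : 'I_d -> R), (0 < n)%N -> (J0 <= j)%N ->
    (forall i, `|w i| <= Omega * 2 ^+ s) ->
    ((gamma * (2 `^ (- (s%:R * alpha)) * 2 `^ (- (s%:R * beta)))
       * `|bias_form W n j (wave w) (wave w)|)%:E
     <= max_abs_bias W C1 C2 alpha beta M n j)%E.
Proof.
move=> a0 b0 aS bS Omega0 fa fb.
have step a : 0 < a -> a < S%:R -> strictly_feasible W C1 C2 a M ->
    exists2 delta, 0 < delta & exists p : point R d -> R, [/\ measurable_fun setT p,
      ess_bounded U p & forall s (w : 'I_d -> R) (sg : bool),
      (forall i, `|w i| <= Omega * 2 ^+ s) ->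
      let q x := p x + (-1) ^+ sg * (delta * 2 `^ (- (s%:R * a)) * wave w x) in
      (forall x, cube x -> C1 <= q x <= C2) /\ holder_ball W a M q].
  move=> {}a0 {}aS [eps eps0 [h hh hC]].
  have [K K0 KP] := wave_holder W a0 aS Omega0.
  have mp : measurable_fun setT (h \o @clamp R d) by apply: measurable_clamp; case: hh.
  have pE x : cube x -> h x = (h \o @clamp R d) x by move=> cx; rewrite /= clampE.
  have pC x : cube x -> C1 + eps <= (h \o @clamp R d) x <= C2 - eps.
    by move=> cx; rewrite -pE//; exact: hC.
  have bp := ess_bounded_range mp pC.
  have K1 : 0 < K + 1 by rewrite ltr_wpDr// ltW.
  exists (eps / (K + 1)); first by rewrite divr_gt0.
  exists (h \o @clamp R d); split=> // s w sg ws q.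
  pose g x := eps / (K + 1) * 2 `^ (- (s%:R * a)) * wave w x.
  have bg : ess_bounded U g by apply: ess_boundedZ; exact: ess_bounded_waveE.
  have hg : holder_ball W a eps g.
    apply: KP => //; first by rewrite divr_ge0 ?(ltW eps0) ?(ltW K1).
    by rewrite mulrAC ler_pdivrMr// ler_wpM2l ?(ltW eps0)// lerDl.
  split; last first.
    rewrite (_ : M = (M - eps) + eps); last by rewrite subrK.
    have hp := eq_holder_ball pE hh.
    rewrite /q; case: (sg).
      have -> : (fun x => (h \o @clamp R d) x + (-1) ^+ true * g x)
          = (fun x => (h \o @clamp R d) x + - g x).
        by apply/funext => x; rewrite expr1 mulN1r.
      by apply: holder_ballD => //; [exact: ess_boundedN|exact: holder_ballN].
    have -> : (fun x => (h \o @clamp R d) x + (-1) ^+ false * g x)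
        = (fun x => (h \o @clamp R d) x + g x).
      by apply/funext => x; rewrite expr0 mul1r.
    exact: holder_ballD.
  move=> x cx; have /andP[p1 p2] := pC x cx.
  have : `|(-1) ^+ sg * g x| <= eps.
    rewrite normrM normrX normrN1 expr1n mul1r /g 2!normrM.
    rewrite (ger0_norm (powR_ge0 _ _)).
    apply: (@le_trans _ _ (eps * 1 * 1)); last by rewrite !mulr1.
    apply: ler_pM; [by rewrite mulr_ge0 ?powR_ge0|exact: normr_ge0| |exact: cos_max].
    apply: ler_pM; [exact: normr_ge0|exact: powR_ge0| |].
      rewrite ger0_norm; last by rewrite divr_ge0 ?(ltW eps0) ?(ltW K1).
      by rewrite ler_pdivrMr// ler_peMr ?(ltW eps0)// lerDr (ltW K0).
    by rewrite -[leRHS](powRr0 2) ler_powR// ?ler1n// oppr_le0 mulr_ge0// ltW.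
  rewrite ler_norml => /andP[g1 g2]; rewrite /q -/(g x).
  by apply/andP; split; lra.
have [da da0 [p [mp bp pP]]] := step _ a0 aS fa.
have [db db0 [b [mb bb bP]]] := step _ b0 bS fb.
exists (da * db) => [|n j s w n0 j0 ws]; first by rewrite mulr_gt0.
set ta : R := 2 `^ (- (s%:R * alpha)); set tb : R := 2 `^ (- (s%:R * beta)).
have bw := ess_bounded_waveE w.
pose g x := da * ta * wave w x; pose g' x := db * tb * wave w x.
have bg : ess_bounded U g by exact: ess_boundedZ.
have bg' : ess_bounded U g' by exact: ess_boundedZ.
have -> : da * db * (ta * tb) * `|bias_form W n j (wave w) (wave w)|
    = `|bias_form W n j g g'|.
  have b00 : ess_bounded U (fun=> 0 : R) by [].
  have zero q : bias_form W n j (fun=> 0) q = 0.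
    rewrite /bias_form /bias_value.
    have z r : mean U (fun x => 0 * r x) = 0.
      by rewrite -[RHS](mean_cst U); apply: eq_mean => x; rewrite mul0r.
    rewrite z big1 => [|m _]; last by rewrite z mul0r.
    rewrite (@eq_mean _ _ _ _ (fun x => 0 * q x * proj_kernel W j x x)
      (fun x => 0 * (q x * proj_kernel W j x x))) => [|x]; last by rewrite mulrA.
    by rewrite z !mulr0 !subr0.
  have Zl cst q r : ess_bounded U q -> ess_bounded U r ->
      bias_form W n j (fun x => cst * q x) r = cst * bias_form W n j q r.
    move=> bq br; have := bias_form_lin n cst j0 b00 bq br; rewrite zero add0r => <-.
    by congr bias_form; apply/funext => x; rewrite add0r.
  rewrite Zl// bias_formC Zl// !normrM.
  have ta0 : 0 <= ta by exact: powR_ge0.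
  have tb0 : 0 <= tb by exact: powR_ge0.
  rewrite (ger0_norm ta0) (ger0_norm tb0) (ger0_norm (ltW da0)) (ger0_norm (ltW db0)).
  by ring.
apply: (perturbation_bias_le n0 j0 bp bb bg bg') => sg sg'.
have [r1 h1] := pP s w sg ws; have [r2 h2] := bP s w sg' ws.
have m1 : measurable_fun setT (fun x => p x + (-1) ^+ sg * g x).
  by apply: measurable_funD => //; have [] := ess_boundedZ ((-1) ^+ sg) bg.
have m2 : measurable_fun setT (fun x => b x + (-1) ^+ sg' * g' x).
  by apply: measurable_funD => //; have [] := ess_boundedZ ((-1) ^+ sg') bg'.
exact: (noiseless_bias_le n0 j0 m1 m2 r1 r2 h1 h2).
Qed.

(** The energy of the wave outside [V_j] survives, up to a diagonal term of order
    [2^(jd)/n]. *)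
Lemma bias_form_rough n j w : (0 < n)%N -> (J0 <= j)%N ->
  residual W j (wave w) - #|Z W j|%:R / n%:R <= bias_form W n j (wave w) (wave w).
Proof.
move=> n0 j0; have bw := ess_bounded_waveE w; have bK := ess_bounded_kernel W j0.
have nn0 : 0 <= n%:R^-1 :> R by rewrite invr_ge0.
rewrite /bias_form /bias_value /residual.
have -> : mean U (fun x => wave w x ^+ 2) = mean U (fun x => wave w x * wave w x).
  by apply: eq_mean => x; rewrite expr2.
under eq_bigr do rewrite expr2.
set u := mean U _; set s := \sum_m _; set v := mean U _.
have s0 : 0 <= s by apply: sumr_ge0 => m _; rewrite -expr2 sqr_ge0.
have vZ : v <= #|Z W j|%:R.
  rewrite -mean_kernel//; apply: le_mean => //.
    by apply: ess_boundedM => //; exact: ess_boundedM.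
  apply: aeW => x; rewrite -[leRHS]mul1r ler_wpM2r ?kernel_ge0//.
  rewrite -expr2 -real_normK ?num_real// expr_le1//.
  exact: cos_max.
have h1 : n%:R^-1 * v <= n%:R^-1 * #|Z W j|%:R by rewrite ler_wpM2l.
have h2 : 0 <= n%:R^-1 * s by rewrite mulr_ge0.
rewrite -subr_ge0 (_ : _ - _ = (n%:R^-1 * #|Z W j|%:R - n%:R^-1 * v) + n%:R^-1 * s);
  last by ring.
by rewrite addr_ge0// subr_ge0.
Qed.

(** Constants belong to [V_j], so that only the diagonal term remains. *)
Lemma bias_form_constant n j : (0 < n)%N -> (J0 <= j)%N ->
  bias_form W n j (wave (fun=> 0)) (wave (fun=> 0)) = (1 - #|Z W j|%:R) / n%:R.
Proof.
move=> n0 j0.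
have w1 x : wave (fun=> 0 : R) x = 1 :> R.
  by rewrite /wave /phase big1 ?cos0// => i _; rewrite mul0r.
have nn0 : n%:R != 0 :> R by rewrite pnatr_eq0 -lt0n.
have bPhi (m : Z W j) := ess_bounded_Phi m j0.
have oPhi (m m' : Z W j) := mean_Phi_Phi m m' j0.
have b1 : ess_bounded U (fun=> 1 : R) by [].
have e0 : (\sum_(i < d) (fun=> 0%N) i <= S.-1)%N by rewrite big1.
have [c cE] := polynomials W j0 e0.
have parseval : \sum_(m : Z W j) mean U (fun x => 1 * Phi m x) ^+ 2 = 1.
  rewrite -(mean_sqr_span bPhi oPhi (c := c) b1).
    by rewrite -[RHS](mean_cst U); apply: eq_mean => x; rewrite expr1n.
  apply: filterS2 cE (ae_cube R d) => x h cx; rewrite -h//.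
  by symmetry; apply: big1 => i _; exact: expr0.
rewrite /bias_form /bias_value.
have -> : mean U (fun x => wave (fun=> 0) x * wave (fun=> 0) x) = 1.
  by rewrite -[RHS](mean_cst U); apply: eq_mean => x; rewrite !w1 mulr1.
have -> : mean U (fun x => wave (fun=> 0) x * wave (fun=> 0) x * proj_kernel W j x x)
    = #|Z W j|%:R.
  by rewrite -mean_kernel//; apply: eq_mean => x; rewrite !w1 !mul1r.
rewrite (eq_bigr (fun m => mean U (fun x => 1 * Phi m x) ^+ 2)).
  by rewrite parseval; field.
by move=> m _; rewrite expr2; congr (_ * _); apply: eq_mean => x; rewrite w1.
Qed.

End fixed_constants.
End lower_bound.

Section rates.
Context (R : realType) (d S J0 : nat) (W : cdv_basis R d S J0).

(** Two perturbations suffice. A rough wave at scale [2^(-j)] yields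
    [k^(-(alpha+beta)/d)] as long as [k/n] is small, and a constant yields [k/n] as
    long as the dimension of [V_j] exceeds [1], which is the case for [k >= k0]. For
    [k < k0] and [n] large, [k^(-(alpha+beta)/d)] is the larger of the two rates. *)
Lemma bias_lower C1 C2 alpha beta M : (0 < d)%N -> 0 < alpha -> 0 < beta ->
  alpha < S%:R -> beta < S%:R ->
  strictly_feasible W C1 C2 alpha M -> strictly_feasible W C1 C2 beta M ->
  lesssim J0 (bias_rate d alpha beta) (max_abs_bias W C1 C2 alpha beta M).
Proof.
move=> d0 a0 b0 aS bS fa fb.
have [r rP] := rough_wave_exists W d0.
have [c [C0 [c0 cardC]]] := card_Z W.
pose Omega : R := 2 * pi * 2 ^+ r.
have Omega0 : 0 <= Omega by rewrite !mulr_ge0 ?pi_ge0// exprn_ge0.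
have [gamma gamma0 gP] := wave_bias_le a0 b0 aS bS Omega0 fa fb.
pose C := `|C0| + 1; have C_gt0 : 0 < C by rewrite ltr_wpDl.
(* for [k >= k0] the dimension is at least [c k >= 1 + c k / 2] *)
pose k0 := 2 / c; have k00 : 0 < k0 by rewrite divr_gt0.
pose a := (alpha + beta) / d%:R.
have a_gt0 : 0 < a by rewrite divr_gt0 ?addr_gt0 ?ltr0n.
pose rho := k0 `^ (- a); have rho0 : 0 < rho by exact: powR_gt0.
(* for [k/n <= c1] the diagonal term absorbs at most half of the energy [1/4] *)
pose c1 := (8 * C)^-1; have c10 : 0 < c1 by rewrite invr_gt0 mulr_gt0.
pose L := 8 + 2 / c * (1 + 8 * C).
have L0 : 0 < L by rewrite addr_gt0// mulr_gt0// ?addr_gt0 ?mulr_gt0// divr_gt0.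
exists (L / gamma); first by rewrite divr_gt0.
(* for [k < k0], [k/n] is then below both [c1] and [rho <= k^(-(alpha+beta)/d)] *)
exists (Num.truncn (k0 / Num.min c1 rho)).+1 => n j n0' j0.
have n0 : (0 < n)%N by exact: leq_trans n0'.
have nR : 0 < n%:R :> R by rewrite ltr0n.
set mb := max_abs_bias _ _ _ _ _ _ _ _.
set k := resolution R d j.
have k1 : 1 <= k := resolution_ge1 R d j.
have kgt0 : 0 < k by exact: lt_le_trans k1.
set t := k `^ (- a).
have t0 : 0 < t by exact: powR_gt0.
have t1 : t <= 1 by rewrite /t -[leRHS](powRr0 k) ler_powR// oppr_le0 ltW.
have /andP[cZ1 cZ2] := cardC j j0; rewrite -[2 ^+ (j * d)]/k in cZ1 cZ2.
have ZC : #|Z W j|%:R <= C * k.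
  by apply: (le_trans cZ2); rewrite ler_wpM2r ?(ltW kgt0)// (le_trans (ler_norm _))// lerDl.
have oscillation : ((gamma * t * (4^-1 - C * (k / n%:R)))%:E <= mb)%E.
  have [kappa kP] := rP j j0.
  have wb i : `|freq R kappa i| <= Omega * 2 ^+ j.
    rewrite /freq ger0_norm ?mulr_ge0 ?pi_ge0// /Omega -(mulrA (2 * pi)).
    rewrite ler_wpM2l ?mulr_ge0 ?pi_ge0//.
    by rewrite mulrC -exprD -natrX ler_nat; exact: ltn_ord.
  apply: le_trans (gP n j j (freq R kappa) n0 j0 wb); rewrite lee_fin.
  have -> : 2 `^ (- (j%:R * alpha)) * 2 `^ (- (j%:R * beta)) = t.
    rewrite /t /a resolution_powR// -powRD; last by rewrite pnatr_eq0 implybT.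
    by congr (_ `^ _); ring.
  apply: ler_wpM2l; first by rewrite mulr_ge0// ltW.
  apply: le_trans (ler_norm _); apply: le_trans (bias_form_rough W _ n0 j0).
  apply: lerB => //; rewrite mulrA ler_wpM2r// invr_ge0 ltW//.
have diagonal : ((gamma * ((c * k - 1) / n%:R))%:E <= mb)%E.
  have wb i : `|(fun=> 0 : R) (i : 'I_d)| <= Omega * 2 ^+ 0 by rewrite normr0 mulr_ge0.
  apply: le_trans (gP n j 0%N (fun=> 0) n0 j0 wb); rewrite lee_fin.
  rewrite !mul0r oppr0 !powRr0 !mulr1 ler_wpM2l ?(ltW gamma0)//.
  rewrite bias_form_constant// -normrN; apply: le_trans (ler_norm _).
  by rewrite -mulNr opprB ler_wpM2r ?invr_ge0 ?(ltW nR)// lerB.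
have conclude x : (x%:E <= mb)%E -> Num.max t (k / n%:R) <= L / gamma * x ->
    (bias_rate d alpha beta n j <= (L / gamma)%:E * mb)%E.
  move=> xm tx; rewrite /bias_rate -/k -/a -/t.
  apply: (@le_trans _ _ ((L / gamma)%:E * x%:E)%E); first by rewrite -EFinM lee_fin.
  by rewrite lee_wpmul2l// lee_fin divr_ge0 ?(ltW L0) ?(ltW gamma0).
have Lg x : L / gamma * (gamma * x) = L * x by field; rewrite gt_eqF.
have rate2_ge0 : 0 <= k / n%:R by rewrite divr_ge0 ?(ltW kgt0) ?(ltW nR).
have Lge8 : 8 <= L.
  by rewrite lerDl mulr_ge0 ?divr_ge0 ?addr_ge0 ?mulr_ge0 ?(ltW c0) ?(ltW C_gt0).
have C8 : C * c1 = 8^-1 by rewrite /c1; field; rewrite gt_eqF.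
have small : k / n%:R <= c1 -> t <= L / gamma * (gamma * t * (4^-1 - C * (k / n%:R))).
  move=> kn; rewrite -(mulrA gamma) Lg.
  have h1 : 8^-1 <= 4^-1 - C * (k / n%:R).
    have : C * (k / n%:R) <= 8^-1 by rewrite -C8 ler_wpM2l ?(ltW C_gt0).
    by set z := C * _; lra.
  rewrite mulrCA -[leLHS]mulr1 ler_wpM2l ?(ltW t0)//.
  by apply: (@le_trans _ _ (8 * 8^-1)); [rewrite divff|apply: ler_pM].
have [kk0|kk0] := leP k0 k.
  have dk : k / n%:R * (1 + 8 * C) <= L / gamma * (gamma * ((c * k - 1) / n%:R)).
    rewrite Lg.
    have ck2 : c * k / 2 <= c * k - 1.
      have : 2 <= c * k by rewrite mulrC -ler_pdivrMr.
      by set z := c * k; lra.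
    apply: (@le_trans _ _ (2 / c * (1 + 8 * C) * (c * k / 2 / n%:R))).
      by rewrite le_eqVlt; apply/orP; left; apply/eqP; field; rewrite !gt_eqF.
    apply: ler_pM.
    - by rewrite mulr_ge0 ?divr_ge0 ?addr_ge0 ?mulr_ge0 ?(ltW c0) ?(ltW C_gt0).
    - by rewrite !divr_ge0 ?mulr_ge0 ?(ltW c0) ?(ltW kgt0) ?(ltW nR).
    - by rewrite lerDr.
    - by rewrite ler_wpM2r ?invr_ge0 ?(ltW nR).
  have C81 : k / n%:R <= k / n%:R * (1 + 8 * C).
    by rewrite ler_peMr// lerDl mulr_ge0 ?(ltW C_gt0).
  have [kn|kn] := leP (k / n%:R) c1.
    have [tk|kt] := leP t (k / n%:R).
      by apply: conclude diagonal _; rewrite max_r//; exact: le_trans dk.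
    by apply: conclude oscillation _; rewrite max_l ?(ltW kt)//; exact: small.
  apply: conclude diagonal _; apply: le_trans dk; rewrite ge_max C81 andbT.
  apply: (le_trans t1); rewrite mulrDr mulr1 -[leLHS]add0r; apply: lerD => //.
  apply: (@le_trans _ _ (c1 * (8 * C))); first by rewrite mulVf// gt_eqF// mulr_gt0.
  by rewrite ler_wpM2r ?(ltW kn)// mulr_ge0 ?(ltW C_gt0).
have kn : k / n%:R <= Num.min c1 rho.
  have m0 : 0 < Num.min c1 rho by rewrite lt_min c10.
  rewrite ler_pdivrMr// -ler_pdivrMl// mulrC.
  apply: (@le_trans _ _ (k0 / Num.min c1 rho)).
    by rewrite ler_wpM2r ?invr_ge0 ?(ltW m0) ?(ltW kk0).
  by apply: le_trans (ltW (truncnS_gt _)) _; rewrite ler_nat.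
move: kn; rewrite le_min => /andP[knc knr].
apply: conclude oscillation _; rewrite max_l; first exact: small.
apply: (le_trans knr); rewrite /rho /t !powRN lef_pV2 ?posrE ?powR_gt0//.
by apply: ge0_ler_powR; rewrite ?nnegrE ?ltW.
Qed.

End rates.

Theorem theorem5 (R : realType) (d S J0 : nat) (W : cdv_basis R d S J0)
    (C1 C2 alpha beta M : R)
    (d_gt0 : (0 < d)%N) (alpha_gt0 : 0 < alpha) (beta_gt0 : 0 < beta)
    (M_gt0 : 0 < M) (S_gt : Num.max alpha beta < S%:R) :
  [/\ lesssim J0 (max_abs_bias W C1 C2 alpha beta M) (bias_rate d alpha beta),
      (* the converse inequality of the first relation, for nondegenerate
         constants C1, C2, M *)
      strictly_feasible W C1 C2 alpha M -> strictly_feasible W C1 C2 beta M ->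
      lesssim J0 (bias_rate d alpha beta) (max_abs_bias W C1 C2 alpha beta M)
    & lesssim J0 (max_variance W C1 C2 alpha beta M) (@variance_rate R d)].
Proof.
move: S_gt; rewrite gt_max => /andP[aS bS]; split.
- exact: bias_upper.
- exact: bias_lower.
- exact: variance_upper.
Qed.
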